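(* Let $\rho>0$ and $(b_1,b_2)\in\mathbb{R}^2$. Let $\mathbf{P}_{(b_1,b_2)}$ be the distribution on $C([0,\infty),\mathbb{R}^2)$ of the $2$-system of coalescing Brownian motions with speed $\rho$ and initial state $(b_1,b_2)$. Then $\mathbf{P}_{(b_1,b_2)}$ is the unique probability measure on $C([0,\infty),\mathbb{R}^2)$ such that $\mathbf{P}_{(b_1,b_2)}\{(w_1(0),w_2(0))=(b_1,b_2)\}=1$ and the coordinate process $\{(w_1(t),w_2(t)):t\ge0\}$ under $\mathbf{P}_{(b_1,b_2)}$ solves the $(G_0^{(2)},\mathcal{D}^{(2)})$-martingale problem.
   Context: Conventions: $C(E)$ denotes the bounded continuous real functions on $E$ when used as a class of test functions; $C^2(\mathbb{R})$ denotes the functions in $C(\mathbb{R})$ with bounded continuous derivatives up to order two. $C([0,\infty),\mathbb{R}^2)$ is the space of continuous paths with the topology of locally uniform convergence and $(w_1(t),w_2(t))$ is its coordinate process. A Brownian motion with speed $\rho$ is a (real) Brownian motion with quadratic variation $\rho t$. A two-dimensional continuous process $\{(y_1(t),y_2(t)):t\ge0\}$ is a $2$-system of coalescing Brownian motions with speed $\rho>0$ if each $\{y_i(t)\}$ is a Brownian motion with speed $\rho$ and $\{|y_1(t)-y_2(t)|\}$ is a Brownian motion with speed $2\rho$ stopped at the origin (all relative to the common filtration of the system). Equivalently, $y_1,y_2$ are continuous local martingales with $\langle y_i,y_j\rangle(t)=\rho\,(t-t\wedge\tau_{ij})$ for $1\le i,j\le2$, where $\tau_{ij}=\inf\{t\ge0:y_i(t)=y_j(t)\}$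 (so $\tau_{ii}=0$). Let $\mathcal{D}_0^{(2)}$ be the set of $f\in C(\mathbb{R}^2)$ such that $f$ is twice continuously differentiable in each of the open half-planes $\{x_1<x_2\}$ and $\{x_2<x_1\}$ with bounded partial derivatives up to order two, and all these partial derivatives extend to uniformly continuous functions on the closure of each half-plane, with the extensions of $\partial^2f/\partial x_1\partial x_2=\partial^2f/\partial x_2\partial x_1$ equal to $0$ on $\{x_1=x_2\}$. Let $\mathcal{D}^{(2)}$ be the set of $f\in\mathcal{D}_0^{(2)}$ such that $x\mapsto f(x,x)$ belongs to $C^2(\mathbb{R})$. For $f\in\mathcal{D}^{(2)}$ let $G_0^{(2)}f=\frac12\rho\left(\frac{\partial^2f}{\partial x_1^2}+\frac{\partial^2f}{\partial x_2^2}\right)$, evaluated on $\{x_1=x_2\}$ through the continuous extensions (the value does not depend on the half-plane used). A continuous process $\{(x_1(t),x_2(t))\}$ solves the $(G_0^{(2)},\mathcal{D}^{(2)})$-martingale problem if for each $f\in\mathcal{D}^{(2)}$ the process $f(x_1(t),x_2(t))-f(x_1(0),x_2(0))-\int_0^tG_0^{(2)}f(x_1(s),x_2(s))\,ds$ is a martingale (relative to the natural filtration of the process). *)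

(* Defs.v *)
From HB Require Import structures.
From mathcomp Require Import all_boot all_order all_algebra.
From mathcomp Require Import all_classical all_reals all_analysis.
Import Order.TTheory GRing.Theory Num.Theory.
Import numFieldNormedType.Exports.

Set Implicit Arguments.
Unset Strict Implicit.
Unset Printing Implicit Defensive.

Local Open Scope classical_set_scope.
Local Open Scope ring_scope.

(* The path space C([0,oo), R^2). The time set is the subtype [0,oo[, so that
   a path carries no data at negative times. *)
Section path_space.
Variable R : realType.

Definition halfline : set R := `[0, +oo[%classic.

Definition cpath := continuousType (set_type halfline) (R * R)%type.

HB.instance Definition _ := Choice.on cpath.

(* locally uniform convergence, i.e. uniform convergence on compact sets *)
HB.instance Definition _ := Topological.copy cpath
  (initial_topology (id : cpath ->
     {family compact, set_type halfline -> (R * R)%type})).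

Let cst0 : set_type halfline -> (R * R)%type := cst (0, 0).

Let cst0_continuous : continuous cst0.
Proof. by move=> x; exact: cst_continuous. Qed.

HB.instance Definition _ := isPointed.Build cpath (mkcts cst0_continuous).

Definition path_space := g_sigma_algebraType (@open cpath).

HB.instance Definition _ := Measurable.on path_space.

(* Coordinate process; times are real numbers and only t >= 0 is relevant
   ([valL] returns a default value at t < 0). *)
Definition coordinate (t : R) (w : path_space) : R * R := valL (w : cpath) t.

End path_space.

Section processes.
Context {R : realType} {d : measure_display} {Omega : measurableType d}.
Variable P : probability Omega R.

Definition natural_filtration (X : R -> Omega -> R * R) (t : R) :
    set (set Omega) :=
  <<s \bigcup_(s in `[0, t]) preimage_set_system setT (X s) measurable >>.

Definition adapted (F : R -> set (set Omega)) (M : R -> Omega -> R) :=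
  forall t : R, 0 <= t -> forall E : set R, measurable E -> F t (M t @^-1` E).

(* The last condition is E[M t | F s] = M s. *)
Definition martingale (F : R -> set (set Omega)) (M : R -> Omega -> R) :=
  [/\ adapted F M,
      forall t : R, 0 <= t -> P.-integrable setT (EFin \o M t) &
      forall s t : R, 0 <= s -> s <= t -> forall A, F s A ->
        (\int[P]_(om in A) (M t om)%:E = \int[P]_(om in A) (M s om)%:E)%E].

Definition continuous_process {V : topologicalType} (X : R -> Omega -> V) :=
  forall om, {within `[0, +oo[, continuous (X ^~ om)}.

(* Brownian motion with speed sigma relative to F, with arbitrary initial
   value. The second argument of [normal_prob] is the standard deviation. *)
Definition brownian (F : R -> set (set Omega)) (sigma : R)
    (B : R -> Omega -> R) :=
  [/\ adapted F B, continuous_process B &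
      forall s t : R, 0 <= s -> s < t ->
        (forall E : set R, measurable E ->
           P [set om | E (B t om - B s om)%R] =
           normal_prob 0 (Num.sqrt (sigma * (t - s))) E) /\
        (forall (A : set Omega) (E : set R), F s A -> measurable E ->
           P (A `&` [set om | E (B t om - B s om)%R]) =
           (P A * P [set om | E (B t om - B s om)%R])%E)].

Definition hitting_origin (B : R -> Omega -> R) (om : Omega) : \bar R :=
  ereal_inf [set t%:E | t in [set t | 0 <= t /\ B t om = 0]].

Definition stopped_at_origin (B : R -> Omega -> R) (t : R) (om : Omega) : R :=
  B (fine (Order.min t%:E (hitting_origin B om))) om.

Definition stopped_brownian (F : R -> set (set Omega)) (sigma : R)
    (Z : R -> Omega -> R) :=
  exists2 B, brownian F sigma B &
    {ae P, forall om, forall t : R, 0 <= t -> Z t om = stopped_at_origin B t om}.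

(* Asking the Brownian motion behind |X.1 - X.2| to live on Omega is no
   restriction: from the meeting time on it can be continued by the increments
   of sqrt 2 * X.1, so that no enlargement of Omega is needed. *)
Definition coalescing_system (rho : R) (X : R -> Omega -> R * R) :=
  let F := natural_filtration X in
  [/\ continuous_process X,
      brownian F rho (fun t om => (X t om).1),
      brownian F rho (fun t om => (X t om).2) &
      stopped_brownian F (2 * rho) (fun t om => `|(X t om).1 - (X t om).2|)].

End processes.

Section domain.
Variable R : realType.
Implicit Types (f g h : R * R -> R) (U : set (R * R)).

Definition axis : set (R * R) := [set (1, 0); (0, 1)].

Definition below : set (R * R) := [set x | x.1 < x.2].
Definition above : set (R * R) := [set x | x.2 < x.1].

Definition twice_continuously_differentiable_on U f :=
  forall x, U x -> forall u, axis u ->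
    [/\ derivable f x u, {for x, continuous ('D_u f)} &
        forall v, axis v ->
          derivable ('D_u f) x v /\ {for x, continuous ('D_v ('D_u f))}].

Definition uniform_extension U g h :=
  unif_continuous (h : subspace (closure U) -> R) /\
  forall x, U x -> h x = g x.

Definition calD0 f :=
  [/\ continuous f, [bounded f x | x in setT] &
      forall U, U = below \/ U = above ->
      [/\ twice_continuously_differentiable_on U f,
          forall u, axis u ->
            [bounded 'D_u f x | x in U] /\
            exists h, uniform_extension U ('D_u f) h &
          forall u v, axis u -> axis v ->
            [bounded 'D_v ('D_u f) x | x in U] /\
            exists2 h, uniform_extension U ('D_v ('D_u f)) h &
              u <> v -> forall a, h (a, a) = 0]].

Definition C2b (g : R -> R) :=
  (forall k, (k <= 2)%N ->
     continuous (derive1n k g) /\ [bounded derive1n k g x | x in setT]) /\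
  (forall k, (k < 2)%N -> forall x : R, derivable (derive1n k g) x 1).

Definition calD f := calD0 f /\ C2b (fun a => f (a, a)).

Definition laplacian f (x : R * R) : R :=
  'D_(1, 0) ('D_(1, 0) f) x + 'D_(0, 1) ('D_(0, 1) f) x.

(* On the diagonal the second derivatives are those extended from [below];
   for f in calD the value is the same with [above]. *)
Definition G0 (rho : R) f (x : R * R) : R :=
  2^-1 * rho *
  (if x.1 == x.2 then lim (laplacian f @ within below (nbhs x))
   else laplacian f x).

End domain.

Section martingale_problem.
Context {R : realType} {d : measure_display} {Omega : measurableType d}.
Variable P : probability Omega R.

Definition solves_martingale_problem (rho : R) (X : R -> Omega -> R * R) :=
  continuous_process X /\
  forall f : R * R -> R, calD f ->
    martingale P (natural_filtration X)
      (fun t om => f (X t om) - f (X 0 om) -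
         \int[lebesgue_measure]_(s in `[0, t]) G0 rho f (X s om)).

End martingale_problem.

(* Main.v *)
Require Import Defs.
From HB Require Import structures.
From mathcomp Require Import all_boot all_order all_algebra.
From mathcomp Require Import all_classical all_reals all_analysis.
From mathcomp Require Import measurable_realfun ring lra.
Import Order.TTheory GRing.Theory Num.Theory.
Import numFieldNormedType.Exports.

(** Existence. Let f be in the domain and let X = (X1, X2) be the coalescing
    pair. Between two times X stays in one closed half-plane, where f has a
    second order Taylor expansion (calD_taylor). So f (X t) - f (X s) is a sum,
    over the steps of a partition of [s, t], of terms of first order, terms
    with a pure second derivative, mixed terms and small remainders. On an
    event of the past, the independence of Brownian increments kills the terms
    of first order, and turns the terms with pure second derivatives into a
    Riemann sum of the time integral of G0 f. In a mixed term, the product a * b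
    of the increments of X1 and X2 is half of a^2 + b^2 - (a - b)^2. Here a^2
    and b^2 both have mean rho * h over a step of length h, and a - b is the
    increment of X1 - X2. As long as the pair is apart, (a - b)^2 is the square
    of an increment of a Brownian motion with speed 2 * rho, so the mean of the
    mixed term is zero; once the pair has met, the mixed derivative of f is
    zero. What remains is the one step of the path in which the pair meets,
    and its contribution is small by bounds on fourth moments
    (coalescing_step_bound, coalescing_one_step, martingale_increment).

    Uniqueness. The waves W a b c = sin (a x1 + b x2 + c) are eigenfunctions of
    the Laplacian, but in general their mixed derivative on the diagonal is not
    zero. This defect disappears for the antisymmetric W a b c - W b a c, whose
    mixed derivative is a multiple of itself. This function vanishes on the
    diagonal, so it can even be multiplied by different constants on the two
    sides without leaving the domain (one_sided_wave_calD). Together with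
    the waves in x1 alone, these are eigenfunctions of G0. For every solution of
    the martingale problem, the integral of an eigenfunction over an event of
    the past therefore decays exponentially in time (eigenfunction_decay), at a
    rate which is the same for all solutions. On the other hand, the integrals
    of these functions determine a finite measure on the plane
    (wave_uniqueness), by Fourier uniqueness on each open half-plane and then
    on the diagonal. By induction on the number of times, two solutions have
    the same finite dimensional distributions, and the finite dimensional
    cylinders generate the Borel sets of the path space
    (path_measurable_cylinders). *)

Set Implicit Arguments.
Unset Strict Implicit.
Unset Printing Implicit Defensive.

Local Open Scope classical_set_scope.
Local Open Scope ring_scope.

(** * Integrals of bounded functions and laws on events *)

Section measure_prelim.
Context d (T : measurableType d) (R : realType).

Lemma bounded_integrable (mu : {measure set T -> \bar R}) (A : set T)
    (f : T -> R) (C : R) : measurable A -> (mu A < +oo)%E ->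
  measurable_fun A f -> (forall x, A x -> `|f x| <= C) ->
  mu.-integrable A (EFin \o f).
Proof.
move=> mA Aoo mf fC; apply: measurable_bounded_integrable => //.
exists C; split; first exact: num_real.
by move=> M CM x Ax; apply: le_trans (fC _ Ax) _; exact: ltW.
Qed.

Lemma bounded_cvg_integral (mu : {measure set T -> \bar R}) (A : set T)
    (f : nat -> T -> R) (g : T -> R) (C : R) :
  measurable A -> (mu A < +oo)%E ->
  (forall n, measurable_fun A (f n)) ->
  (forall n x, A x -> `|f n x| <= C) ->
  (forall x, A x -> f n x @[n --> \oo] --> g x) ->
  \int[mu]_(x in A) f n x @[n --> \oo] --> \int[mu]_(x in A) g x.
Proof.
move=> mA Aoo mf fC fg.
have mg : measurable_fun A g by exact: measurable_fun_cvg fg.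
have gC x : A x -> `|g x| <= C.
  move=> Ax; apply: (cvgr_to_le (cvg_norm (fg x Ax))).
  by apply: nearW => n; exact: fC.
have -> : (fun n => \int[mu]_(x in A) f n x) =
    fine \o (fun n => (\int[mu]_(x in A) (f n x)%:E)%E) by [].
apply: fine_cvg; rewrite /Rintegral fineK; last first.
  exact/integrable_fin_num/(bounded_integrable _ _ _ gC).
apply: (@dominated_cvg _ _ _ mu A mA (fun n => EFin \o f n) (EFin \o g)
  (cst C%:E)).
- by move=> n; exact/measurable_EFinP.
- by move=> x Ax; apply: cvg_EFin; [exact: nearW|exact: fg].
- by [].
- apply: (@bounded_integrable _ _ _ `|C|) => //.
- by move=> n x Ax; rewrite /= lee_fin fC.
Qed.

Lemma integrableD_EFin (mu : {measure set T -> \bar R}) (A : set T)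
    (f g : T -> R) : measurable A ->
  mu.-integrable A (EFin \o f) -> mu.-integrable A (EFin \o g) ->
  mu.-integrable A (EFin \o (fun x => f x + g x)).
Proof.
move=> mA fi gi; have -> : EFin \o (fun x => f x + g x) = ((EFin \o f) \+ (EFin \o g))%E.
  by apply/funext => x /=; rewrite EFinD.
exact: integrableD.
Qed.

Lemma integrableB_EFin (mu : {measure set T -> \bar R}) (A : set T)
    (f g : T -> R) : measurable A ->
  mu.-integrable A (EFin \o f) -> mu.-integrable A (EFin \o g) ->
  mu.-integrable A (EFin \o (fun x => f x - g x)).
Proof.
move=> mA fi gi; have -> : EFin \o (fun x => f x - g x) = ((EFin \o f) \- (EFin \o g))%E.
  by apply/funext => x /=; rewrite EFinB.
exact: integrableB.
Qed.

Lemma integrableZ_EFin (mu : {measure set T -> \bar R}) (A : set T) (k : R)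
    (f : T -> R) : measurable A -> mu.-integrable A (EFin \o f) ->
  mu.-integrable A (EFin \o (fun x => k * f x)).
Proof.
move=> mA fi; have -> : EFin \o (fun x => k * f x) = (fun x => (k%:E * (EFin \o f) x)%E).
  by apply/funext => x /=; rewrite EFinM.
exact: integrableZl.
Qed.

End measure_prelim.

Lemma probability_lty d (T : measurableType d) (R : realType) (P : probability T R) A :
  measurable A -> (P A < +oo)%E.
Proof. by move=> mA; apply: le_lt_trans (probability_le1 P mA) _; rewrite ltry. Qed.

Section image_measure.
Context d (T : measurableType d) d' (T' : measurableType d') (R : realType).
Variables (mu : {measure set T -> \bar R}).

(** The law of X on the event A; its total mass is the measure of A. *)
Definition image_on (A : set T) (mA : measurable A) (X : T -> T')
  (mX : measurable_fun setT X) : {measure set T' -> \bar R} :=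
  @measure_function_pushforward__canonical__measure_function_Measure
    _ _ _ _ _ (mrestr mu mA) X mX.

Lemma image_onE (A : set T) (mA : measurable A) (X : T -> T')
  (mX : measurable_fun setT X) B : image_on mA mX B = mu (X @^-1` B `&` A).
Proof. by []. Qed.

Lemma integrable_mrestr (A : set T) (mA : measurable A) (f : T -> R) :
  measurable_fun setT f -> mu.-integrable A (EFin \o f) ->
  (mrestr mu mA).-integrable setT (EFin \o f).
Proof.
move=> mf /integrableP[_ foo]; apply/integrableP; split.
  exact/measurable_EFinP.
have mfA : measurable_fun setT (fun x => `|(EFin \o f) x|%E).
  by apply: measurableT_comp => //; exact/measurable_EFinP.
rewrite (@ge0_negligible_integral _ _ _ _ setT (~` A)) => //=.
- rewrite setTD setCK (@eq_measure_integral _ _ _ A mu)//.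
  by move=> B mB BA; rewrite /= /mrestr setIidl.
- exact: measurableC.
- by rewrite /mrestr setICl measure0.
Qed.

Lemma Rintegral_mrestr (A : set T) (mA : measurable A) (f : T -> R) :
  measurable_fun setT f -> mu.-integrable A (EFin \o f) ->
  \int[mrestr mu mA]_x f x = \int[mu]_(x in A) f x.
Proof.
move=> mf foo; rewrite /Rintegral; congr fine.
rewrite (@negligible_integral _ _ _ _ setT (~` A)) => //=.
- rewrite setTD setCK; apply: eq_measure_integral.
  by move=> B mB BA; rewrite /= /mrestr setIidl.
- exact: measurableC.
- exact: integrable_mrestr.
- by rewrite /mrestr setICl measure0.
Qed.

Lemma integrable_image_on (A : set T) (mA : measurable A) (X : T -> T')
    (mX : measurable_fun setT X) (f : T' -> R) :
  measurable_fun setT f -> mu.-integrable A (EFin \o (f \o X)) ->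
  (image_on mA mX).-integrable setT (EFin \o f).
Proof.
move=> mf fX; apply: integrable_pushforward => //.
  exact/measurable_EFinP.
by rewrite preimage_setT; apply: integrable_mrestr => //; exact: measurableT_comp.
Qed.

Lemma Rintegral_image_on (A : set T) (mA : measurable A) (X : T -> T')
    (mX : measurable_fun setT X) (f : T' -> R) :
  measurable_fun setT f -> mu.-integrable A (EFin \o (f \o X)) ->
  \int[image_on mA mX]_y f y = \int[mu]_(x in A) f (X x).
Proof.
move=> mf fX; rewrite -(@Rintegral_mrestr A mA (f \o X))//; last first.
  exact: measurableT_comp.
rewrite /Rintegral; congr fine; rewrite integral_pushforward//=.
  exact/measurable_EFinP.
by rewrite preimage_setT; apply: integrable_mrestr => //; exact: measurableT_comp.
Qed.

End image_measure.

(** * Borel functions on the plane *)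

Section borel_plane.
Variable R : realType.

(** The product sigma-algebra contains the open sets because boxes with rational
    endpoints form a countable base. *)
Lemma open_measurable2 (O : set (R * R)) : open O -> measurable O.
Proof.
move=> oO.
pose r (q : (rat * rat) * (rat * rat)) : set (R * R) :=
  `](ratr q.1.1), (ratr q.1.2)[%classic `*` `](ratr q.2.1), (ratr q.2.2)[%classic.
pose D q : set (R * R) := if pselect (r q `<=` O) then r q else set0.
have -> : O = \bigcup_q D q.
  apply/seteqP; split => x; last first.
    by move=> [q _]; rewrite /D; case: pselect => // qO; exact: qO.
  move=> Ox; have : nbhs x O by exact: open_nbhs_nbhs.
  move=> /nbhs_ballP[e /= e0 xe].
  have rd (y : R) : exists q : rat * rat, (y \in `](@ratr R q.1), (@ratr R q.2)[) /\
      forall z, (z \in `](@ratr R q.1), (@ratr R q.2)[) -> ball y e z.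
    have [|q1] := @rat_in_itvoo R (y - e) y; first by rewrite gtrBl.
    rewrite in_itv/= => /andP[q1l q1r].
    have [|q2] := @rat_in_itvoo R y (y + e); first by rewrite ltrDl.
    rewrite in_itv/= => /andP[q2l q2r].
    exists (q1, q2); rewrite in_itv/= q1r q2l; split => // z.
    rewrite in_itv/= => /andP[z1 z2]; rewrite /ball/= distrC ltr_distl.
    by rewrite (lt_trans q1l z1) (lt_trans z2 q2r).
  have [q1 [x1 h1]] := rd x.1; have [q2 [x2 h2]] := rd x.2.
  exists (q1, q2) => //; rewrite /D; case: pselect => [h|]; first by split.
  by case=> z [/= z1 z2]; apply: xe; split; [exact: h1|exact: h2].
apply: countable_bigcupT_measurable => // q; rewrite /D.
by case: pselect => h; [exact: measurableX|exact: measurable0].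
Qed.

Lemma continuous_measurable_fun2 (f : R * R -> R) :
  continuous f -> measurable_fun setT f.
Proof.
move=> cf; apply: (measurability _ (RGenOInfty.measurableE R)) => _ [_ [x ->] <-].
rewrite setTI; apply: open_measurable2; apply: open_comp; last exact: interval_open.
by move=> y _; exact: cf.
Qed.

Lemma open_below : open (@below R).
Proof.
have -> : @below R = (fun x : R * R => x.2 - x.1) @^-1` `]0, +oo[%classic.
  by apply/seteqP; split => x /=; rewrite in_itv/= andbT subr_gt0.
apply: open_comp; last exact: interval_open.
by move=> x _; apply: cvgB; [exact: cvg_snd|exact: cvg_fst].
Qed.

Lemma open_above : open (@above R).
Proof.
have -> : @above R = (fun x : R * R => x.1 - x.2) @^-1` `]0, +oo[%classic.
  by apply/seteqP; split => x /=; rewrite in_itv/= andbT subr_gt0.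
apply: open_comp; last exact: interval_open.
by move=> x _; apply: cvgB; [exact: cvg_fst|exact: cvg_snd].
Qed.

Lemma continuous_pair (p q : R * R -> R) : continuous p -> continuous q ->
  continuous (fun x => (p x, q x)).
Proof. by move=> cp cq x; exact: cvg_pair (cp x) (cq x). Qed.

Lemma continuous_min_coord : continuous (fun x : R * R => Num.min x.1 x.2).
Proof. by move=> x; apply: continuous_min; [exact: cvg_fst|exact: cvg_snd]. Qed.

Lemma continuous_max_coord : continuous (fun x : R * R => Num.max x.1 x.2).
Proof. by move=> x; apply: continuous_max; [exact: cvg_fst|exact: cvg_snd]. Qed.

Lemma continuous_snd2 : continuous (fun x : R * R => x.2).
Proof. by move=> x; exact: cvg_snd. Qed.

Lemma calD_bounded (f : R * R -> R) : calD f ->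
  measurable_fun setT f /\ exists C : R, forall x, `|f x| <= C.
Proof.
move=> [[cf [M [_ hM]] _] _]; split; first exact: continuous_measurable_fun2.
by exists (M + 1) => x; apply: hM => //; rewrite ltrDl.
Qed.

End borel_plane.


(** * Fourier uniqueness in the plane *)

Section trigonometric_polynomials.
Variable R : realType.

Definition wave (a b c : R) (x : R * R) : R := sin (a * x.1 + b * x.2 + c).

(** The phase c lets sines stand for cosines as well. *)
Inductive trigpoly : (R * R -> R) -> Prop :=
| trigpoly_wave a b c : trigpoly (wave a b c)
| trigpolyD f g : trigpoly f -> trigpoly g -> trigpoly (fun x => f x + g x)
| trigpolyZ k f : trigpoly f -> trigpoly (fun x => k * f x).

Lemma trigpolyM f g : trigpoly f -> trigpoly g -> trigpoly (fun x => f x * g x).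
Proof.
move=> tf tg; elim: tf => [a b c|f1 f2 _ h1 _ h2|k f1 _ h1].
- elim: tg => [a' b' c'|g1 g2 _ h1 _ h2|k g1 _ h1].
  + (* sin u sin v = (cos (u - v) - cos (u + v)) / 2, and cos is a shifted sin *)
    have -> : (fun x => wave a b c x * wave a' b' c' x) =
      (fun x => 2^-1 * wave (a - a') (b - b') (c - c' + pi / 2) x +
                (- 2^-1) * wave (a + a') (b + b') (c + c' + pi / 2) x).
      apply/funext => -[x y]; rewrite /wave/=.
      set u := a * x + b * y + c; set v := a' * x + b' * y + c'.
      have -> : (a - a') * x + (b - b') * y + (c - c' + pi / 2) = u - v + pi / 2.
        by rewrite /u /v; ring.
      have -> : (a + a') * x + (b + b') * y + (c + c' + pi / 2) = u + v + pi / 2.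
        by rewrite /u /v; ring.
      by rewrite !sinDpihalf (cosB u v) (cosD u v); field.
    by apply: trigpolyD; apply: trigpolyZ; exact: trigpoly_wave.
  + by under eq_fun do rewrite mulrDr; exact: trigpolyD.
  + by under eq_fun do rewrite mulrCA; exact: trigpolyZ.
- by under eq_fun do rewrite mulrDl; exact: trigpolyD.
- by under eq_fun do rewrite -mulrA; exact: trigpolyZ.
Qed.

Definition smoothstep (y : R) : R := 3 / 2 * y + - 2^-1 * (y * y * y).

Lemma trigpoly_smoothstep n f : trigpoly f ->
  trigpoly (fun x => iter n smoothstep (f x)).
Proof.
move=> tf; elim: n => [//|n ih] /=; rewrite /smoothstep.
apply: trigpolyD; apply: trigpolyZ => //.
by apply: trigpolyM => //; exact: trigpolyM.
Qed.

Lemma iter_smoothstepN n y : iter n smoothstep (- y) = - iter n smoothstep y.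
Proof. by elim: n => //= n ->; rewrite /smoothstep; ring. Qed.

(** Since 1 - smoothstep y = (1 - y) * (1 - (y + y^2) / 2), each iteration
    shrinks the distance to 1 by a factor of at most 1 - y / 2. *)
Lemma iter_smoothstep_near1 n (y : R) : 0 <= y <= 1 ->
  y <= iter n smoothstep y <= 1 /\
  1 - iter n smoothstep y <= (1 - y / 2) ^+ n.
Proof.
move=> /andP[y0 y1]; elim: n => [|n [/andP[ih1 ih2] ih3]] /=.
  by rewrite expr0 lexx y1; split => //; lra.
set z := iter n smoothstep y in ih1 ih2 ih3 *.
have z0 : 0 <= z by lra.
have h : 1 - smoothstep z = (1 - z) * (1 - (z + z * z) / 2).
  by rewrite /smoothstep; field.
have q0 : 0 <= (1 - y / 2) ^+ n by apply: exprn_ge0; lra.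
have zz : 0 <= z * z by exact: mulr_ge0.
split.
  have : 0 <= z * (1 - z) * (1 + z) by rewrite !mulr_ge0//; lra.
  have : 0 <= (1 - z) * (1 - z) * (2 + z) by rewrite !mulr_ge0//; lra.
  by rewrite /smoothstep; nra.
rewrite h exprSr; apply: ler_pM => //; try lra.
have : z * z <= 1 * 1 by apply: ler_pM.
lra.
Qed.

Lemma iter_smoothstep_le1 n (y : R) : `|y| <= 1 -> `|iter n smoothstep y| <= 1.
Proof.
move=> y1; have [y0|y0] := leP 0 y.
  have [|/andP[h1 h2] _] := @iter_smoothstep_near1 n y.
    by rewrite y0 -(ger0_norm y0).
  by rewrite ger0_norm// (le_trans y0).
rewrite -normrN -iter_smoothstepN.
have [|/andP[h1 h2] _] := @iter_smoothstep_near1 n (- y).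
  by rewrite oppr_ge0 ltW//= -(ltr0_norm y0).
by rewrite ger0_norm// (le_trans _ h1)// oppr_ge0 ltW.
Qed.

(** The smoothstep polynomial pushes [-1, 1] minus 0 towards the endpoints, so
    that its iterates are polynomials that approximate the sign function. *)
Lemma cvg_iter_smoothstep (y : R) : `|y| <= 1 ->
  iter n smoothstep y @[n --> \oo] --> Num.sg y.
Proof.
have pos (z : R) : 0 < z -> z <= 1 -> iter n smoothstep z @[n --> \oo] --> (1 : R).
  move=> z0 z1; apply: (@squeeze_cvgr _ _ _ _ (fun n => 1 - (1 - z / 2) ^+ n) (cst 1)).
  - apply: nearW => n.
    have [|/andP[h1 h2] h3] := @iter_smoothstep_near1 n z; first by rewrite z1 ltW.
    by rewrite h2 andbT; lra.
  - rewrite -[X in _ --> X]subr0; apply: cvgB; first exact: cvg_cst.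
    by apply: cvg_expr; rewrite ger0_norm; lra.
  - exact: cvg_cst.
move=> y1; have [y0|y0|->] := ltgtP y 0.
- rewrite ltr0_sg//.
  have -> : (fun n => iter n smoothstep y) = (fun n => - iter n smoothstep (- y)).
    by apply/funext => n; rewrite iter_smoothstepN opprK.
  by apply: cvgN; apply: pos; [rewrite oppr_gt0|rewrite -(ltr0_norm y0)].
- by rewrite gtr0_sg//; apply: pos => //; rewrite -(gtr0_norm y0).
- rewrite sgr0.
  have -> : (fun n => iter n smoothstep 0) = cst (0 : R).
    apply/funext => n; elim: n => //= n ->.
    by rewrite /smoothstep !(mulr0, addr0).
  exact: cvg_cst.
Qed.

End trigonometric_polynomials.

Section fourier_uniqueness.
Variable R : realType.

Lemma measure_eq_rays (m1 m2 : {measure set R -> \bar R}) :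
  (m1 setT < +oo)%E -> (forall c, m1 `]c, +oo[%classic = m2 `]c, +oo[%classic) ->
  forall A, measurable A -> m1 A = m2 A.
Proof.
move=> m1oo m12 A mA; apply: (@measure_unique _ R _ (@RGenOInfty.G R)
  (fun k => `](- k%:R), +oo[%classic) _ _ _ _ m1 m2 _ _ A mA).
- exact: RGenOInfty.measurableE.
- move=> _ _ [x ->] [y ->]; exists (Num.max x y); apply/seteqP; split => z /=.
    by rewrite !in_itv/= !andbT gt_max => -[-> ->].
  by rewrite !in_itv/= !andbT gt_max => /andP[-> ->].
- by move=> k; eexists.
- apply/seteqP; split => // x _; exists (Num.trunc `|x|).+1 => //=.
  rewrite in_itv/= andbT ltrNl.
  apply: (@le_lt_trans _ _ `|x|); first by rewrite -normrN ler_norm.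
  exact: truncnS_gt.
- by move=> _ [x ->].
- by move=> k; apply: le_lt_trans m1oo; apply: le_measure; rewrite ?inE.
Qed.

(** One coordinate at a time: fixing a set for the other coordinate leaves a
    measure on the line, to which the criterion on rays applies. *)
Lemma measure_eq_quadrants (m1 m2 : {measure set (R * R) -> \bar R}) :
  (m1 setT < +oo)%E -> (forall c d, m1 (`]c, +oo[%classic `*` `]d, +oo[%classic) =
                             m2 (`]c, +oo[%classic `*` `]d, +oo[%classic)) ->
  forall A, measurable A -> m1 A = m2 A.
Proof.
move=> m1oo m12.
have fin A : measurable A -> (m1 A < +oo)%E.
  by move=> mA; apply: le_lt_trans m1oo; apply: le_measure; rewrite ?inE.
have half (A : set R) d : measurable A ->
    m1 (A `*` `]d, +oo[%classic) = m2 (A `*` `]d, +oo[%classic).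
  have mD : measurable ([set: R] `*` `]d, +oo[%classic) by exact: measurableX.
  have e (m : {measure set (R * R) -> \bar R}) B :
      m (B `*` `]d, +oo[%classic) = image_on m mD measurable_fst B.
    rewrite image_onE; congr (m _); apply/seteqP; split => -[x y] /=.
      by move=> [].
    by move=> [] ? [].
  move=> mA; rewrite !e; apply: measure_eq_rays => //.
    by rewrite -e; apply: fin; exact: measurableX.
  by move=> c; rewrite -!e.
move=> E mE; apply: (@measure_unique _ R _
   [set A `*` B | A in measurable & B in measurable] (fun=> setT)
   _ _ _ _ m1 m2 _ _ E mE).
- exact: measurable_prod_measurableType.
- move=> _ _ [A mA [B mB <-]] [A' mA' [B' mB' <-]].
  by exists (A `&` A'); [exact: measurableI|exists (B `&` B');
    [exact: measurableI|rewrite setXI]].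
- by move=> _; exists setT => //; exists setT => //; rewrite setXTT.
- by rewrite bigcup_const.
- move=> _ [A mA [B mB <-]].
  have mD : measurable (A `*` [set: R]) by exact: measurableX.
  have e (m : {measure set (R * R) -> \bar R}) C :
      m (A `*` C) = image_on m mD measurable_snd C.
    rewrite image_onE; congr (m _); apply/seteqP; split => -[x y] /=.
      by move=> [].
    by move=> [] ? [].
  rewrite !e; apply: measure_eq_rays => //.
    by rewrite -e; apply: fin; exact: measurableX.
  by move=> c; rewrite -!e half.
- by move=> _; exact: fin.
Qed.

Lemma measurable_wave (a b c : R) : measurable_fun setT (wave a b c).
Proof.
rewrite /wave; apply: (measurableT_comp (continuous_measurable_fun (@continuous_sin R))).
by repeat apply: measurable_funD => //; apply: measurable_funM.
Qed.

Variables m1 m2 : {measure set (R * R) -> \bar R}.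
Hypotheses (m1oo : (m1 setT < +oo)%E) (m2oo : (m2 setT < +oo)%E).
Hypothesis m12 : forall a b c,
  \int[m1]_x wave a b c x = \int[m2]_x wave a b c x.

Let agree (f : R * R -> R) := [/\ measurable_fun setT f, exists C : R, forall x, `|f x| <= C &
  \int[m1]_x f x = \int[m2]_x f x].

Let agree_trigpoly f : trigpoly f -> agree f.
Proof.
have I (m : {measure set (R * R) -> \bar R}) (h : R * R -> R) (K : R) :
    (m setT < +oo)%E -> measurable_fun setT h -> (forall x, `|h x| <= K) ->
    m.-integrable setT (EFin \o h).
  by move=> moo mh hK; apply: (@bounded_integrable _ _ _ m _ _ K).
elim=> [a b c|{}f g _ [mf [C fC] fE] _ [mg [D gD] gE]|k {}f _ [mf [C fC] fE]].
- split => //; first exact: measurable_wave.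
  by exists 1 => x; rewrite ler_norml sin_geN1 sin_le1.
- split; first exact: measurable_funD.
    by exists (C + D) => x; apply: (le_trans (ler_normD _ _)); exact: lerD.
  by rewrite !RintegralD ?fE ?gE//; first [exact: (I _ _ C) | exact: (I _ _ D)].
- split; first exact: measurable_funM.
    by exists (`|k| * C) => x; rewrite normrM ler_wpM2l.
  by rewrite !RintegralZl ?fE//; apply: (I _ _ C).
Qed.

Let agree_lim (f : nat -> R * R -> R) (g : R * R -> R) (C : R) : (forall n, agree (f n)) ->
  (forall n x, `|f n x| <= C) -> (forall x, f n x @[n --> \oo] --> g x) ->
  agree g.
Proof.
move=> fa fC fg.
have mf n : measurable_fun setT (f n) by case: (fa n).
have mg : measurable_fun setT g by exact: measurable_fun_cvg (fun x _ => fg x).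
split => //.
  exists C => x; apply: (cvgr_to_le (cvg_norm (fg x))).
  by apply: nearW => n; exact: fC.
have h (m : {measure set (R * R) -> \bar R}) : (m setT < +oo)%E ->
    \int[m]_x f n x @[n --> \oo] --> \int[m]_x g x.
  by move=> moo; apply: (@bounded_cvg_integral _ _ _ _ _ _ _ C).
apply: (cvg_unique _ (h _ m1oo)) => //=.
rewrite (_ : (fun n => _) = (fun n => \int[m2]_x f n x)); first exact: h.
by apply/funext => n; case: (fa n).
Qed.

(** For large m the sine has the sign of y - c, and (z^2 + z) / 2 sends the signs
    1, 0, -1 to 1, 0, 0; so step tends to the indicator of c < y, and stepper is
    its approximation by iterated smoothsteps. *)
Let stepper (n m : nat) (c y : R) : R :=
  let z := iter n (@smoothstep R) (sin ((y - c) / m.+1%:R)) in 2^-1 * (z * z + z).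

Let step (m : nat) (c y : R) : R :=
  let z := Num.sg (sin ((y - c) / m.+1%:R)) in 2^-1 * (z * z + z).

Let half_le1 (z : R) : `|z| <= 1 -> `|2^-1 * (z * z + z)| <= 1.
Proof.
rewrite !ler_norml => /andP[z1 z2].
have : 0 <= (1 - z) * (1 + z) by rewrite mulr_ge0//; lra.
have : 0 <= z * z by rewrite -expr2 sqr_ge0.
nra.
Qed.

Let sin_le (y : R) : `|sin y| <= 1.
Proof. by rewrite ler_norml sin_geN1 sin_le1. Qed.

Let stepper_le1 n m c y : `|stepper n m c y| <= 1.
Proof. by rewrite /stepper; apply: half_le1; exact: iter_smoothstep_le1. Qed.

Let step_le1 m c y : `|step m c y| <= 1.
Proof.
rewrite /step; apply: half_le1; set z := sin _.
by case: (sgrP z) => _; rewrite ?normr0 ?normrN ?normr1.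
Qed.

Let cvg_stepper m c y : stepper n m c y @[n --> \oo] --> step m c y.
Proof.
rewrite /stepper /step; apply: cvgM; first exact: cvg_cst.
have := @cvg_iter_smoothstep R _ (sin_le ((y - c) / m.+1%:R)) => h.
by apply: cvgD => //; exact: cvgM.
Qed.

Let cvg_step c y : step m c y @[m --> \oo] --> ((c < y)%R%:R : R).
Proof.
apply: cvg_near_cst.
have [N yN] : exists N : nat, `|y - c| <= N%:R.
  by exists (Num.trunc `|y - c|).+1; apply/ltW/truncnS_gt.
exists N => // m /= Nm; rewrite /step.
have b : `|(y - c) / m.+1%:R| <= 1.
  rewrite normrM normfV (ger0_norm (ler0n _ m.+1)) ler_pdivrMr// mul1r.
  by rewrite (le_trans yN)// ler_nat ltnW.
have := @pi_ge2 R => pi2.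
have m0 : 0 < m.+1%:R^-1 :> R by rewrite invr_gt0.
have [cy|yc|<-] := ltgtP c y; last first.
- by rewrite subrr mul0r sin0 sgr0 !(mulr0, addr0).
- rewrite ltr0_sg; first by rewrite mulrNN mulr1 subrr mulr0.
  rewrite -[X in sin X]opprK sinN oppr_lt0; apply: sin_gt0_pi.
  move: b; rewrite ler_norml => /andP[b1 b2].
  have : (y - c) / m.+1%:R < 0 by rewrite pmulr_llt0// subr_lt0.
  by move: {m0} b1 b2; move: (_ / _) => z b1 b2 z0; apply/andP; split; lra.
- rewrite gtr0_sg; first by rewrite mulr1 -[1 + 1]/2 mulVf.
  apply: sin_gt0_pi.
  move: b; rewrite ler_norml => /andP[b1 b2].
  have : 0 < (y - c) / m.+1%:R by rewrite mulr_gt0// subr_gt0.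
  by move: {m0} b1 b2; move: (_ / _) => z b1 b2 z0; apply/andP; split; lra.
Qed.

(** Trigonometric polynomials approximate indicators of quadrants boundedly
    and pointwise, so their integrals determine a finite measure. *)
Lemma fourier_uniqueness A : measurable A -> m1 A = m2 A.
Proof.
apply: measure_eq_quadrants => // c d.
suff [_ _] : agree \1_(`]c, +oo[%classic `*` `]d, +oo[%classic).
  have mX : measurable (`]c, +oo[%classic `*` `]d, +oo[%classic).
    exact: measurableX.
  rewrite /Rintegral !integral_indic// setIT.
  have f1 : m1 (`]c, +oo[%classic `*` `]d, +oo[%classic) \is a fin_num.
    by rewrite ge0_fin_numE// (le_lt_trans _ m1oo)// le_measure ?inE.
  have f2 : m2 (`]c, +oo[%classic `*` `]d, +oo[%classic) \is a fin_num.
    by rewrite ge0_fin_numE// (le_lt_trans _ m2oo)// le_measure ?inE.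
  by move=> e; rewrite -(fineK f1) -(fineK f2) e.
have trig n (f : R * R -> R) : trigpoly f ->
    trigpoly (fun x => 2^-1 * (iter n (@smoothstep R) (f x) *
       iter n (@smoothstep R) (f x) + iter n (@smoothstep R) (f x))).
  move=> tf; apply: trigpolyZ; apply: trigpolyD; [apply: trigpolyM|];
    exact: trigpoly_smoothstep.
have e1 m x : sin ((x.1 - c) / m.+1%:R) = wave m.+1%:R^-1 0 (- c / m.+1%:R) x.
  by rewrite /wave; congr sin; ring.
have e2 m x : sin ((x.2 - d) / m.+1%:R) = wave 0 m.+1%:R^-1 (- d / m.+1%:R) x.
  by rewrite /wave; congr sin; ring.
apply: (@agree_lim (fun m x => step m c x.1 * step m d x.2) _ 1); last first.
- move=> [x y] /=.
  rewrite (_ : \1_ _ _ = (c < x)%R%:R * (d < y)%R%:R); last first.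
    rewrite -natrM mulnb indicE; congr (_%:R : R); congr nat_of_bool.
    by rewrite in_setX !mem_setE/= !in_itv/= !andbT.
  by apply: cvgM; exact: cvg_step.
- by move=> m x; rewrite normrM mulr_ile1.
move=> m; apply: (@agree_lim (fun n x => stepper n m c x.1 * stepper n m d x.2) _ 1).
- move=> n; apply: agree_trigpoly; apply: trigpolyM; rewrite /stepper.
    have := @trig n _ (trigpoly_wave m.+1%:R^-1 0 (- c / m.+1%:R)).
    by under eq_fun do rewrite -!e1.
  have := @trig n _ (trigpoly_wave 0 m.+1%:R^-1 (- d / m.+1%:R)).
  by under eq_fun do rewrite -!e2.
- by move=> n x; rewrite normrM mulr_ile1.
- by move=> x; apply: cvgM; exact: cvg_stepper.
Qed.

End fourier_uniqueness.

(** * Measures determined by antisymmetric waves *)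

Lemma addeI_fin (R : realType) (x y z : \bar R) :
  x \is a fin_num -> (x + y = x + z)%E -> y = z.
Proof. by case: x => // x; case: y => [y||]; case: z => [z||] // _ [/addrI ->]. Qed.

Section half_planes.
Variable R : realType.

Lemma measurable_below : measurable (@below R).
Proof. exact: open_measurable2 (@open_below R). Qed.

Lemma measurable_above : measurable (@above R).
Proof. exact: open_measurable2 (@open_above R). Qed.

Definition antiwave (a b c : R) (x : R * R) := wave a b c x - wave b a c x.

(** The jump of the factor across the diagonal is harmless because antiwave
    vanishes there. *)
Definition one_sided_wave (p q a b c : R) (x : R * R) :=
  (if x.1 < x.2 then p else q) * antiwave a b c x.

Definition swap (x : R * R) := (x.2, x.1).

Variables mu nu : {measure set (R * R) -> \bar R}.
Hypotheses (muoo : (mu setT < +oo)%E) (nuoo : (nu setT < +oo)%E).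

(** On D, put the part of mu next to the mirror image of the part of nu, and vice
    versa. Integrals of antisymmetric functions over D say that waves do not
    distinguish the two sums; so these are equal, and mu and nu agree on D
    because the mirror image of D is disjoint from D. *)
Lemma antisymmetric_uniqueness (D : set (R * R)) : measurable D ->
  D `&` swap @^-1` D = set0 ->
  (forall a b c, \int[mu]_(x in D) antiwave a b c x =
                 \int[nu]_(x in D) antiwave a b c x) ->
  forall B, measurable B -> B `<=` D -> mu B = nu B.
Proof.
move=> mD DD0 munu.
have ms : measurable_fun setT (swap).
  by apply: measurable_fun_pair.
have mi : measurable_fun setT (@id (R * R)) by [].
pose m (l1 l2 : {measure set (R * R) -> \bar R}) : {measure set (R * R) -> \bar R} :=
  measure_add (image_on l1 mD mi) (image_on l2 mD ms).
have maddE (l1 l2 : {measure set (R * R) -> \bar R}) B :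
    m l1 l2 B = (image_on l1 mD mi B + image_on l2 mD ms B)%E.
  exact: measure_addE.
have mE (l1 l2 : {measure set (R * R) -> \bar R}) B : B `<=` D -> m l1 l2 B = l1 B.
  move=> BD; rewrite maddE !image_onE/= preimage_id (setIidl BD).
  rewrite (_ : _ `&` D = set0) ?measure0 ?adde0//.
  by apply/seteqP; split => // x /= [/BD h1 h2]; have : (D `&` swap @^-1` D) x by []; rewrite DD0.
have fin (l : {measure set (R * R) -> \bar R}) A : (l setT < +oo)%E ->
    measurable A -> (l A < +oo)%E.
  by move=> loo mA; apply: le_lt_trans loo; apply: le_measure; rewrite ?inE.
have w1 a b c x : `|wave a b c x| <= 1 :> R.
  by rewrite ler_norml sin_geN1 sin_le1.
have ws a b c x : wave a b c (swap x) = wave b a c x :> R.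
  by rewrite /wave/= [b * _ + _]addrC.
have i1 (l : {measure set (R * R) -> \bar R}) a b c : (l setT < +oo)%E ->
    l.-integrable D (EFin \o wave a b c).
  move=> loo; apply: (@bounded_integrable _ _ _ _ _ _ 1) => //.
    exact: fin.
  by apply: measurable_funTS; exact: measurable_wave.
have i2 (l : {measure set (R * R) -> \bar R}) a b c : (l setT < +oo)%E ->
    l.-integrable D (EFin \o (wave a b c \o swap)).
  move=> loo; have -> : wave a b c \o swap = wave b a c.
    by apply/funext => x; exact: ws.
  exact: i1.
have moo (l1 l2 : {measure set (R * R) -> \bar R}) : (l1 setT < +oo)%E -> (l2 setT < +oo)%E -> (m l1 l2 setT < +oo)%E.
  move=> l1oo l2oo; rewrite maddE !image_onE !preimage_setT !setTI.
  by rewrite lte_add_pinfty// fin.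
have wE (l1 l2 : {measure set (R * R) -> \bar R}) a b c :
    (l1 setT < +oo)%E -> (l2 setT < +oo)%E ->
    \int[m l1 l2]_x wave a b c x = \int[l1]_(x in D) wave a b c x +
      \int[l2]_(x in D) wave b a c x.
  move=> l1oo l2oo; rewrite {1}/Rintegral integral_measure_add//; last 2 first.
    by apply: integrable_image_on; [exact: measurable_wave|exact: i1].
    by apply: integrable_image_on; [exact: measurable_wave|exact: i2].
  rewrite fineD; last 2 first.
    by apply: integrable_fin_num => //; apply: integrable_image_on;
      [exact: measurable_wave|exact: i1].
    by apply: integrable_fin_num => //; apply: integrable_image_on;
      [exact: measurable_wave|exact: i2].
  congr (_ + _); rewrite -/(Rintegral _ _ _) Rintegral_image_on//.
  - exact: measurable_wave.
  - exact: i1.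
  - by apply: eq_Rintegral => x _; exact: ws.
  - exact: measurable_wave.
  - exact: i2.
move=> B mB BD; rewrite -(mE mu nu B BD) -(mE nu mu B BD).
apply: fourier_uniqueness => //; [exact: moo|exact: moo|move=> a b c].
rewrite !wE//; have := munu a b c; rewrite /antiwave.
rewrite !RintegralB//; try exact: i1.
lra.
Qed.

(** One-sided antisymmetric waves see each open half-plane separately, and the
    first marginal then recovers the part of the measure on the diagonal. *)
Lemma wave_uniqueness :
  (forall a c, \int[mu]_x wave a 0 c x = \int[nu]_x wave a 0 c x) ->
  (forall p q a b c, \int[mu]_x one_sided_wave p q a b c x =
                     \int[nu]_x one_sided_wave p q a b c x) ->
  forall B, measurable B -> mu B = nu B.
Proof.
move=> marg one.
have fin (l : {measure set (R * R) -> \bar R}) A : (l setT < +oo)%E ->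
    measurable A -> (l A < +oo)%E.
  by move=> loo mA; apply: le_lt_trans loo; apply: le_measure; rewrite ?inE.
have mb := measurable_below; have ma := measurable_above.
have eb B : measurable B -> B `<=` @below R -> mu B = nu B.
  apply: antisymmetric_uniqueness => //.
    by apply/seteqP; split => // -[x y] [] /=; rewrite /below/= => /lt_trans h /h; rewrite ltxx.
  move=> a b c; rewrite !(Rintegral_mkcond _ (@below R)).
  rewrite (_ : _ \_ _ = one_sided_wave 1 0 a b c)//.
  apply/funext => x; rewrite /one_sided_wave patchE.
  have -> : (x \in @below R) = (x.1 < x.2).
    by apply/idP/idP; rewrite inE.
  by case: ifP; rewrite ?(mul1r, mul0r).
have ea B : measurable B -> B `<=` @above R -> mu B = nu B.
  apply: antisymmetric_uniqueness => //.
    by apply/seteqP; split => // -[x y] [] /=; rewrite /above/= => /lt_trans h /h; rewrite ltxx.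
  move=> a b c; rewrite !(Rintegral_mkcond _ (@above R)).
  rewrite (_ : _ \_ _ = one_sided_wave 0 1 a b c)//.
  apply/funext => x; rewrite /one_sided_wave patchE.
  have -> : (x \in @above R) = (x.2 < x.1).
    by apply/idP/idP; rewrite inE.
  case: (ltgtP x.1 x.2) => e; rewrite ?(mul1r, mul0r)//.
  by rewrite /antiwave /wave e [b * _ + _]addrC subrr.
have em A : measurable A -> mu (A `*` setT) = nu (A `*` setT).
  have mf : measurable_fun setT (fun x : R * R => (x.1, 0 : R)).
    by apply: measurable_fun_pair.
  move=> mA; have mX : measurable (A `*` [set: R]) by exact: measurableX.
  have e (l : {measure set (R * R) -> \bar R}) :
      l (A `*` setT) = image_on l measurableT mf (A `*` setT).
    by rewrite image_onE setIT; congr (l _); apply/seteqP; split => -[x y] /=.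
  rewrite (e mu) (e nu); apply: fourier_uniqueness => //.
    by rewrite image_onE preimage_setT setIT.
    by rewrite image_onE preimage_setT setIT.
  move=> a b c; rewrite !Rintegral_image_on//.
  - have eW x : wave a b c (x.1, 0 : R) = wave a 0 c x.
      by rewrite /wave/= mulr0 mul0r.
    under eq_Rintegral do rewrite eW; rewrite marg.
    by under [in RHS]eq_Rintegral do rewrite eW.
  - exact: measurable_wave.
  - apply: (@bounded_integrable _ _ _ _ _ _ 1) => //.
      by apply: measurableT_comp => //; exact: measurable_wave.
    by move=> x _; rewrite ler_norml sin_geN1 sin_le1.
  - exact: measurable_wave.
  - apply: (@bounded_integrable _ _ _ _ _ _ 1) => //.
      by apply: measurableT_comp => //; exact: measurable_wave.
    by move=> x _; rewrite ler_norml sin_geN1 sin_le1.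
pose diag := ~` (@below R `|` @above R).
have md : measurable diag by apply: measurableC; exact: measurableU.
have split (l : {measure set (R * R) -> \bar R}) B : measurable B ->
    (l B = l (B `&` @below R) + l (B `&` @above R) + l (B `&` diag))%E.
  move=> mB; have U : B = (B `&` @below R `|` B `&` @above R) `|` B `&` diag.
    by rewrite -!setIUr setUv setIT.
  rewrite {1}U measureU//; [|by apply: measurableU; exact: measurableI|exact: measurableI|].
    rewrite measureU//; [exact: measurableI|exact: measurableI|].
    apply/seteqP; split => // x [[_ /=]]; rewrite /below/= => h1 [_ /=].
    by rewrite /above/= => /(lt_trans h1); rewrite ltxx.
  by rewrite -setIUr; apply/seteqP; split => // x [[_ h] [_ h']].
move=> B mB; rewrite (split mu)// (split nu)//.
have mBb : measurable (B `&` @below R) by exact: measurableI.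
have mBa : measurable (B `&` @above R) by exact: measurableI.
rewrite (eb _ mBb (@subIsetr _ _ _)) (ea _ mBa (@subIsetr _ _ _)).
congr (_ + _)%E.
(* on the diagonal, B is the cylinder over its first projection A *)
pose A : set R := (fun t => (t, t)) @^-1` B.
have mA : measurable A.
  rewrite -[A]setTI; have : measurable_fun setT (fun t : R => (t, t)).
    exact: measurable_fun_pair.
  by apply.
have -> : B `&` diag = (A `*` setT) `&` diag.
  apply/seteqP; split => -[x y] [h d]; split => //; move: d h;
    rewrite /diag /below /above /A /= => /not_orP[/negP + /negP];
    rewrite -!leNgt => xy yx; have -> : x = y by apply/eqP; rewrite eq_le xy yx.
    by [].
  by case.
have mX : measurable (A `*` [set: R]) by exact: measurableX.
have := em _ mA; rewrite (split mu)// (split nu)//.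
have mXb : measurable (A `*` setT `&` @below R) by exact: measurableI.
have mXa : measurable (A `*` setT `&` @above R) by exact: measurableI.
rewrite (eb _ mXb (@subIsetr _ _ _)) (ea _ mXa (@subIsetr _ _ _)).
have f1 : nu (A `*` setT `&` @below R) \is a fin_num.
  by rewrite ge0_fin_numE// fin//; exact: measurableI.
have f2 : nu (A `*` setT `&` @above R) \is a fin_num.
  by rewrite ge0_fin_numE// fin//; exact: measurableI.
by rewrite -!addeA => /(addeI_fin f1) /(addeI_fin f2).
Qed.

End half_planes.

(** * The path space *)

Section uniform_continuity.
Context {R : realType} {V : pseudoMetricType R}.

Lemma heine (g : R -> V) (a b e : R) : continuous g -> 0 < e ->
  exists2 d : R, 0 < d & forall x y, a <= x <= b -> `|x - y| < d ->
    ball (g x) e (g y).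
Proof.
move=> cg e0.
pose P (d x : R) := forall y, `|x - y| < d -> ball (g x) e (g y).
have /compact_near_coveringP nc := @segment_compact R a b.
have [] := nc R (0^'+) P _ _.
  move=> x _.
  have : \forall z \near x, ball (g x) (e / 2) (g z).
    by apply: cg; apply: nbhsx_ballx; rewrite divr_gt0.
  move=> /nbhs_ballP[r /= r0 xr].
  exists (ball x (r / 2), [set d | d < r / 2]).
    split; first by apply: nbhsx_ballx; rewrite divr_gt0.
    by apply: nbhs_right_lt; rewrite divr_gt0.
  move=> [x' d] /= [x'x dr] y x'y.
  rewrite [e]splitr; apply: (ball_triangle (y := g x)).
    apply: ball_sym; apply: xr; apply: le_ball x'x.
    by rewrite ler_pdivrMr// ler_pMr// ler1n.
  apply: xr; rewrite [r]splitr; apply: ball_triangle x'x _.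
  by rewrite /ball/= (lt_trans x'y).
move=> r /= r0 h; exists (r / 2); first by rewrite divr_gt0.
move=> x y xab; apply: h; rewrite /=; last by rewrite in_itv.
- by rewrite /ball/= sub0r normrN gtr0_norm ?divr_gt0// ltr_pdivrMr// ltr_pMr// ltr1n.
- by rewrite divr_gt0.
Qed.

End uniform_continuity.

Section coordinate_process.
Variable R : realType.
Implicit Types (w : path_space R) (t : R).

Lemma sigL_coordinate w :
  sigL (@halfline R) ((@coordinate R) ^~ w) = (w : cpath R).
Proof. by rewrite -[LHS]/(sigL _ (valL (w : cpath R))) valLK. Qed.

Lemma continuous_coordinate w :
  {within `[0, +oo[, continuous ((@coordinate R) ^~ w)}.
Proof.
apply/subspace_sigL_continuousP.
by have -> := sigL_coordinate w; exact: cts_fun.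
Qed.

Lemma coordinateE w t (t0 : t \in @halfline R) :
  coordinate t w = (w : cpath R) (exist _ t t0).
Proof. by rewrite -sigL_coordinate /sigL /=. Qed.

Lemma in_halfline t : 0 <= t -> t \in @halfline R.
Proof. by move=> t0; rewrite inE /halfline/= in_itv/= t0. Qed.

(** A single time is a compact set, so evaluation is continuous for locally
    uniform convergence. *)
Lemma open_eval (t : set_type (@halfline R)) (O : set (R * R)) : open O ->
  open [set w : cpath R | O (w t)].
Proof.
move=> oO.
pose A : set {family compact, set_type (@halfline R) -> (R * R)%type} :=
  [set g | O (g t)].
suff : open A by move=> oA; exists A.
rewrite openE => g Ag.
have h : {ptws, nbhs (g : {family compact, set_type (@halfline R) -> (R * R)%type}) --> g}.
  exact: pointwise_cvg_compact_family.
apply: h.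
have ct := @proj_continuous (set_type (@halfline R)) (fun=> R * R)%type t g.
by apply: ct; exact: open_nbhs_nbhs.
Qed.

Lemma measurable_coordinate t : 0 <= t ->
  measurable_fun [set: path_space R] (coordinate t).
Proof.
move=> t0; apply/measurable_fun_pairP; split.
  apply: (measurability _ (RGenOInfty.measurableE R)) => _ [_ [x ->] <-].
  rewrite setTI; apply: sub_sigma_algebra.
  have -> : (fst \o coordinate t) @^-1` `]x, +oo[%classic =
      [set w : cpath R | [set y : R * R | x < y.1] (w (exist _ t (in_halfline t0)))].
    by apply/seteqP; split => w /=; rewrite in_itv/= andbT (coordinateE w (in_halfline t0)).
  apply: open_eval.
rewrite (_ : [set y | _] = @fst R R @^-1` `]x, +oo[%classic); last first.
  by apply/seteqP; split => y /=; rewrite in_itv/= andbT.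
apply: open_comp => [z _|].
    exact: cvg_fst.
  exact: interval_open.
apply: (measurability _ (RGenOInfty.measurableE R)) => _ [_ [x ->] <-].
rewrite setTI; apply: sub_sigma_algebra.
have -> : (snd \o coordinate t) @^-1` `]x, +oo[%classic =
    [set w : cpath R | [set y : R * R | x < y.2] (w (exist _ t (in_halfline t0)))].
  by apply/seteqP; split => w /=; rewrite in_itv/= andbT (coordinateE w (in_halfline t0)).
apply: open_eval.
rewrite (_ : [set y | _] = @snd R R @^-1` `]x, +oo[%classic); last first.
  by apply/seteqP; split => y /=; rewrite in_itv/= andbT.
apply: open_comp => [z _|].
  exact: cvg_snd.
exact: interval_open.
Qed.

(** The path continued to negative times by its initial value, which makes it
    continuous on the whole line. *)
Definition extended_path w (t : R) : R * R := coordinate (Num.max 0 t) w.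

Lemma extended_path_ge0 w t : 0 <= t -> extended_path w t = coordinate t w.
Proof. by move=> t0; rewrite /extended_path max_r. Qed.

Lemma continuous_extended_path w : continuous (extended_path w).
Proof.
move=> t; rewrite /extended_path.
have /subspace_continuousP/(_ (Num.max 0 t)) := @continuous_coordinate w.
rewrite /= in_itv/= andbT le_max lexx => /(_ isT) h.
have cm : Num.max 0 x @[x --> t] --> Num.max 0 t.
  by apply: continuous_max => //; first [exact: cvg_cst|exact: cvg_id].
apply: (@cvg_comp _ _ _ (fun x => Num.max 0 x) (fun s => coordinate s w) _ _ _ _ h) => A /= A0.
have : nbhs t (fun x => `[0, +oo[%classic (Num.max 0 x) -> A (Num.max 0 x)) := cm _ A0.
apply: filterS => x; apply; rewrite /=.
by rewrite in_itv/= andbT le_max lexx.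
Qed.

Let tube n w : set (path_space R) := [set v | forall t, 0 <= t <= n.+1%:R ->
  ball (coordinate t w) (3 / n.+1%:R) (coordinate t v)].

(** A neighbourhood for locally uniform convergence contains a tube, because
    a compact set of times is bounded. *)
Let open_tube (O : set (cpath R)) w : open O -> O w ->
  exists n, tube n w `<=` O.
Proof.
move=> [A oA <-] Aw.
pose H := set_type (@halfline R).
pose tb n := [set g : {family compact, H -> (R * R)%type} |
  forall t : H, \val t <= n.+1%:R ->
  ball ((w : cpath R) t) (3 / n.+1%:R) (g t)].
have tbS m n : (m <= n)%N -> tb n `<=` tb m.
  move=> mn g gn t tm.
  have h : m.+1%:R <= n.+1%:R :> R by rewrite ler_nat.
  apply: (le_ball _ (gn t (le_trans tm h))).
  by rewrite ler_pM2l// lef_pV2// posrE.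
pose F : set_system {family compact, H -> (R * R)%type} := filter_from setT tb.
have FF : Filter F.
  apply: filter_from_filter; first by exists 0%N.
  move=> i j _ _; exists (maxn i j) => //; rewrite subsetI.
  by split; apply: tbS; rewrite ?leq_maxl ?leq_maxr.
have : F --> ((w : cpath R) : {family compact, H -> (R * R)%type}).
  apply/fam_cvgP => K cK P /uniform_nbhs[E [entE EP]].
  move: entE; rewrite -entourage_ballE => -[e /= e0 eE].
  have : compact (set_val @` K).
    apply: continuous_compact => //; apply: continuous_subspaceT.
    exact: initial_continuous.
  move=> /compact_bounded[M [_ /(_ (M + 1))]]; rewrite ltrDl ltr01 => /(_ isT) KM.
  pose n := (Num.trunc (`|M + 1| + 3 / e)).+1.
  have nlt : `|M + 1| + 3 / e < n.+1%:R.
    by apply: (lt_trans (truncnS_gt _)); rewrite ltr_nat.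
  have e30 : 0 < 3 / e by rewrite divr_gt0.
  exists n => // g gn; apply: EP => t Kt; apply: eE => /=.
  apply: (le_ball _ (gn t _)).
    rewrite ler_pdivrMr// mulrC -ler_pdivrMr//.
    by apply: ltW; apply: le_lt_trans nlt; rewrite lerDr.
  apply: ltW; apply: le_lt_trans nlt.
  have := KM (\val t) (ex_intro2 _ _ t Kt erefl) => /(le_trans (ler_norm _)) h.
  by apply: (le_trans h); rewrite (le_trans (ler_norm _))// lerDl ltW.
have nA : nbhs ((w : cpath R) : {family compact, H -> (R * R)%type}) A.
  exact: open_nbhs_nbhs.
move=> /(_ _ nA)[n _ nA']; exists n => v vn; apply: nA' => t tn.
case: t tn => t p /= tn.
have t0 : 0 <= t by move: p; rewrite inE /halfline/= in_itv/= andbT.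
by have := vn t; rewrite t0 tn => /(_ isT); rewrite !(coordinateE _ p).
Qed.

Let toR (q : rat * rat) : R * R := (ratr q.1, ratr q.2).

(** Paths that are, at the rational times up to n + 1, within 1 / (n + 1) of the
    step function with mesh 1 / (m + 1) and rational values q. There are countably
    many of them, and each is a countable intersection of cylinders. *)
Let box n m (q : seq (rat * rat)) : set (path_space R) :=
  [set w | forall r : rat, 0 <= (ratr r : R) <= n.+1%:R ->
    ball (toR (nth (0, 0) q (Num.trunc ((ratr r : R) * m.+1%:R)))) n.+1%:R^-1
      (coordinate (ratr r) w)].

Let box_tube n m q w : box n m q w -> box n m q `<=` tube n w.
Proof.
move=> bw v bv t /andP[t0 tn].
pose e : R := n.+1%:R^-1 / 2.
have e0 : 0 < e by rewrite divr_gt0// invr_gt0.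
have : \forall r \near t, ball (extended_path w t) e (extended_path w r) /\ ball (extended_path v t) e (extended_path v r).
  by apply: filterI; [exact: (@continuous_extended_path w t _ (nbhsx_ballx _ _ e0))|exact: (@continuous_extended_path v t _ (nbhsx_ballx _ _ e0))].
move=> /nbhs_ballP[d /= d0 dt].
have [r r0n td] : exists2 r : rat, 0 <= (ratr r : R) <= n.+1%:R & `|t - ratr r| < d.
  have [->|tN0] := eqVneq t 0.
    have [|r] := @rat_in_itvoo R 0 (Num.min d n.+1%:R); first by rewrite lt_min d0 ltr0Sn.
    rewrite in_itv/= => /andP[r0]; rewrite lt_min => /andP[rd rn].
    by exists r; rewrite ?(ltW r0) ?(ltW rn)// sub0r normrN gtr0_norm.
  have [|r] := @rat_in_itvoo R (Num.max 0 (t - d)) t.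
    by rewrite gt_max lt_neqAle eq_sym tN0 t0/= ltrBlDr ltrDl.
  rewrite in_itv/= gt_max => /andP[/andP[r0 rd] rt].
  exists r; first by rewrite (ltW r0)/= (le_trans (ltW rt)).
  by rewrite ger0_norm ?subr_ge0 ?(ltW rt)// ltrBlDr -ltrBlDl.
have [/= h1 h2] := dt _ td.
have /andP[r0 _] := r0n.
rewrite !extended_path_ge0// in h1 h2.
have -> : 3 / n.+1%:R = e + ((n.+1%:R^-1 + n.+1%:R^-1) + e) :> R.
  by rewrite /e; field; rewrite ?pnatr_eq0 ?nat1r ?natr1 ?pnatr_eq0.
apply: ball_triangle h1 _; apply: (@ball_triangle _ _ (coordinate (ratr r) v)); last exact: ball_sym.
by apply: ball_triangle (bv _ r0n); apply: ball_sym; exact: bw.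
Qed.

(** Uniform continuity up to time n + 1 provides the mesh. *)
Let ex_box n w : exists m q, box n m q w.
Proof.
pose e : R := n.+1%:R^-1 / 2.
have e0 : 0 < e by rewrite divr_gt0// invr_gt0.
have [d d0 hd] := heine 0 n.+1%:R (@continuous_extended_path w) e0.
pose m := Num.trunc d^-1.
have md : m.+1%:R^-1 < d.
  rewrite -[ltRHS]invrK ltf_pV2 ?posrE ?invr_gt0//; exact: truncnS_gt.
have rd (x : R) : exists q : rat, `|ratr q - x| < e.
  have [|q] := @rat_in_itvoo R (x - e) (x + e); first by rewrite ltrD2l gtrN.
  by rewrite in_itv/= => xqx; exists q; rewrite ltr_distl.
have /choice[Q QP] : forall i : nat, exists q : rat * rat,
    ball (toR q) e (extended_path w (i%:R / m.+1%:R)).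
  move=> i.
  have [q1 h1] := rd (extended_path w (i%:R / m.+1%:R)).1.
  have [q2 h2] := rd (extended_path w (i%:R / m.+1%:R)).2.
  by exists (q1, q2); split.
exists m, (mkseq Q (n.+1 * m.+1).+1) => r r0n.
have /andP[r0 rn] := r0n.
set i := Num.trunc _.
have m0 : 0 < m.+1%:R :> R by [].
have /andP[i1 i2] : i%:R <= (ratr r : R) * m.+1%:R < i.+1%:R.
  by apply: truncn_itv; rewrite mulr_ge0.
rewrite nth_mkseq; last first.
  rewrite ltnS -(ler_nat R) (le_trans i1)// natrM.
  by rewrite ler_pM2r.
rewrite -extended_path_ge0//; have -> : n.+1%:R^-1 = e + e by exact: splitr.
apply: ball_triangle (QP i) _; apply: hd.
  rewrite divr_ge0//= ler_pdivrMr// (le_trans i1)//.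
  by rewrite ler_pM2r.
apply: le_lt_trans md.
rewrite distrC ger0_norm ?subr_ge0 ?ler_pdivrMr//.
by rewrite lerBlDr -[X in X + _]mul1r -mulrDl ler_pdivlMr// nat1r ltW.
Qed.

Definition cylinder (ts : seq R) (B : R -> set (R * R)) : set (path_space R) :=
  [set w | forall t, t \in ts -> B t (coordinate t w)].

Definition cylinders : set (set (path_space R)) :=
  [set A | exists ts B, [/\ forall t, t \in ts -> 0 <= t,
                           forall t, measurable (B t) & A = cylinder ts B]].

Let measurable_ball (x : R * R) e : measurable (ball x e).
Proof.
have -> : ball x e = ball x.1 e `*` ball x.2 e by [].
by apply: measurableX; exact: measurable_ball.
Qed.

Let measurable_box n m q : <<s cylinders >> (box n m q).
Proof.
pose P (r : rat) : set (g_sigma_algebraType cylinders) :=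
  if 0 <= (ratr r : R) <= n.+1%:R then
  [set w | ball (toR (nth (0, 0) q (Num.trunc ((ratr r : R) * m.+1%:R)))) n.+1%:R^-1
      (coordinate (ratr r) w)] else setT.
have mP r : measurable (P r).
  rewrite /P; case: ifPn => [/andP[r0 _]|_]; last exact: measurableT.
  apply: sub_sigma_algebra.
  exists [:: ratr r], (fun=> ball (toR (nth (0, 0) q
    (Num.trunc ((ratr r : R) * m.+1%:R)))) n.+1%:R^-1); split => //.
    by move=> t; rewrite inE => /eqP ->.
  apply/seteqP; split => w /=; first by move=> h t; rewrite inE => /eqP ->.
  by apply; rewrite inE.
have -> : box n m q = ~` (\bigcup_r ~` P r).
  have -> : ~` (\bigcup_r ~` P r) = \bigcap_r P r.
    by rewrite setC_bigcup; apply: eq_bigcapr => r _; rewrite setCK.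
  apply/seteqP; split => w bw r; rewrite /P.
    by move=> _; case: ifPn => // r0; exact: bw.
  by move=> rn; have : P r w by [exact: bw]; rewrite /P rn.
apply: (@measurableC _ (g_sigma_algebraType cylinders)).
by apply: bigcupT_measurable_rat => r; exact: measurableC.
Qed.

(** Locally uniform convergence is second countable: an open set is the union
    of the countably many boxes that it contains. *)
Lemma path_measurable_cylinders (A : set (path_space R)) :
  measurable A -> <<s cylinders >> A.
Proof.
apply: smallest_sub; first exact: smallest_sigma_algebra.
move=> O oO.
pose D (c : nat * nat * seq (rat * rat)) : set (g_sigma_algebraType cylinders) :=
  if pselect (box c.1.1 c.1.2 c.2 `<=` O) then box c.1.1 c.1.2 c.2 else set0.
have -> : O = \bigcup_c D c.
  apply/seteqP; split => w.
    move=> Ow; have [n nO] := open_tube oO Ow.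
    have [m [q bw]] := ex_box n w.
    exists (n, m, q) => //; rewrite /D; case: pselect => // -[].
    exact: subset_trans (box_tube bw) nO.
  by move=> [c _]; rewrite /D; case: pselect => // cO; exact: cO.
apply: (@countable_bigcupT_measurable _ (g_sigma_algebraType cylinders)) => // c.
by rewrite /D; case: pselect => cO; [exact: measurable_box|exact: measurable0].
Qed.

End coordinate_process.

(** * Eigenfunctions of the generator *)

Section lines.
Variable R : realType.
Implicit Types (f : R * R -> R) (x u : R * R) (t : R).

Lemma shift_line x u (h t : R) : h *: u + (t *: u + x) = (h *: (1 : R) + t) *: u + x.
Proof. by rewrite addrA -scalerDl /GRing.scale/= mulr1. Qed.

Lemma line_quotient f x u t :
  (fun h : R => h^-1 *: (((fun s : R => f (s *: u + x)) \o shift t) (h *: (1 : R)) -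
     f (t *: u + x))) =
  (fun h : R => h^-1 *: ((f \o shift (t *: u + x)) (h *: u) - f (t *: u + x))).
Proof. by apply/funext => h /=; rewrite shift_line. Qed.

Lemma derivable_line f x u t :
  derivable (fun s : R => f (s *: u + x)) t 1 <-> derivable f (t *: u + x) u.
Proof. by rewrite /derivable line_quotient. Qed.

Lemma derive_line f x u t :
  'D_1 (fun s : R => f (s *: u + x)) t = 'D_u f (t *: u + x).
Proof. by rewrite /derive line_quotient. Qed.

Lemma is_derive_line f x u t d :
  is_derive (t *: u + x) u f d <-> is_derive t (1 : R) (fun s : R => f (s *: u + x)) d.
Proof.
split=> -[h1 h2]; split.
- exact/derivable_line.
- by rewrite derive_line.
- exact/derivable_line.
- by rewrite -derive_line.
Qed.

End lines.

Section smooth_waves.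
Variable R : realType.
Implicit Types (f F : R * R -> R) (x u : R * R) (t : R).

Lemma is_derive_wave a b c x u :
  is_derive x u (wave a b c) ((a * u.1 + b * u.2) * wave a b (c + pi / 2) x).
Proof.
have -> : x = (0 : R) *: u + x by rewrite scale0r add0r.
apply/is_derive_line.
have -> : (fun s : R => wave a b c (s *: u + x)) =
    (@sin R) \o (fun s => (a * u.1 + b * u.2) * s + (a * x.1 + b * x.2 + c)).
  by apply/funext => s /=; rewrite /wave/= /GRing.scale/=; congr sin; ring.
set k := a * u.1 + b * u.2; set m := a * x.1 + b * x.2 + c.
have h : is_derive (0 : R) (1 : R) (fun s => k * s + m) k.
  have -> : (fun s => k * s + m) = (k *: id) + cst m by [].
  have := is_deriveD (is_deriveZ k (is_derive_id (0 : R) (1 : R))) (is_derive_cst m (0 : R) 1).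
  by rewrite addr0 /GRing.scale/= mulr1.
have := @is_derive1_comp R sin (fun s => k * s + m) 0 _ _ (is_derive_sin _) h.
rewrite mulr0 add0r mulrC => h'; apply: is_derive_eq h' _.
by rewrite /wave scale0r add0r addrA sinDpihalf.
Qed.

(** Stability under derivation, which makes the derivatives of all orders bounded
    and uniformly continuous at once. *)
Lemma trigpoly_derive F u : trigpoly F ->
  (forall x, derivable F x u) /\ trigpoly ('D_u F).
Proof.
elim=> [a b c|{}F G _ [dF tF] _ [dG tG]|k {}F _ [dF tF]].
- split=> [x|]; first by case: (is_derive_wave a b c x u).
  have -> : 'D_u (wave a b c) = (fun x => (a * u.1 + b * u.2) * wave a b (c + pi / 2) x).
    by apply/funext => x; case: (is_derive_wave a b c x u).
  by apply: trigpolyZ; exact: trigpoly_wave.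
- split=> [x|]; first exact: derivableD.
  have -> : 'D_u (fun x => F x + G x) = (fun x => 'D_u F x + 'D_u G x).
    by apply/funext => x; exact: deriveD.
  exact: trigpolyD.
- split=> [x|]; first exact: derivableZ.
  have -> : 'D_u (fun x => k * F x) = (fun x => k * 'D_u F x).
    by apply/funext => x; exact: deriveZ.
  exact: trigpolyZ.
Qed.

Lemma trigpoly_bounded F : trigpoly F -> exists C : R, forall x, `|F x| <= C.
Proof.
elim=> [a b c|{}F G _ [C FC] _ [D GD]|k {}F _ [C FC]].
- by exists 1 => x; rewrite ler_norml sin_geN1 sin_le1.
- by exists (C + D) => x; apply: (le_trans (ler_normD _ _)); exact: lerD.
- by exists (`|k| * C) => x; rewrite normrM ler_wpM2l.
Qed.

Lemma sin_lipschitz (s t : R) : `|sin s - sin t| <= `|s - t|.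
Proof.
wlog st : s t / s <= t => [hw|].
  have [/hw//|/ltW/hw] := leP s t.
  by rewrite distrC [X in _ <= X -> _]distrC.
have [r _] := @MVT_segment R sin cos s t st (fun r _ => is_derive_sin r)
  (continuous_subspaceT (@continuous_sin R)).
rewrite distrC => ->; rewrite normrM distrC ler_piMl//.
by rewrite ler_norml cos_geN1 cos_le1.
Qed.

Lemma trigpoly_unif_continuous F (e : R) : trigpoly F -> 0 < e ->
  exists2 d, 0 < d & forall x y, ball x d y -> `|F x - F y| < e.
Proof.
move=> tF; elim: tF e => [a b c|{}F G _ hF _ hG|k {}F _ hF] e e0.
- pose K := `|a| + `|b| + 1; have K0 : 0 < K by rewrite ltr_wpDl// addr_ge0.
  exists (e / K); first by rewrite divr_gt0.
  move=> x y [xy1 xy2]; apply: (le_lt_trans (sin_lipschitz _ _)).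
  have -> : a * x.1 + b * x.2 + c - (a * y.1 + b * y.2 + c) =
    a * (x.1 - y.1) + b * (x.2 - y.2) by ring.
  apply: (le_lt_trans (ler_normD _ _)); rewrite !normrM.
  have h : (`|a| + `|b|) * (e / K) < e.
    by rewrite mulrA ltr_pdivrMr// mulrC ltr_pM2l// /K ltrDl.
  apply: le_lt_trans h; rewrite mulrDl.
  by apply: lerD; apply: ler_wpM2l => //; exact: ltW.
- have e20 : 0 < e / 2 by rewrite divr_gt0.
  have [d d0 hd] := hF _ e20; have [r r0 hr] := hG _ e20.
  exists (Num.min d r); first by rewrite lt_min d0.
  move=> x y xy; have -> : F x + G x - (F y + G y) = (F x - F y) + (G x - G y) by ring.
  rewrite [e]splitr; apply: (le_lt_trans (ler_normD _ _)); apply: ltrD.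
    by apply: hd; apply: le_ball xy; rewrite ge_min lexx.
  by apply: hr; apply: le_ball xy; rewrite ge_min lexx orbT.
- have k0 : 0 < `|k| + 1 by rewrite ltr_wpDl.
  have [|d d0 hd] := hF (e / (`|k| + 1)); first by rewrite divr_gt0.
  exists d => // x y /hd; rewrite ltr_pdivlMr// => h.
  rewrite -mulrBr normrM; apply: le_lt_trans h.
  by rewrite mulrC ler_wpM2l// lerDl.
Qed.

Lemma trigpoly_continuous F : trigpoly F -> continuous F.
Proof.
move=> tF x; apply/cvgrPdist_lt => e e0.
have [d d0 hd] := trigpoly_unif_continuous tF e0.
by apply: filterS (nbhsx_ballx x d d0) => y; exact: hd.
Qed.

Section agreement.
Variables (U : set (R * R)) (f F : R * R -> R).
Hypotheses (oU : open U) (fF : forall x, U x -> f x = F x).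

Lemma near_agree x : U x -> {near x, f =1 F}.
Proof.
move=> Ux; have : \forall y \near x, U y by exact: open_nbhs_nbhs.
by apply: filterS => y; exact: fF.
Qed.

Lemma derive_agree x u : U x -> 'D_u f x = 'D_u F x.
Proof. by move=> Ux; apply: near_eq_derive; exact: near_agree. Qed.

Lemma derivable_agree x u : U x -> derivable F x u -> derivable f x u.
Proof.
move=> Ux; apply: near_eq_derivable.
by apply: filterS (near_agree Ux).
Qed.

Lemma continuous_agree x : U x -> {for x, continuous F} -> {for x, continuous f}.
Proof.
move=> Ux cF; rewrite /prop_for /continuous_at (fF Ux).
apply: cvg_trans cF; apply: near_eq_cvg.
by apply: filterS (near_agree Ux).
Qed.

End agreement.

Lemma uniform_extension_trigpoly U f F : trigpoly F ->
  (forall x, U x -> f x = F x) -> uniform_extension U f F.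
Proof.
move=> tF fF; split; last by move=> x Ux; rewrite fF.
apply/unif_continuousP => e e0 /=.
have [d d0 hd] := trigpoly_unif_continuous tF e0.
exists d => // -[x y] /= xy.
apply: hd; move: xy; rewrite ball_subspace_ball /subspace_ball.
by case: ifP => [_ []//|_ ->]; exact: ballxx.
Qed.

(** Agreement with a trigonometric polynomial on an open half-plane provides all the
    regularity that the domain asks for on this side; what is left is the
    condition on mixed derivatives. *)
Lemma half_plane_trigpoly U f F : open U -> trigpoly F ->
  (forall x, U x -> f x = F x) ->
  (forall u v a, axis u -> axis v -> u <> v -> 'D_v ('D_u F) (a, a) = 0) ->
  [/\ twice_continuously_differentiable_on U f,
      forall u, axis u ->
        [bounded 'D_u f x | x in U] /\
        exists h, uniform_extension U ('D_u f) h &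
      forall u v, axis u -> axis v ->
        [bounded 'D_v ('D_u f) x | x in U] /\
        exists2 h, uniform_extension U ('D_v ('D_u f)) h &
          u <> v -> forall a, h (a, a) = 0].
Proof.
move=> oU tF fF mixed.
have t1 u : trigpoly ('D_u F) by case: (trigpoly_derive u tF).
have t2 u v : trigpoly ('D_v ('D_u F)) by case: (trigpoly_derive v (t1 u)).
have e1 u x : U x -> 'D_u f x = 'D_u F x by exact: derive_agree.
have e2 u v x : U x -> 'D_v ('D_u f) x = 'D_v ('D_u F) x.
  by apply: derive_agree => //; exact: e1.
have bnd (g G : R * R -> R) : trigpoly G -> (forall x, U x -> g x = G x) ->
    [bounded g x | x in U].
  move=> tG gG; have [C GC] := trigpoly_bounded tG.
  exists C; split; first exact: num_real.
  by move=> M CM x Ux; rewrite /= gG//; apply: le_trans (GC _) _; exact: ltW.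
split.
- move=> x Ux u Au; split.
  + by apply: (derivable_agree oU fF) => //; case: (trigpoly_derive u tF).
  + by apply: (continuous_agree oU (@e1 u)) => //; exact: trigpoly_continuous.
  + move=> v Av; split.
      by apply: (derivable_agree oU (@e1 u)) => //; case: (trigpoly_derive v (t1 u)).
    by apply: (continuous_agree oU (@e2 u v)) => //; exact: trigpoly_continuous.
- move=> u Au; split; first exact: bnd (t1 u) (@e1 u).
  by exists ('D_u F); exact: uniform_extension_trigpoly (t1 u) (@e1 u).
- move=> u v Au Av; split; first exact: bnd (t2 u v) (@e2 u v).
  exists ('D_v ('D_u F)); first exact: uniform_extension_trigpoly (t2 u v) (@e2 u v).
  by move=> uv a; exact: mixed.
Qed.

End smooth_waves.

Section eigenfunctions.
Variable R : realType.
Implicit Types (f F : R * R -> R) (x u v : R * R).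

Lemma C2b_sin (k a c : R) : C2b (fun t => k * sin (a * t + c)).
Proof.
pose s (k c : R) (t : R) := k * sin (a * t + c).
have ds (k' c' t : R) : is_derive t (1 : R) (s k' c') (s (k' * a) (c' + pi / 2) t).
  have h : is_derive t (1 : R) (fun r => a * r + c') a.
    have -> : (fun r => a * r + c') = (a *: id) + cst c' by [].
    have := is_deriveD (is_deriveZ a (is_derive_id t (1 : R))) (is_derive_cst c' t 1).
    by rewrite addr0 /GRing.scale/= mulr1.
  have h' := @is_derive1_comp R sin (fun r => a * r + c') t _ _ (is_derive_sin _) h.
  have := is_deriveZ k' h'; rewrite /s; move=> /is_derive_eq; apply.
  by rewrite addrA sinDpihalf /GRing.scale/=; ring.
have dn (k' c' : R) n : exists k'' c'', derive1n n (s k' c') = s k'' c''.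
  elim: n k' c' => [|n ih] k' c'; first by exists k', c'.
  rewrite derive1nS; have [k1 [c1 ->]] := ih k' c'.
  exists (k1 * a), (c1 + pi / 2); apply/funext => t.
  by rewrite derive1E; case: (ds k1 c1 t).
have cs (k' c' : R) : continuous (s k' c').
  move=> t; apply: differentiable_continuous; apply/derivable1_diffP.
  by case: (ds k' c' t).
split=> [n _|n _ t]; have [k1 [c1 E]] := dn k c n; rewrite /s in E; rewrite E.
  split; first exact: cs.
  exists `|k1|; split; first exact: num_real.
  move=> M kM x _ /=; rewrite normrM; apply: le_trans (ltW kM).
  by rewrite ler_piMr// ler_norml sin_geN1 sin_le1.
by case: (ds k1 c1 t).
Qed.

Lemma axisP u : axis u -> u = (1, 0) \/ u = (0, 1) :> R * R.
Proof. by []. Qed.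

Lemma calD_trigpoly f Fb Fa : continuous f ->
  trigpoly Fb -> (forall x, below x -> f x = Fb x) ->
  trigpoly Fa -> (forall x, above x -> f x = Fa x) ->
  (forall F u v a, F = Fb \/ F = Fa -> axis u -> axis v -> u <> v ->
     'D_v ('D_u F) (a, a) = 0) ->
  C2b (fun a => f (a, a)) -> calD f.
Proof.
move=> cf tb fb ta fa mixed c2; split => //; split => //.
- have [Cb hb] := trigpoly_bounded tb; have [Ca ha] := trigpoly_bounded ta.
  have [[_ [C [_ hC]]] _] := (c2.1 0%N isT, I).
  rewrite /= in hC.
  exists (Num.max `|C + 1| (Num.max Cb Ca)); split; first exact: num_real.
  move=> M; rewrite !gt_max => /andP[CM /andP[bM aM]] x _ /=.
  have [x12|x21|x12] := ltgtP x.1 x.2.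
  + by rewrite fb//; apply: le_trans (hb _) _; exact: ltW.
  + by rewrite fa//; apply: le_trans (ha _) _; exact: ltW.
  + have -> : x = (x.1, x.1) by rewrite [in RHS]x12 [in LHS](surjective_pairing x) x12.
    have := hC (C + 1); rewrite ltrDl ltr01 => /(_ isT x.1 I) /=.
    move=> /le_trans; apply.
    by apply: le_trans (ler_norm _) _; exact: ltW.
- move=> U [->|->].
  + apply: (half_plane_trigpoly (@open_below R) tb fb) => u v a Au Av uv.
    by apply: mixed => //; left.
  + apply: (half_plane_trigpoly (@open_above R) ta fa) => u v a Au Av uv.
    by apply: mixed => //; right.
Qed.

Lemma diag_below_proper x : x.1 = x.2 -> ProperFilter (within (@below R) (nbhs x)).
Proof.
move=> x12; apply: Build_ProperFilter_ex => P /=; rewrite /within/= => /nbhs_ballP[e /= e0 xe].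
exists (x.1 - e / 2, x.2); apply: xe; rewrite /below/=; last first.
  by rewrite x12 ltrBlDr ltrDl divr_gt0.
split => /=; last exact: ballxx.
rewrite /ball/= opprB addrCA subrr addr0 gtr0_norm ?divr_gt0//.
by rewrite ltr_pdivrMr// ltr_pMr// ltr1n.
Qed.

(** The eigenvalue equation off the diagonal passes to the limit that defines the
    generator on the diagonal, by continuity of f. *)
Lemma G0_eigen rho f lam : continuous f ->
  (forall x, x.1 != x.2 -> laplacian f x = lam * f x) ->
  forall x, G0 rho f x = 2^-1 * rho * (lam * f x).
Proof.
move=> cf fl x; rewrite /G0; case: eqVneq => [x12|x12]; last by rewrite fl.
congr (_ * _).
have pf := diag_below_proper x12.
apply: cvg_lim => //.
have h : lam * f y @[y --> within (@below R) (nbhs x)] --> lam * f x.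
  by apply: cvgM; [exact: cvg_cst|exact: cvg_within_filter (cf x)].
apply: cvg_trans h; apply: near_eq_cvg.
rewrite /prop_near1 /within/=; apply: nearW => y; rewrite /below/= => y12.
by rewrite fl// lt_eqF.
Qed.

Lemma derive2_wave (k a b c l a' b' c' : R) u v x :
  'D_v ('D_u (fun x => k * wave a b c x + l * wave a' b' c' x)) x =
  k * ((a * u.1 + b * u.2) * ((a * v.1 + b * v.2) * - wave a b c x)) +
  l * ((a' * u.1 + b' * u.2) * ((a' * v.1 + b' * v.2) * - wave a' b' c' x)).
Proof.
have w1 k1 a1 b1 c1 u1 y : is_derive y u1 (fun x => k1 * wave a1 b1 c1 x)
    (k1 * (a1 * u1.1 + b1 * u1.2) * wave a1 b1 (c1 + pi / 2) y).
  have := is_deriveZ k1 (is_derive_wave a1 b1 c1 y u1).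
  by move=> /is_derive_eq; apply; rewrite /GRing.scale/= mulrA.
have w2 k1 a1 b1 c1 l1 a2 b2 c2 u1 :
    'D_u1 (fun x => k1 * wave a1 b1 c1 x + l1 * wave a2 b2 c2 x) =
    (fun x => k1 * (a1 * u1.1 + b1 * u1.2) * wave a1 b1 (c1 + pi / 2) x +
       l1 * (a2 * u1.1 + b2 * u1.2) * wave a2 b2 (c2 + pi / 2) x).
  apply/funext => y.
  by case: (is_deriveD (w1 k1 a1 b1 c1 u1 y) (w1 l1 a2 b2 c2 u1 y)).
have w3 a1 b1 c1 y : wave a1 b1 (c1 + pi / 2 + pi / 2) y = - wave a1 b1 c1 y :> R.
  by rewrite /wave !addrA sinDpihalf cosDpihalf.
rewrite w2; have /(congr1 (fun g => g x)) /= -> := w2 (k * (a * u.1 + b * u.2)) a b (c + pi / 2)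
  (l * (a' * u.1 + b' * u.2)) a' b' (c' + pi / 2) v.
by rewrite !w3; ring.
Qed.

(** A function of the first coordinate has no mixed derivative. *)
Lemma wave_calD a c : calD (wave a 0 c : R * R -> R).
Proof.
have tw : trigpoly (wave a 0 c : R * R -> R) by exact: trigpoly_wave.
apply: (@calD_trigpoly _ (wave a 0 c) (wave a 0 c)) => //.
- exact: trigpoly_continuous.
- move=> F u v t FE Au Av uv.
  have -> : F = (fun x => 1 * wave a 0 c x + 0 * wave 0 0 0 x).
    by case: FE => ->; apply/funext => x; rewrite mul1r mul0r addr0.
  rewrite derive2_wave.
  case: (axisP Au) uv => ->; case: (axisP Av) => -> uv //=; by [case: uv|ring].
- have -> : (fun t : R => wave a 0 c (t, t)) = (fun t => 1 * sin (a * t + c)).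
    by apply/funext => t; rewrite /wave/= mul0r addr0 mul1r.
  exact: C2b_sin.
Qed.

Lemma G0_wave rho a c x :
  G0 rho (wave a 0 c) x = - (2^-1 * rho * a ^+ 2) * wave a 0 c x.
Proof.
rewrite (@G0_eigen rho _ (- a ^+ 2)).
- ring.
- by apply: trigpoly_continuous; exact: trigpoly_wave.
- move=> y _; rewrite /laplacian.
  have -> : wave a 0 c = (fun x : R * R => 1 * wave a 0 c x + 0 * wave 0 0 0 x).
    by apply/funext => z; rewrite mul1r mul0r addr0.
  by rewrite !derive2_wave/=; ring.
Qed.

Let antiE k a b c : (fun x => k * antiwave a b c x) =
  (fun x : R * R => k * wave a b c x + (- k) * wave b a c x).
Proof. by apply/funext => x; rewrite /antiwave; ring. Qed.

Let anti_diag a b c t : antiwave a b c (t, t) = 0 :> R.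
Proof. by rewrite /antiwave /wave/= [b * _ + _]addrC subrr. Qed.

Let trig_anti k a b c : trigpoly (fun x : R * R => k * antiwave a b c x).
Proof.
by rewrite antiE; apply: trigpolyD; apply: trigpolyZ; exact: trigpoly_wave.
Qed.

Let one_below p q a b c x : below x -> one_sided_wave p q a b c x = p * antiwave a b c x :> R.
Proof. by rewrite /below/= /one_sided_wave => ->. Qed.

Let one_above p q a b c x : above x -> one_sided_wave p q a b c x = q * antiwave a b c x :> R.
Proof. by rewrite /above/= /one_sided_wave => /ltW; rewrite leNgt => /negPf ->. Qed.

(** The function S below, the antiwave at the sorted point, is continuous and
    equals the antiwave below the diagonal and its opposite above; so the two
    sides are linear combinations of A + S and A - S. *)
Lemma one_sided_wave_continuous p q a b c :
  continuous (one_sided_wave p q a b c : R * R -> R).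
Proof.
pose A (x : R * R) : R := antiwave a b c x.
pose S (x : R * R) : R := antiwave a b c (Num.min x.1 x.2, Num.max x.1 x.2).
have cA : continuous A.
  have -> : A = (fun x => 1 * antiwave a b c x) by apply/funext => x; rewrite mul1r.
  exact/trigpoly_continuous/trig_anti.
have cS : continuous S.
  move=> x; apply: (@continuous_comp _ _ _ (fun y : R * R =>
    (Num.min y.1 y.2, Num.max y.1 y.2)) A); last exact: cA.
  exact: continuous_pair (@continuous_min_coord R) (@continuous_max_coord R) _.
have -> : one_sided_wave p q a b c =
    (fun x => p * 2^-1 * (A x + S x) + q * 2^-1 * (A x - S x)).
  apply/funext => x; rewrite /S /A.
  have [x12|x21|x12] := ltgtP x.1 x.2.
  - by rewrite one_below// -surjective_pairing; field.
  - rewrite one_above//.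
    have -> : antiwave a b c (x.2, x.1) = - antiwave a b c x.
      by rewrite /antiwave /wave/= opprB [b * _ + _]addrC [a * x.2 + _]addrC.
    by field.
  - rewrite (_ : x = (x.1, x.1)).
      by rewrite /one_sided_wave/= !anti_diag; ring.
    by rewrite [in RHS]x12 [in LHS](surjective_pairing x) x12.
move=> x; apply: cvgD; apply: cvgM; try exact: cvg_cst.
  by apply: cvgD; [exact: cA|exact: cS].
by apply: cvgB; [exact: cA|exact: cS].
Qed.

(** On each side the mixed derivative is a multiple of the antiwave, hence zero on
    the diagonal, and so is the restriction of the function itself. *)
Lemma one_sided_wave_calD p q a b c : calD (one_sided_wave p q a b c : R * R -> R).
Proof.
apply: (@calD_trigpoly _ (fun x => p * antiwave a b c x) (fun x => q * antiwave a b c x)).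
- exact: one_sided_wave_continuous.
- exact: trig_anti.
- by move=> x; exact: one_below.
- exact: trig_anti.
- by move=> x; exact: one_above.
- move=> F u v t FE Au Av uv.
  have [k ->] : exists k, F = (fun x => k * antiwave a b c x).
    by case: FE => ->; [exists p|exists q].
  rewrite antiE derive2_wave.
  have -> : wave b a c (t, t) = wave a b c (t, t) by rewrite /wave/= addrC [b * t + _]addrC addrC.
  case: (axisP Au) uv => ->; case: (axisP Av) => -> uv //=; by [case: uv|ring].
- have -> : (fun t : R => one_sided_wave p q a b c (t, t)) = (fun t => 0 * sin (a * t + c)).
    by apply/funext => t; rewrite /one_sided_wave anti_diag mulr0 mul0r.
  exact: C2b_sin.
Qed.

Lemma G0_one_sided_wave rho p q a b c x :
  G0 rho (one_sided_wave p q a b c) x =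
  - (2^-1 * rho * (a ^+ 2 + b ^+ 2)) * one_sided_wave p q a b c x.
Proof.
rewrite (@G0_eigen rho _ (- (a ^+ 2 + b ^+ 2))).
- ring.
- exact: one_sided_wave_continuous.
- have l k U (oU : open U) (E : forall y, U y -> one_sided_wave p q a b c y = k * antiwave a b c y) y :
      U y -> laplacian (one_sided_wave p q a b c) y =
      - (a ^+ 2 + b ^+ 2) * one_sided_wave p q a b c y.
    move=> Uy; rewrite /laplacian.
    have e1 u z : U z -> 'D_u (one_sided_wave p q a b c) z =
        'D_u (fun x => k * antiwave a b c x) z by exact: (derive_agree oU E).
    rewrite !(derive_agree oU (e1 _))// E// antiE !derive2_wave/= /antiwave.
    ring.
  move=> y y12; case: (ltgtP y.1 y.2) y12 => // yy _.
    by apply: (l p _ (@open_below R)) => // z; exact: one_below.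
  by apply: (l q _ (@open_above R)) => // z; exact: one_above.
Qed.

End eigenfunctions.

(** * Riemann sums *)

Section path_integrals.
Variable R : realType.
Variable g : R -> R.
Hypothesis cg : continuous g.
Implicit Types t u v : R.

Let J (t : R) := \int[lebesgue_measure]_(r in `[0, t]) g r.

Lemma continuous_integrable (a b : R) :
  lebesgue_measure.-integrable `[a, b] (EFin \o g).
Proof.
apply: continuous_compact_integrable; first exact: segment_compact.
exact: continuous_subspaceT.
Qed.

Lemma is_derive_integral t : 0 < t -> is_derive t (1 : R) J (g t).
Proof.
move=> t0; have t1 : t < t + 1 by rewrite ltrDl.
have [d e] := continuous_FTC1_closed t1 (continuous_integrable 0 (t + 1)) t0 (@cg t).
by split => //; rewrite -derive1E.
Qed.

Lemma integral_mean_value u v : 0 <= u -> u <= v ->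
  exists2 c, u <= c <= v & J v - J u = g c * (v - u).
Proof.
move=> u0 uv.
have dJ x : x \in `]u, v[ -> is_derive x (1 : R) J (g x).
  by rewrite in_itv/= => /andP[ux _]; apply: is_derive_integral; exact: le_lt_trans ux.
have cJ : {within `[u, v], continuous J}.
  have := parameterized_integral_continuous (le_trans u0 uv) (continuous_integrable 0 v).
  apply: continuous_subspaceW => x /=; rewrite !in_itv/= => /andP[ux ->].
  by rewrite (le_trans u0).
have [c] := MVT_segment uv dJ cJ.
by rewrite in_itv/= => cuv E; exists c.
Qed.

Lemma integral_lipschitz C u v : (forall r, `|g r| <= C) -> 0 <= u -> u <= v ->
  `|J v - J u| <= C * (v - u).
Proof.
move=> gC u0 uv; have [c _ ->] := integral_mean_value u0 uv.
by rewrite normrM (ger0_norm (_ : 0 <= v - u)) ?subr_ge0// ler_wpM2r ?subr_ge0.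
Qed.

(** By the mean value theorem for integrals, a term of the sum misses the integral
    over its interval by at most the oscillation of g on it. *)
Lemma cvg_riemann_sum u v : 0 <= u -> u <= v ->
  \sum_(0 <= j < n.+1) (v - u) / n.+1%:R * g (u + j%:R * ((v - u) / n.+1%:R)) @[n --> \oo]
  --> J v - J u.
Proof.
move=> u0 uv; apply/cvgrPdist_lt => e e0.
have [e' e'0 e'e] : exists2 e' : R, 0 < e' & (v - u) * e' < e.
  exists (e / (v - u + 1)).
    by rewrite divr_gt0// ltr_wpDl// subr_ge0.
  rewrite mulrA ltr_pdivrMr ?ltr_wpDl ?subr_ge0// mulrC ltr_pM2l//.
  by rewrite ltrDl.
have [d d0 hd] := heine u v cg e'0.
pose N := Num.trunc ((v - u) / d).
exists N => // n /= Nn.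
pose h := (v - u) / n.+1%:R.
have h0 : 0 <= h by rewrite divr_ge0// subr_ge0.
have hd' : h < d.
  rewrite ltr_pdivrMr// mulrC -ltr_pdivrMr//.
  by apply: lt_le_trans (truncnS_gt _) _; rewrite ler_nat ltnS.
have hn : n.+1%:R * h = v - u by rewrite mulrC divfK// pnatr_eq0.
pose p (j : nat) := u + j%:R * h.
have pS j : p j.+1 = p j + h by rewrite /p -natr1; ring.
have p0 j : 0 <= p j by rewrite addr_ge0// mulr_ge0.
have -> : J v - J u = \sum_(0 <= j < n.+1) (J (p j.+1) - J (p j)).
  rewrite telescope_sumr// /p mul0r addr0 hn.
  by congr (J _ - _); ring.
rewrite -sumrB; apply: le_lt_trans (ler_norm_sum _ _ _) _.
apply: le_lt_trans e'e.
have -> : (v - u) * e' = \sum_(0 <= j < n.+1) h * e'.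
  by rewrite big_const_nat subn0 iter_addr addr0 -mulr_natl mulrA hn.
rewrite big_nat [leRHS]big_nat; apply: ler_sum => j /andP[_ jn].
have [||c /andP[pc cp] ->] := @integral_mean_value (p j) (p j.+1) => //.
  by rewrite pS lerDl.
have pjv : p j <= v.
  have -> : v = u + n.+1%:R * h by rewrite hn addrC subrK.
  by rewrite lerD2l ler_wpM2r// ler_nat ltnW.
have -> : p j.+1 - p j = h by rewrite pS addrAC subrr add0r.
rewrite -/h [h * g _]mulrC -mulrBl normrM (ger0_norm h0) mulrC ler_wpM2l//.
rewrite distrC; apply: ltW; apply: (hd (p j)).
  by rewrite pjv andbT lerDl mulr_ge0.
rewrite distrC ger0_norm ?subr_ge0//; apply: le_lt_trans hd'.
by rewrite lerBlDl -pS.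
Qed.

End path_integrals.

(** * Natural filtrations *)

Section filtration.
Context {R : realType} {d : measure_display} {Omega : measurableType d}.
Variable X : R -> Omega -> R * R.

Lemma natural_filtrationS (s t : R) : s <= t ->
  natural_filtration X s `<=` natural_filtration X t.
Proof.
move=> st; apply: sub_sigma_algebra2 => A [r]; rewrite /= in_itv/= => /andP[r0 rs] XA.
by exists r => //=; rewrite in_itv/= r0 (le_trans rs).
Qed.

Lemma natural_filtration_measurable (t : R) :
  (forall r, 0 <= r -> measurable_fun setT (X r)) ->
  natural_filtration X t `<=` measurable.
Proof.
move=> mX; apply: smallest_sub; first exact: sigma_algebra_measurable.
move=> A [r]; rewrite /= in_itv/= => /andP[r0 _] [B mB <-].
exact: mX.
Qed.

Lemma natural_filtration_preimage (r t : R) B : 0 <= r -> r <= t -> measurable B ->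
  natural_filtration X t (X r @^-1` B).
Proof.
move=> r0 rt mB; apply: sub_sigma_algebra; exists r; first by rewrite /= in_itv/= r0.
by exists B => //; rewrite setTI.
Qed.

End filtration.

(** * Uniqueness for the martingale problem *)

Section linear_ode.
Variable R : realType.

(** The product of m with the exponential of lam * u has derivative zero. *)
Lemma linear_ode_unique (m : R -> R) (lam s t : R) : s <= t ->
  {within `[s, t], continuous m} ->
  (forall u, s < u -> is_derive u (1 : R) m (- lam * m u)) ->
  m t = expR (- lam * (t - s)) * m s.
Proof.
move=> st cm dm.
pose e (u : R) := expR (lam * u).
have de u : is_derive u (1 : R) e (e u * lam).
  have h : is_derive u (1 : R) (fun r => lam * r) lam.
    have := is_deriveZ lam (is_derive_id u (1 : R)).
    by rewrite /GRing.scale/= mulr1.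
  exact: (@is_derive1_comp R expR (fun r => lam * r) u _ _ (is_derive_expR _) h).
have ce : continuous e.
  move=> u; apply: differentiable_continuous; apply/derivable1_diffP.
  by case: (de u).
have dg u : u \in `]s, t[ -> is_derive u (1 : R) (m * e) 0.
  rewrite in_itv/= => /andP[su _].
  have := is_deriveM (dm u su) (de u).
  move=> /is_derive_eq; apply; rewrite /GRing.scale/=; ring.
have cg : {within `[s, t], continuous (m * e)}.
  move=> x; apply: cvgM; first exact: cm.
  by apply: continuous_subspaceT.
have [c _] := MVT_segment st dg cg.
rewrite mul0r => /eqP; rewrite subr_eq0 => /eqP.
rewrite -[(m * e) t]/(m t * e t) -[(m * e) s]/(m s * e s) => E.
have e0 : e t != 0 by rewrite gt_eqF// expR_gt0.
apply: (mulIf e0); rewrite E mulrAC mulrC; congr (_ * _).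
by rewrite /e -expRD; congr expR; ring.
Qed.

End linear_ode.

Section eigenfunction_decay.
Variable R : realType.
Variables (Q : probability (path_space R) R) (rho : R).
Hypothesis mp : solves_martingale_problem Q rho (@coordinate R).
Variables (f : R * R -> R) (lam : R).
Hypotheses (Df : calD f) (Gf : forall x, G0 rho f x = - lam * f x).

Let cf : continuous f. Proof. by case: Df => -[]. Qed.

Let F := natural_filtration (@coordinate R).

Let I (t : R) (w : path_space R) :=
  \int[lebesgue_measure]_(s in `[0, t]) G0 rho f (coordinate s w).

Let g (w : path_space R) (r : R) := - lam * f (extended_path w r).

Let cg w : continuous (g w).
Proof.
move=> r; apply: cvgM; first exact: cvg_cst.
apply: (cvg_comp _ _ (@continuous_extended_path R w r)); exact: cf.
Qed.

Let IE t w : I t w = \int[lebesgue_measure]_(r in `[0, t]) g w r.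
Proof.
apply: eq_Rintegral => r; rewrite inE/= in_itv/= => /andP[r0 _].
by rewrite Gf /g extended_path_ge0.
Qed.

Let mf t : 0 <= t -> measurable_fun setT (fun w : path_space R => f (coordinate t w)).
Proof.
move=> t0; apply: measurableT_comp; first exact: continuous_measurable_fun2.
exact: measurable_coordinate.
Qed.

Let M t w := f (coordinate t w) - f (coordinate 0 w) - I t w.

Let mart : martingale Q F M.
Proof. by case: mp => _; apply. Qed.

Let mM t : 0 <= t -> measurable_fun setT (M t).
Proof. by move=> t0; case: mart => _ /(_ _ t0)/measurable_int/measurable_EFinP. Qed.

Let m (A : set (path_space R)) t := \int[Q]_(w in A) f (coordinate t w).

(** The martingale property writes an increment of m A as the integral over A of a
    time integral of - lam * f. Dominated convergence differentiates it, which
    gives the linear equation m' = - lam * m. *)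
Lemma eigenfunction_decay s t A : 0 <= s -> s <= t -> F s A ->
  m A t = expR (- lam * (t - s)) * m A s.
Proof.
move=> s0 st FA.
have mA : measurable A.
  apply: natural_filtration_measurable FA => r r0; exact: measurable_coordinate.
have [_ [C fC]] := calD_bounded Df.
have gC w r : `|g w r| <= `|lam| * C by rewrite normrM normrN ler_wpM2l.
have Qoo := probability_lty Q mA.
have mI u v : 0 <= u -> 0 <= v -> measurable_fun setT (fun w => I v w - I u w).
  move=> u0 v0.
  have -> : (fun w => I v w - I u w) =
      (fun w => (f (coordinate v w) - f (coordinate u w)) - (M v w - M u w)).
    by apply/funext => w; rewrite /M; ring.
  by apply: measurable_funB; apply: measurable_funB; [exact: mf|exact: mf|exact: mM|exact: mM].
have If u : 0 <= u -> Q.-integrable A (EFin \o (fun w => f (coordinate u w))).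
  move=> u0; apply: (@bounded_integrable _ _ _ _ _ _ C) => //.
  exact: measurable_funTS (mf u0).
have IM u : 0 <= u -> Q.-integrable A (EFin \o M u).
  move=> u0; case: mart => _ /(_ _ u0) iM _.
  exact: integrableS iM.
have incr u v : s <= u -> s <= v -> m A v - m A u = \int[Q]_(w in A) (I v w - I u w).
  move=> su sv.
  have u0 := le_trans s0 su; have v0 := le_trans s0 sv.
  have ME r : s <= r -> \int[Q]_(w in A) M r w = \int[Q]_(w in A) M s w.
    move=> sr; case: mart => _ _ /(_ s r s0 sr A FA) E.
    by rewrite /Rintegral E.
  under eq_Rintegral => w _.
    have -> : I v w - I u w = (f (coordinate v w) - f (coordinate u w)) - (M v w - M u w).
      by rewrite /M; ring.
    over.
  have E1 := RintegralB mA (If v v0) (If u u0).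
  have E2 := RintegralB mA (IM v v0) (IM u u0).
  rewrite (ME u su) (ME v sv) subrr in E2.
  rewrite RintegralB//; [|exact: integrableB_EFin mA (If v v0) (If u u0)|
    exact: integrableB_EFin mA (IM v v0) (IM u u0)].
  by rewrite E1 E2 subr0.
have lip u v : s <= u -> u <= v -> `|m A v - m A u| <= `|lam| * C * (v - u).
  move=> su uv; have u0 := le_trans s0 su; have v0 := le_trans u0 uv.
  rewrite incr//; last exact: le_trans uv.
  have b w : `|I v w - I u w| <= `|lam| * C * (v - u).
    rewrite !IE; apply: integral_lipschitz => //; exact: cg.
  have c0 : 0 <= `|lam| * C * (v - u) by exact: le_trans (normr_ge0 _) (b point).
  have iI : Q.-integrable A (EFin \o (fun w => I v w - I u w)).
    apply: (@bounded_integrable _ _ _ _ _ _ (`|lam| * C * (v - u))) => //.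
    exact: measurable_funTS (mI _ _ u0 v0).
  apply: (le_trans (le_normr_Rintegral _ iI)) => //.
  apply: (@le_trans _ _ (\int[Q]_(w in A) (`|lam| * C * (v - u)))).
    apply: le_Rintegral => //.
      exact: integrable_norm.
    exact: finite_measure_integrable_cst.
  rewrite Rintegral_cst// ler_piMr//.
  by rewrite -[leRHS]/(fine 1%E) fine_le ?fin_num_measure// probability_le1.
apply: linear_ode_unique => //.
- apply/subspace_continuousP => x /=; rewrite in_itv/= => /andP[sx xt].
  apply/cvgrPdist_lt => e e0.
  have K0 : 0 < `|lam| * C + 1.
    by rewrite ltr_wpDl// mulr_ge0// (le_trans _ (fC point)).
  have : \forall y \near x, ball x (e / (`|lam| * C + 1)) y.
    by apply: nbhsx_ballx; rewrite divr_gt0.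
  rewrite /within/=; apply: filterS => y; rewrite /ball/= ltr_pdivlMr// => xy.
  rewrite in_itv/= => /andP[sy yt]; apply: le_lt_trans xy.
  wlog xy : x y sx xt sy yt / x <= y => [hw|].
    have [/hw|/ltW/hw] := leP x y; first exact.
    by rewrite distrC [`|x - y|]distrC; exact.
  rewrite distrC; apply: le_trans (lip _ _ sx xy) _.
  rewrite distrC (ger0_norm (_ : 0 <= y - x)) ?subr_ge0// mulrC ler_wpM2l ?subr_ge0//.
  by rewrite lerDl.
- move=> u su; have u0 := le_trans s0 (ltW su); have u0' := le_lt_trans s0 su.
  have Ib w k : s <= u + k -> `|I (u + k) w - I u w| <= `|lam| * C * `|k|.
    move=> sk; rewrite !IE; have [k0|k0] := leP 0 k.
      have := @integral_lipschitz R (g w) (@cg w) (`|lam| * C) u (u + k) (gC w) u0.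
      by rewrite lerDl => /(_ k0); rewrite (_ : u + k - u = k) ?(ger0_norm k0)//; ring.
    have := @integral_lipschitz R (g w) (@cg w) (`|lam| * C) (u + k) u (gC w).
    rewrite (le_trans s0 sk) => /(_ isT); rewrite gerDl => /(_ (ltW k0)).
    by rewrite distrC; rewrite (_ : u - (u + k) = - k) ?(ltr0_norm k0)//; ring.
  have D : h^-1 *: (m A (h *: 1 + u) - m A u) @[h --> (0 : R)^'] --> - lam * m A u.
    apply/cvgr_dnbhsP => h [h0 hcvg].
    have [N _ hN] : \forall n \near \oo, s < u + h n.
      have us0 : 0 < u - s by rewrite subr_gt0.
      have /cvgr0_norm_lt/(_ _ us0) := hcvg.
      by apply: filterS => n; rewrite ltr_norml => /andP[]; lra.
    rewrite -(cvg_shiftn N)/=.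
    have sh n : s <= u + h (n + N)%N by apply/ltW/hN; rewrite /= leq_addl.
    have -> : (fun n => (h (n + N)%N)^-1 *: (m A (h (n + N)%N *: 1 + u) - m A u)) =
      (fun n => \int[Q]_(w in A) ((h (n + N)%N)^-1 * (I (u + h (n + N)%N) w - I u w))).
      apply/funext => n.
      have -> : h (n + N)%N *: 1 + u = u + h (n + N)%N.
        by rewrite addrC /GRing.scale/= mulr1.
      rewrite incr//; last exact: ltW.
      rewrite RintegralZl//.
      apply: (@bounded_integrable _ _ _ _ _ _ (`|lam| * C * `|h (n + N)%N|)) => //.
        by apply: measurable_funTS; apply: mI => //; exact: le_trans (sh n).
      by move=> w _; apply: Ib.
    have -> : - lam * m A u = \int[Q]_(w in A) g w u.
      rewrite /m -RintegralZl//; last exact: If.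
      by apply: eq_Rintegral => w _; rewrite /g extended_path_ge0.
    apply: (@bounded_cvg_integral _ _ _ _ _ _ _ (`|lam| * C)) => //.
    + move=> n; apply: measurable_funTS; apply: measurable_funM => //.
      by apply: mI => //; exact: le_trans (sh n).
    + move=> n w _; rewrite normrM normfV ler_pdivrMl ?normr_gt0// mulrC.
      exact: Ib.
    + move=> w _.
      have [dJ EJ] := is_derive_integral (@cg w) u0'.
      have cJ : h^-1 *: ((\int[lebesgue_measure]_(r in `[0, (h *: 1 + u)]) g w r) -
          (\int[lebesgue_measure]_(r in `[0, u]) g w r)) @[h --> (0 : R)^'] --> g w u.
        by rewrite -EJ; exact: dJ.
      move/cvgr_dnbhsP : cJ => /(_ (fun n => h (n + N)%N)).
      have hc : h (n + N)%N @[n --> \oo] --> (0 : R) by rewrite (cvg_shiftn N h).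
      move=> /(_ (conj (fun n => h0 (n + N)%N) hc)).
      under eq_fun do rewrite [_ *: 1 + u]addrC /GRing.scale/= mulr1.
      by under [X in _ -> X @ _ --> _]eq_fun do rewrite !IE.
  split; first by apply/cvg_ex; exists (- lam * m A u).
  exact: cvg_lim D.
Qed.

End eigenfunction_decay.

Section uniqueness.
Variable R : realType.

Lemma cylinder_rcons (ts : seq R) t B :
  cylinder (rcons ts t) B = cylinder ts B `&` coordinate t @^-1` B t.
Proof.
apply/seteqP; split => w /=.
  move=> h; split; last by apply: h; rewrite mem_rcons mem_head.
  by move=> r rts; apply: h; rewrite mem_rcons inE rts orbT.
by move=> [h1 h2] r; rewrite mem_rcons inE => /predU1P[->//|/h1].
Qed.

Lemma cylinder_filtration (ts : seq R) B s :
  (forall t, t \in ts -> 0 <= t <= s) -> (forall t, measurable (B t)) ->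
  natural_filtration (@coordinate R) s (cylinder ts B).
Proof.
move=> + mB; elim/last_ind: ts => [|ts t ih] h.
  have -> : cylinder [::] B = setT by apply/seteqP; split.
  exact: (@measurableT _ (g_sigma_algebraType
    (\bigcup_(r in `[0, s]) preimage_set_system setT (@coordinate R r) measurable))).
rewrite cylinder_rcons.
apply: (@measurableI _ (g_sigma_algebraType
    (\bigcup_(r in `[0, s]) preimage_set_system setT (@coordinate R r) measurable))).
  by apply: ih => r rts; apply: h; rewrite mem_rcons inE rts orbT.
have /andP[t0 ts'] : 0 <= t <= s by apply: h; rewrite mem_rcons mem_head.
exact: natural_filtration_preimage.
Qed.

Lemma cylinder_measurable (ts : seq R) B :
  (forall t, t \in ts -> 0 <= t) -> (forall t, measurable (B t)) ->
  measurable (cylinder ts B).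
Proof.
move=> + mB; elim/last_ind: ts => [|ts t ih] h.
  by have -> : cylinder [::] B = setT by apply/seteqP; split.
rewrite cylinder_rcons; apply: measurableI.
  by apply: ih => r rts; apply: h; rewrite mem_rcons inE rts orbT.
rewrite -[X in measurable X]setTI; apply: measurable_coordinate => //.
by apply: h; rewrite mem_rcons mem_head.
Qed.

Lemma path_le_bounds (x : R) ts r :
  path <=%R x ts -> r \in x :: ts -> x <= r <= last x ts.
Proof.
elim: ts x r => [|y ts ih] x r /=; first by rewrite inE => _ /eqP ->; rewrite lexx.
move=> /andP[xy p]; rewrite inE => /predU1P[->|/(ih _ _ p)/andP[yr ->]].
  by have /andP[_ yl] := ih y y p (mem_head _ _); rewrite lexx (le_trans xy).
by rewrite (le_trans xy).
Qed.

Variables (rho b1 b2 : R).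
Variables P Q : probability (path_space R) R.
Hypotheses (mpP : solves_martingale_problem P rho (@coordinate R))
  (mpQ : solves_martingale_problem Q rho (@coordinate R)).
Hypotheses (P0 : P [set w | coordinate 0 w = (b1, b2)] = 1%E)
  (Q0 : Q [set w | coordinate 0 w = (b1, b2)] = 1%E).

Let point_measurable : measurable [set (b1, b2)].
Proof.
have -> : [set (b1, b2)] = [set b1] `*` [set b2].
  by apply/seteqP; split => -[x y] /= [-> ->].
exact: measurableX.
Qed.

Let init (P' : probability (path_space R) R) B :
  P' [set w | coordinate 0 w = (b1, b2)] = 1%E -> measurable B ->
  P' (coordinate 0 @^-1` B) = (if pselect (B (b1, b2)) then 1 else 0)%E.
Proof.
move=> P'0 mB.
have mC C : measurable C -> measurable (coordinate 0 @^-1` C : set (path_space R)).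
  by move=> mC; rewrite -[X in measurable X]setTI; exact: measurable_coordinate.
have mS : measurable [set w : path_space R | coordinate 0 w = (b1, b2)].
  exact: mC point_measurable.
case: pselect => Bb.
  apply/eqP; rewrite eq_le probability_le1//=; last exact: mC.
  rewrite -P'0; apply: le_measure; rewrite ?inE//; first exact: mC.
  by move=> w /= ->.
have : (P' (coordinate 0 @^-1` (~` B)) <= 1)%E.
  by apply: probability_le1; apply: mC; exact: measurableC.
have h : (P' [set w | coordinate 0 w = (b1, b2)] <= P' (coordinate 0 @^-1` (~` B)))%E.
  apply: le_measure; rewrite ?inE//; first by apply: mC; exact: measurableC.
  by move=> w /= ->.
rewrite P'0 in h => h'.
have e1 : P' (coordinate 0 @^-1` (~` B)) = 1%E.
  by apply/eqP; rewrite eq_le h h'.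
have := probability_setC P' (mC _ mB).
rewrite preimage_setC in e1; rewrite e1 => /esym/eqP.
have : P' (coordinate 0 @^-1` B) \is a fin_num by rewrite fin_num_measure//; exact: mC.
case: (P' (coordinate 0 @^-1` B)) => // r _.
by rewrite -EFinB eqe => /eqP rr; congr (_%:E); lra.
Qed.

(** Induction on the number of times. The induction hypothesis, with the set at the
    last time s made smaller, identifies the laws of the position at time s on
    the cylinder; the decay of eigenfunctions carries this over to the next time. *)
Let law_eq (ts : seq R) B : path <=%R 0 ts -> (forall t, measurable (B t)) ->
  P (cylinder (0 :: ts) B) = Q (cylinder (0 :: ts) B).
Proof.
elim/last_ind: ts B => [|ts t ih] B.
  move=> _ mB; have -> : cylinder [:: 0] B = coordinate 0 @^-1` B 0.
    apply/seteqP; split => w /=; first by apply; rewrite inE.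
    by move=> h t; rewrite inE => /eqP ->.
  by rewrite !init.
rewrite rcons_path => /andP[pts st] mB; set s := last 0 ts in st.
have ts0s r : r \in 0 :: ts -> 0 <= r <= s by exact: path_le_bounds.
have s0 : 0 <= s by have /andP[] := ts0s 0 (mem_head _ _).
have t0 : 0 <= t := le_trans s0 st.
have sts : s \in 0 :: ts by exact: mem_last.
have mA : measurable (cylinder (0 :: ts) B).
  by apply: cylinder_measurable => // r /ts0s/andP[].
rewrite -rcons_cons cylinder_rcons.
have mXs := measurable_coordinate s0; have mXt := measurable_coordinate t0.
have IH : forall E, measurable E -> image_on P mA mXs E = image_on Q mA mXs E.
  move=> E mE; rewrite !image_onE.
  pose B' r := if r == s then B r `&` E else B r.
  have -> : coordinate s @^-1` E `&` cylinder (0 :: ts) B = cylinder (0 :: ts) B'.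
    apply/seteqP; split => w /=.
      move=> [Ew h] r rts; rewrite /B'; case: eqP => [->|_]; last exact: h.
      by split => //; exact: h.
    move=> h; split.
      by have := h s sts; rewrite /B' eqxx => -[].
    by move=> r /h; rewrite /B'; case: ifP => // _ [].
  apply: ih => // r; rewrite /B'; case: ifP => _ //; exact: measurableI.
have FA : natural_filtration (@coordinate R) s (cylinder (0 :: ts) B).
  exact: cylinder_filtration.
have int (P' : probability (path_space R) R) f r (mr : measurable_fun setT (coordinate r)) :
    calD f -> P'.-integrable (cylinder (0 :: ts) B) (EFin \o (f \o @coordinate R r)).
  move=> Df; have [mf [C fC]] := calD_bounded Df.
  apply: (@bounded_integrable _ _ _ _ _ _ C) => //.
  - exact: probability_lty.
  - by apply: measurable_funTS; exact: measurableT_comp.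
  - by move=> w _; exact: fC.
have key (h : R * R -> R) (lam : R) : calD h ->
    (forall x, G0 rho h x = - lam * h x) ->
    \int[image_on P mA mXt]_x h x = \int[image_on Q mA mXt]_x h x.
  move=> Df Gf; have [mh _] := calD_bounded Df.
  rewrite !Rintegral_image_on//; try exact: int.
  rewrite (eigenfunction_decay mpP Df Gf s0 st FA) (eigenfunction_decay mpQ Df Gf s0 st FA).
  congr (_ * _).
  rewrite -(Rintegral_image_on mA mXs mh); last exact: int.
  rewrite -(Rintegral_image_on mA mXs mh); last exact: int.
  by rewrite /Rintegral; congr fine; apply: eq_measure_integral => E mE _; exact: IH.
have fin (P' : probability (path_space R) R) : (image_on P' mA mXt setT < +oo)%E.
  rewrite image_onE preimage_setT setTI.
  exact: probability_lty.
have := wave_uniqueness (fin P) (fin Q) _ _ (mB t).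
rewrite !image_onE ![coordinate t @^-1` _ `&` _]setIC; apply.
- by move=> a c; apply: (key _ (2^-1 * rho * a ^+ 2)) => [|x]; [exact: wave_calD|exact: G0_wave].
- move=> p q a b c; apply: (key _ (2^-1 * rho * (a ^+ 2 + b ^+ 2))) => [|x].
    exact: one_sided_wave_calD.
  exact: G0_one_sided_wave.
Qed.

Let cylinder_eq A : cylinders A -> P A = Q A.
Proof.
move=> [ts [B [ts0 mB ->]]].
pose B' t := if t \in ts then B t else setT.
have -> : cylinder ts B = cylinder (0 :: sort <=%R ts) B'.
  apply/seteqP; split => w /= h t.
    by rewrite /B'; case: ifP => // tts _; exact: h.
  by move=> tts; have := h t; rewrite /B' tts inE mem_sort tts orbT; apply.
apply: law_eq => [|t]; last by rewrite /B'; case: ifP.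
rewrite (path_sortedE le_trans) sort_le_sorted andbT.
by apply/allP => t; rewrite mem_sort; exact: ts0.
Qed.

(** The two solutions agree on cylinders, which are stable under intersection and
    generate the Borel sets of the path space. *)
Lemma martingale_problem_unique A : measurable A -> P A = Q A.
Proof.
move=> mA; apply: (@g_sigma_algebra_measure_unique _ R (path_space R) (@cylinders R)
  _ (fun=> setT)) => //.
- by move=> _ [ts [B [ts0 mB ->]]]; exact: cylinder_measurable.
- by move=> _; exists [::], (fun=> setT); split => //; apply/seteqP; split.
- by rewrite bigcup_const.
- move=> _ _ [ts [B [ts0 mB ->]]] [ts' [B' [ts'0 mB' ->]]].
  exists (ts ++ ts'), (fun t => (if t \in ts then B t else setT) `&`
    (if t \in ts' then B' t else setT)); split.
  + by move=> t; rewrite mem_cat => /orP[/ts0|/ts'0].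
  + by move=> t; apply: measurableI; case: ifP.
  + apply/seteqP; split => w /=.
      move=> [h h'] t _; split; case: ifP => // tts; [exact: h|exact: h'].
    move=> h; split => t tts; have := h t; rewrite mem_cat tts ?orbT => /(_ isT) [] //.
- by move=> k; apply: le_lt_trans (probability_le1 _ _) _; rewrite ?ltry.
- exact: path_measurable_cylinders.
Qed.

End uniqueness.

(** * Second order expansion of the functions in the domain *)

Section one_variable_taylor.
Variable R : realType.
Implicit Types (a b c t : R).

Definition between a b t := Num.min a b <= t <= Num.max a b.

Lemma betweenl a b : between a b a.
Proof. by rewrite /between ge_min lexx le_max lexx. Qed.

Lemma between_norm a b t : between a b t -> `|t - a| <= `|b - a|.
Proof.
rewrite /between; have [ab|ba] := leP a b => /andP[h1 h2].
  by rewrite !ger0_norm ?subr_ge0// lerD2r.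
by rewrite !ler0_norm ?subr_le0 ?(ltW ba)// lerN2 lerD2r.
Qed.

Lemma between_trans a b c t : between a b c -> between a c t -> between a b t.
Proof.
rewrite /between => /andP[h1 h2].
have [ac|ca] := leP a c => /andP[h3 h4]; apply/andP; split.
- by apply: le_trans h3; rewrite ge_min lexx.
- exact: le_trans h2.
- exact: le_trans h3.
- by apply: (le_trans h4); rewrite le_max lexx.
Qed.

Lemma mean_value_between (phi dphi : R -> R) a b :
  (forall t, between a b t -> is_derive t (1 : R) phi (dphi t)) ->
  exists2 c, between a b c & phi b - phi a = dphi c * (b - a).
Proof.
move=> d.
have cont (x y : R) : (forall t, x <= t <= y -> between a b t) -> {within `[x, y], continuous phi}.
  move=> h; apply: derivable_within_continuous => t; rewrite in_itv/= => /h /d.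
  by case.
have [ab|ba] := leP a b.
  have bt t : a <= t <= b -> between a b t by rewrite /between min_l// max_r.
  have [|c] := @MVT_segment R phi dphi a b ab _ (cont a b bt).
    by move=> t; rewrite in_itv/= => /andP[/ltW at_ /ltW tb]; apply: d; apply: bt; rewrite at_.
  by rewrite in_itv/= => /bt cab E; exists c.
have bt t : b <= t <= a -> between a b t.
  by rewrite /between min_r ?max_l// ltW.
have [|c] := @MVT_segment R phi dphi b a (ltW ba) _ (cont b a bt).
  by move=> t; rewrite in_itv/= => /andP[/ltW at_ /ltW tb]; apply: d; apply: bt; rewrite at_.
rewrite in_itv/= => /bt cab E; exists c => //.
by rewrite -opprB E -mulrN opprB.
Qed.

Lemma taylor1_between (phi dphi : R -> R) (w : R) a b :
  (forall t, between a b t -> is_derive t (1 : R) phi (dphi t)) ->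
  (forall t, between a b t -> `|dphi t - dphi a| <= w) ->
  `|phi b - phi a - dphi a * (b - a)| <= w * `|b - a|.
Proof.
move=> d dw; have [c cab ->] := mean_value_between d.
by rewrite -mulrBl normrM ler_wpM2r// dw.
Qed.

Lemma taylor2_between (phi dphi d2phi : R -> R) (w : R) a b :
  (forall t, between a b t -> is_derive t (1 : R) phi (dphi t)) ->
  (forall t, between a b t -> is_derive t (1 : R) dphi (d2phi t)) ->
  (forall t, between a b t -> `|d2phi t - d2phi a| <= w) ->
  `|phi b - phi a - dphi a * (b - a) - 2^-1 * d2phi a * (b - a) ^+ 2|
    <= w * (b - a) ^+ 2.
Proof.
move=> d d2 dw.
pose psi t := phi t - dphi a * (t - a) - 2^-1 * d2phi a * (t - a) ^+ 2.
have dpsi t : between a b t ->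
    is_derive t (1 : R) psi (dphi t - dphi a - d2phi a * (t - a)).
  move=> abt; have := d t abt => dt.
  have -> : psi = phi - (dphi a *: (id - cst a)) - ((2^-1 * d2phi a) *: ((id - cst a) ^+ 2)) by [].
  apply: is_derive_eq.
  by rewrite subr0 /GRing.scale/= !mulr1 expr1 -[(id - cst a) t]/(t - a); field.
have [c abc E] := mean_value_between dpsi.
have -> : phi b - phi a - dphi a * (b - a) - 2^-1 * d2phi a * (b - a) ^+ 2 = psi b - psi a.
  by rewrite /psi subrr mulr0 expr0n/= mulr0; ring.
have h : `|dphi c - dphi a - d2phi a * (c - a)| <= w * `|c - a|.
  by apply: taylor1_between => t act; [apply: d2|apply: dw]; exact: between_trans act.
have w0 : 0 <= w by apply: le_trans (dw a (betweenl _ _)).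
rewrite E normrM -(real_normK (num_real (b - a))) expr2 mulrA ler_wpM2r//.
by apply: (le_trans h); rewrite ler_wpM2l// between_norm.
Qed.

(** The path from x to y runs along the first axis and then along the second,
    so that only one-variable expansions are involved. *)
Lemma taylor_corner (g g1 g2 g11 g12 g22 : R -> R -> R) (x1 x2 y1 y2 w : R) :
  (forall t, between x1 y1 t ->
    [/\ is_derive t (1 : R) (g ^~ x2) (g1 t x2),
        is_derive t (1 : R) (g1 ^~ x2) (g11 t x2) &
        is_derive t (1 : R) (g2 ^~ x2) (g12 t x2)]) ->
  (forall t, between x2 y2 t ->
    is_derive t (1 : R) (g y1) (g2 y1 t) /\
    is_derive t (1 : R) (g2 y1) (g22 y1 t)) ->
  (forall t, between x1 y1 t ->
    `|g11 t x2 - g11 x1 x2| <= w /\ `|g12 t x2 - g12 x1 x2| <= w) ->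
  (forall t, between x2 y2 t -> `|g22 y1 t - g22 x1 x2| <= w) ->
  `|g y1 y2 - g x1 x2 - (g1 x1 x2 * (y1 - x1) + g2 x1 x2 * (y2 - x2) +
     2^-1 * (g11 x1 x2 * (y1 - x1) ^+ 2 + g22 x1 x2 * (y2 - x2) ^+ 2) +
     g12 x1 x2 * ((y1 - x1) * (y2 - x2)))|
  <= 4 * w * ((y1 - x1) ^+ 2 + (y2 - x2) ^+ 2).
Proof.
move=> H1 H2 W1 W2.
have E1 : `|g y1 x2 - g x1 x2 - g1 x1 x2 * (y1 - x1) -
    2^-1 * g11 x1 x2 * (y1 - x1) ^+ 2| <= w * (y1 - x1) ^+ 2.
  apply: (@taylor2_between (g ^~ x2) (g1 ^~ x2) (g11 ^~ x2)) => t h.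
  - by case: (H1 t h).
  - by case: (H1 t h).
  - by case: (W1 t h).
have E2 : `|g2 y1 x2 - g2 x1 x2 - g12 x1 x2 * (y1 - x1)| <= w * `|y1 - x1|.
  apply: (@taylor1_between (g2 ^~ x2) (g12 ^~ x2)) => t h.
  - by case: (H1 t h).
  - by case: (W1 t h).
have w0 : 0 <= w by apply: le_trans (W2 x2 (betweenl _ _)).
have E3 : `|g y1 y2 - g y1 x2 - g2 y1 x2 * (y2 - x2) -
    2^-1 * g22 y1 x2 * (y2 - x2) ^+ 2| <= (w + w) * (y2 - x2) ^+ 2.
  apply: (@taylor2_between (g y1) (g2 y1) (g22 y1)) => t h.
  - by case: (H2 t h).
  - by case: (H2 t h).
  - have -> : g22 y1 t - g22 y1 x2 = (g22 y1 t - g22 x1 x2) - (g22 y1 x2 - g22 x1 x2).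
      by ring.
    apply: (le_trans (ler_normB _ _)); apply: lerD; apply: W2 => //.
    exact: betweenl.
have E4 : `|g22 y1 x2 - g22 x1 x2| <= w by apply: W2; exact: betweenl.
set D1 := y1 - x1 in E1 E2 *; set D2 := y2 - x2 in E3 *.
have -> : g y1 y2 - g x1 x2 - (g1 x1 x2 * D1 + g2 x1 x2 * D2 +
     2^-1 * (g11 x1 x2 * D1 ^+ 2 + g22 x1 x2 * D2 ^+ 2) + g12 x1 x2 * (D1 * D2)) =
  (g y1 x2 - g x1 x2 - g1 x1 x2 * D1 - 2^-1 * g11 x1 x2 * D1 ^+ 2) +
  (g y1 y2 - g y1 x2 - g2 y1 x2 * D2 - 2^-1 * g22 y1 x2 * D2 ^+ 2) +
  (g2 y1 x2 - g2 x1 x2 - g12 x1 x2 * D1) * D2 +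
  2^-1 * (g22 y1 x2 - g22 x1 x2) * D2 ^+ 2 by field.
have F2 : `|(g2 y1 x2 - g2 x1 x2 - g12 x1 x2 * D1) * D2| <= w * (D1 ^+ 2 + D2 ^+ 2).
  rewrite normrM; apply: (@le_trans _ _ (w * `|D1| * `|D2|)).
    by rewrite ler_wpM2r.
  rewrite -mulrA ler_wpM2l// -(real_normK (num_real D1)) -(real_normK (num_real D2)).
  have := sqr_ge0 (`|D1| - `|D2|); have := sqr_ge0 (`|D1|); have := sqr_ge0 (`|D2|).
  nra.
have F4 : `|2^-1 * (g22 y1 x2 - g22 x1 x2) * D2 ^+ 2| <= w * D2 ^+ 2.
  rewrite normrM (ger0_norm (sqr_ge0 D2)) ler_wpM2r ?sqr_ge0//.
  rewrite normrM ger0_norm ?invr_ge0//.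
  by apply: le_trans E4; rewrite ler_piMl// invf_le1// ler1n.
have s1 := sqr_ge0 D1; have s2 := sqr_ge0 D2.
apply: (le_trans (ler_normD _ _)); apply: (le_trans (lerD (ler_normD _ _) (lexx _))).
apply: (le_trans (lerD (lerD (ler_normD _ _) (lexx _)) (lexx _))).
apply: (le_trans (lerD (lerD (lerD E1 E3) F2) F4)).
have : 0 <= w * D1 ^+ 2 by rewrite mulr_ge0.
have : 0 <= w * D2 ^+ 2 by rewrite mulr_ge0.
nra.
Qed.

(** Expanding the second difference of g in either order evaluates either
    mixed derivative at a point of the same square. *)
Lemma second_difference (g g1 g2 g12 g21 : R -> R -> R) (x1 x2 k : R) : k != 0 ->
  (forall a b, between x1 (x1 + k) a -> between x2 (x2 + k) b ->
    [/\ is_derive a (1 : R) (g ^~ b) (g1 a b), is_derive b (1 : R) (g a) (g2 a b),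
        is_derive b (1 : R) (g1 a) (g12 a b) & is_derive a (1 : R) (g2 ^~ b) (g21 a b)]) ->
  exists a b a' b', [/\ between x1 (x1 + k) a, between x2 (x2 + k) b,
    between x1 (x1 + k) a', between x2 (x2 + k) b' & g12 a b = g21 a' b'].
Proof.
move=> k0 D.
have L (p q : R) : between p q q by rewrite /between ge_min lexx orbT le_max lexx orbT.
have L' (p q : R) : between p q p by exact: betweenl.
have [|a ha Ea] := @mean_value_between (fun t => g t (x2 + k) - g t x2)
  (fun t => g1 t (x2 + k) - g1 t x2) x1 (x1 + k).
  move=> t ht; have [h1 _ _ _] := D t (x2 + k) ht (L _ _).
  have [h2 _ _ _] := D t x2 ht (L' _ _).
  exact: is_deriveB.
have [|b hb Eb] := @mean_value_between (g1 a) (g12 a) x2 (x2 + k).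
  by move=> t ht; case: (D a t ha ht).
have [|b' hb' Eb'] := @mean_value_between (fun t => g (x1 + k) t - g x1 t)
  (fun t => g2 (x1 + k) t - g2 x1 t) x2 (x2 + k).
  move=> t ht; have [_ h1 _ _] := D (x1 + k) t (L _ _) ht.
  have [_ h2 _ _] := D x1 t (L' _ _) ht.
  exact: is_deriveB.
have [|a' ha' Ea'] := @mean_value_between (g2 ^~ b') (g21 ^~ b') x1 (x1 + k).
  by move=> t ht; case: (D t b' ht hb').
exists a, b, a', b'; split => //.
have xk (t : R) : t + k - t = k by ring.
rewrite !xk in Ea Eb Ea' Eb'.
have kk : k * k != 0 by rewrite mulf_neq0.
have E : g12 a b * k * k = g21 a' b' * k * k.
  by rewrite -Eb -Ea -Ea' -Eb'; ring.
by apply: (mulIf kk); rewrite !mulrA.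
Qed.

End one_variable_taylor.

Section closed_half_plane.
Variable R : realType.
Implicit Types (x y z u v : R * R).

Let e1 : R * R := (1, 0).
Let e2 : R * R := (0, 1).

Let axis1 : axis e1. Proof. by left. Qed.
Let axis2 : axis e2. Proof. by right. Qed.

Lemma is_derive_axis1 (f : R * R -> R) (t b : R) :
  derivable f (t, b) (1, 0) ->
  is_derive t (1 : R) (fun s => f (s, b)) ('D_(1, 0) f (t, b)).
Proof.
have E (s : R) : s *: ((1, 0) : R * R) + (0, b) = (s, b).
  by apply: injective_projections; rewrite /= /GRing.scale/= ?mulr1 ?mulr0 ?addr0 ?add0r.
have F : (fun s => f (s, b)) = (fun s : R => f (s *: ((1, 0) : R * R) + (0, b))).
  by apply/funext => s; rewrite E.
by move=> d; rewrite F; apply/is_derive_line; rewrite E.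
Qed.

Lemma is_derive_axis2 (f : R * R -> R) (a t : R) :
  derivable f (a, t) (0, 1) ->
  is_derive t (1 : R) (fun s => f (a, s)) ('D_(0, 1) f (a, t)).
Proof.
have E (s : R) : s *: ((0, 1) : R * R) + (a, 0) = (a, s).
  by apply: injective_projections; rewrite /= /GRing.scale/= ?mulr1 ?mulr0 ?addr0 ?add0r.
have F : (fun s => f (a, s)) = (fun s : R => f (s *: ((0, 1) : R * R) + (a, 0))).
  by apply/funext => s; rewrite E.
by move=> d; rewrite F; apply/is_derive_line; rewrite E.
Qed.

(** Data of an open half-plane U with closure K: a direction s that points
    into U, and a continuous retraction r of the plane onto K. *)
Record half_plane_data (U K : set (R * R)) (s : R * R) (r : R * R -> R * R) := {
  hp_open : open U;
  hp_sub : U `<=` K;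
  hp_in : forall x (e : R), K x -> 0 < e -> U (x + e *: s);
  hp_s : `|s.1| <= 1 /\ `|s.2| <= 1;
  hp_corner : forall x y, U x -> U y -> U (y.1, x.2) \/ U (x.1, y.2);
  hp_seg1 : forall a b c t : R, U (a, c) -> U (b, c) -> between a b t -> U (t, c);
  hp_seg2 : forall a b c t : R, U (c, a) -> U (c, b) -> between a b t -> U (c, t);
  hp_r : forall x, K (r x);
  hp_rK : forall x, K x -> r x = x;
  hp_rc : continuous r;
  hp_diag : forall a : R, K (a, a)
}.

Variables (U K : set (R * R)) (s : R * R) (r : R * R -> R * R).
Hypothesis H : half_plane_data U K s r.

Let ball_shift x (e d : R) : 0 < e -> e < d -> ball x d (x + e *: s).
Proof.
move=> e0 ed; have [s1 s2] := hp_s H.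
have h (a b : R) : `|b| <= 1 -> `|a - (a + e * b)| < d.
  move=> b1; rewrite opprD addrA subrr add0r normrN normrM gtr0_norm//.
  by apply: le_lt_trans ed; rewrite ler_piMr// ltW.
by split; apply: h.
Qed.

Lemma closed_half_plane_closure : K `<=` closure U.
Proof.
move=> x Kx B /nbhs_ballP[d /= d0 xd].
have d20 : 0 < d / 2 by rewrite divr_gt0.
exists (x + (d / 2) *: s); split; first exact: (hp_in H).
by apply: xd; apply: ball_shift => //; rewrite ltr_pdivrMr// ltr_pMr// ltr1n.
Qed.

Lemma uniform_extensionP (g h : R * R -> R) : uniform_extension U g h ->
  forall e : R, 0 < e -> exists2 d : R, 0 < d &
    forall x y, K x -> K y -> ball x d y -> `|h x - h y| < e.
Proof.
move=> [/unif_continuousP uh _] e e0.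
have [d /= d0 hd] := uh e e0.
exists d => // x y Kx Ky xy.
have := hd (x, y); rewrite /= ball_subspace_ball /subspace_ball.
have -> : x \in closure U by rewrite inE; exact: closed_half_plane_closure.
by apply; split => //; exact: closed_half_plane_closure.
Qed.

(** Composed with the retraction, the extension to the closure becomes a bounded
    continuous function on the whole plane. *)
Lemma retract_extension (g h : R * R -> R) : uniform_extension U g h ->
  [bounded g x | x in U] ->
  [/\ forall x, U x -> (h \o r) x = g x,
      forall e : R, 0 < e -> exists2 d : R, 0 < d &
        forall x y, U x -> U y -> ball x d y -> `|g x - g y| < e,
      continuous (h \o r) &
      exists C : R, forall x, `|(h \o r) x| <= C].
Proof.
move=> ext bnd; have uh := uniform_extensionP ext; have [_ hg] := ext.
have E x : U x -> (h \o r) x = g x.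
  by move=> Ux; rewrite /= (hp_rK H) ?hg//; exact: hp_sub H _ Ux.
split => //.
- move=> e /uh[d d0 hd]; exists d => // x y Ux Uy xy.
  by rewrite -!hg//; apply: hd => //; exact: hp_sub H _ _.
- move=> x; apply/cvgrPdist_lt => e /uh[d d0 hd].
  have : \forall y \near x, ball (r x) d (r y).
    by apply: (hp_rc H); exact: nbhsx_ballx.
  by apply: filterS => y xy; apply: hd => //; exact: hp_r H _.
- have [M [_ hM]] := bnd.
  have [d d0 hd] := uh 1 ltr01.
  exists (M + 1 + 1) => x.
  have Kx := hp_r H x.
  have d20 : 0 < d / 2 by rewrite divr_gt0.
  have Uz := hp_in H Kx d20.
  have Kz := hp_sub H Uz.
  have dd : d / 2 < d by rewrite ltr_pdivrMr// ltr_pMr// ltr1n.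
  have h1 := hd _ _ Kx Kz (ball_shift _ d20 dd).
  have h2 : `|h (r x + d / 2 *: s)| <= M + 1.
    by rewrite hg//; apply: hM => //; rewrite ltrDl.
  have -> : (h \o r) x = (h (r x) - h (r x + d / 2 *: s)) + h (r x + d / 2 *: s).
    by rewrite subrK.
  apply: (le_trans (ler_normD _ _)); rewrite addrC; apply: lerD => //.
  exact: ltW.
Qed.

Definition taylor_remainder (f k1 k2 k11 k12 k22 : R * R -> R) x y : R :=
  f y - f x - (k1 x * (y.1 - x.1) + k2 x * (y.2 - x.2) +
    2^-1 * (k11 x * (y.1 - x.1) ^+ 2 + k22 x * (y.2 - x.2) ^+ 2) +
    k12 x * ((y.1 - x.1) * (y.2 - x.2))).

Variable f : R * R -> R.
Local Notation T := (taylor_remainder f).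
Hypothesis cf : continuous f.
Hypothesis tcd : twice_continuously_differentiable_on U f.

Let d1 u x : axis u -> U x -> derivable f x u.
Proof. by move=> Au Ux; case: (tcd Ux Au). Qed.

Let d2 u v x : axis u -> axis v -> U x -> derivable ('D_u f) x v.
Proof. by move=> Au Av Ux; case: (tcd Ux Au) => _ _ /(_ v Av) []. Qed.

Let c2 u v x : axis u -> axis v -> U x -> {for x, continuous ('D_v ('D_u f))}.
Proof. by move=> Au Av Ux; case: (tcd Ux Au) => _ _ /(_ v Av) []. Qed.

(** Schwarz: both mixed derivatives are limits of the same second difference. *)
Lemma mixed_derivatives_eq x : U x -> 'D_e2 ('D_e1 f) x = 'D_e1 ('D_e2 f) x.
Proof.
move=> Ux; apply/eqP; rewrite -subr_eq0 -normr_le0; apply/ler_addgt0Pl => e e0.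
rewrite addr0.
have e20 : 0 < e / 2 by rewrite divr_gt0.
have [d d0 xd] : exists2 d : R, 0 < d & forall z, ball x d z -> [/\ U z,
    `|'D_e2 ('D_e1 f) x - 'D_e2 ('D_e1 f) z| < e / 2 &
    `|'D_e1 ('D_e2 f) x - 'D_e1 ('D_e2 f) z| < e / 2].
  have /nbhs_ballP[r1 /= p1 b1] : nbhs x U.
    by apply: open_nbhs_nbhs; split => //; exact: hp_open H.
  have /cvgrPdist_lt/(_ _ e20)/nbhs_ballP[r2 /= p2 b2] := c2 axis1 axis2 Ux.
  have /cvgrPdist_lt/(_ _ e20)/nbhs_ballP[r3 /= p3 b3] := c2 axis2 axis1 Ux.
  exists (Num.min r1 (Num.min r2 r3)); first by rewrite !lt_min p1 p2.
  move=> z xz; split.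
  - by apply: b1; apply: le_ball xz; rewrite ge_min lexx.
  - by apply: b2; apply: le_ball xz; rewrite !ge_min lexx orbT.
  - by apply: b3; apply: le_ball xz; rewrite !ge_min lexx !orbT.
pose k := d / 2.
have k0 : 0 < k by rewrite divr_gt0.
have kd : k < d by rewrite ltr_pdivrMr// ltr_pMr// ltr1n.
case: x Ux xd => x1 x2 Ux xd.
have bx a b : between x1 (x1 + k) a -> between x2 (x2 + k) b -> ball (x1, x2) d (a, b).
  move=> /between_norm + /between_norm.
  rewrite !(addrC _ k) !addrK (gtr0_norm k0) => ha hb.
  by split; rewrite /ball/= distrC; [exact: le_lt_trans ha kd|exact: le_lt_trans hb kd].
have bU a b : between x1 (x1 + k) a -> between x2 (x2 + k) b -> U (a, b).
  by move=> ha hb; case: (xd _ (bx a b ha hb)).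
have k0' : k != 0 by rewrite gt_eqF.
have [|a [b [a' [b' [ha hb ha' hb' S]]]]] := @second_difference R
    (fun a b => f (a, b)) (fun a b => 'D_e1 f (a, b)) (fun a b => 'D_e2 f (a, b))
    (fun a b => 'D_e2 ('D_e1 f) (a, b)) (fun a b => 'D_e1 ('D_e2 f) (a, b)) x1 x2 k k0'.
  move=> a b ha hb; have Uab := bU _ _ ha hb; split.
  - exact/is_derive_axis1/d1.
  - exact/is_derive_axis2/d1.
  - exact/is_derive_axis2/d2.
  - exact/is_derive_axis1/d2.
have [_ h1 _] := xd _ (bx a b ha hb); have [_ _ h2] := xd _ (bx a' b' ha' hb').
clear - S h1 h2.
have near_trans (p' p q' q : R) : p = q -> `|p' - p| < e / 2 -> `|q' - q| < e / 2 ->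
    `|p' - q'| <= e.
  move=> -> {}h1 {}h2; have -> : p' - q' = (p' - q) - (q' - q) by ring.
  apply: (le_trans (ler_normB _ _)); rewrite [e]splitr.
  by apply: lerD; exact: ltW.
exact: near_trans S h1 h2.
Qed.

Let taylor_open x y (w : R) : U x -> U y ->
  (forall u v z, axis u -> axis v -> U z -> `|z.1 - x.1| <= `|y.1 - x.1| ->
     `|z.2 - x.2| <= `|y.2 - x.2| ->
     `|'D_v ('D_u f) z - 'D_v ('D_u f) x| <= w) ->
  `|T ('D_e1 f) ('D_e2 f) ('D_e1 ('D_e1 f)) ('D_e2 ('D_e1 f)) ('D_e2 ('D_e2 f)) x y| <=
  4 * w * ((y.1 - x.1) ^+ 2 + (y.2 - x.2) ^+ 2).
Proof.
case: x y => x1 x2 [y1 y2] Ux Uy W.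
have Z (a b : R) : `|a - a| <= `|b| by rewrite subrr normr0 normr_ge0.
case: (hp_corner H Ux Uy) => /= Uc.
- rewrite /taylor_remainder (mixed_derivatives_eq Ux).
  apply: (@taylor_corner R (fun a b => f (a, b)) (fun a b => 'D_e1 f (a, b))
    (fun a b => 'D_e2 f (a, b)) (fun a b => 'D_e1 ('D_e1 f) (a, b))
    (fun a b => 'D_e1 ('D_e2 f) (a, b)) (fun a b => 'D_e2 ('D_e2 f) (a, b))) => t ht.
  + have Ut := hp_seg1 H Ux Uc ht.
    by split; apply: is_derive_axis1; [exact: d1|exact: d2|exact: d2].
  + have Ut := hp_seg2 H Uc Uy ht.
    by split; apply: is_derive_axis2; [exact: d1|exact: d2].
  + have Ut := hp_seg1 H Ux Uc ht.
    by split; apply: W => //=; first [exact: Z|exact: between_norm].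
  + have Ut := hp_seg2 H Uc Uy ht.
    by apply: W => //=; first [exact: Z|exact: between_norm].
- have SW (F G A B P Q C D1 D2 : R) :
      F - G - (A * D1 + B * D2 + 2^-1 * (P * D1 ^+ 2 + Q * D2 ^+ 2) + C * (D1 * D2)) =
      F - G - (B * D2 + A * D1 + 2^-1 * (Q * D2 ^+ 2 + P * D1 ^+ 2) + C * (D2 * D1)).
    by ring.
  rewrite /taylor_remainder/= SW.
  rewrite [(y1 - x1) ^+ 2 + _]addrC.
  apply: (@taylor_corner R (fun b a => f (a, b)) (fun b a => 'D_e2 f (a, b))
    (fun b a => 'D_e1 f (a, b)) (fun b a => 'D_e2 ('D_e2 f) (a, b))
    (fun b a => 'D_e2 ('D_e1 f) (a, b)) (fun b a => 'D_e1 ('D_e1 f) (a, b))) => t ht.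
  + have Ut := hp_seg2 H Ux Uc ht.
    by split; apply: is_derive_axis2; [exact: d1|exact: d2|exact: d2].
  + have Ut := hp_seg1 H Uc Uy ht.
    by split; apply: is_derive_axis1; [exact: d1|exact: d2].
  + have Ut := hp_seg2 H Ux Uc ht.
    by split; apply: W => //=; first [exact: Z|exact: between_norm].
  + have Ut := hp_seg1 H Uc Uy ht.
    by apply: W => //=; first [exact: Z|exact: between_norm].
Qed.

Definition bounded_continuous (k : R * R -> R) :=
  continuous k /\ exists C : R, forall x, `|k x| <= C.

Hypothesis ext1 : forall u, axis u -> [bounded 'D_u f x | x in U] /\
  exists h, uniform_extension U ('D_u f) h.
Hypothesis ext2 : forall u v, axis u -> axis v ->
  [bounded 'D_v ('D_u f) x | x in U] /\
  exists2 h, uniform_extension U ('D_v ('D_u f)) h &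
    u <> v -> forall a, h (a, a) = 0.

Let extend1 u : axis u -> exists k, bounded_continuous k /\ forall x, U x -> k x = 'D_u f x.
Proof.
move=> Au; have [b [h eh]] := ext1 Au; have [E _ ch Ch] := retract_extension eh b.
by exists (h \o r).
Qed.

Let extend2 u v : axis u -> axis v -> exists k, [/\ bounded_continuous k,
  forall x, U x -> k x = 'D_v ('D_u f) x,
  forall e : R, 0 < e -> exists2 d : R, 0 < d & forall x y, U x -> U y ->
    ball x d y -> `|'D_v ('D_u f) x - 'D_v ('D_u f) y| < e &
  u <> v -> forall a, k (a, a) = 0].
Proof.
move=> Au Av; have [b [h eh h0]] := ext2 Au Av.
have [E uc ch Ch] := retract_extension eh b.
exists (h \o r); split => // uv a /=.
by rewrite (hp_rK H) ?h0//; exact: hp_diag H a.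
Qed.

Let e12 : e1 <> e2. Proof. by case=> /eqP; rewrite oner_eq0. Qed.

(** In the open half-plane, the second derivatives oscillate little between
    close points, and between distant points their bounds are absorbed by the
    fourth power of the distance. The expansion passes to the closure by
    shifting both points inwards by the same small vector. *)
Lemma closed_half_plane_taylor : exists k1 k2 k11 k12 k22,
  [/\ [/\ bounded_continuous k1, bounded_continuous k2, bounded_continuous k11,
       bounded_continuous k12 & bounded_continuous k22],
      forall a, k12 (a, a) = 0,
      forall x, U x -> laplacian f x = k11 x + k22 x &
      forall e : R, 0 < e -> exists2 C : R, 0 <= C & forall x y, K x -> K y ->
        `|T k1 k2 k11 k12 k22 x y| <=
        e * ((y.1 - x.1) ^+ 2 + (y.2 - x.2) ^+ 2) +
        C * ((y.1 - x.1) ^+ 2 + (y.2 - x.2) ^+ 2) ^+ 2].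
Proof.
have [k1 [r1 E1]] := extend1 axis1; have [k2 [r2 E2]] := extend1 axis2.
have [k11 [r11 E11 u11 _]] := extend2 axis1 axis1.
have [k12 [r12 E12 u12 z12]] := extend2 axis1 axis2.
have [k21 [r21 E21 u21 _]] := extend2 axis2 axis1.
have [k22 [r22 E22 u22 _]] := extend2 axis2 axis2.
exists k1, k2, k11, k12, k22; split => //; first exact: z12.
  by move=> x Ux; rewrite /laplacian E11// E22.
move=> e e0; have e80 : 0 < e / 8 by rewrite divr_gt0.
have [d [d0 hd]] : exists d : R, 0 < d /\ forall u v x y, axis u -> axis v ->
    U x -> U y -> ball x d y -> `|'D_v ('D_u f) x - 'D_v ('D_u f) y| < e / 8.
  have [a a0 ha] := u11 _ e80; have [b b0 hb] := u12 _ e80.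
  have [c c0 hc] := u21 _ e80; have [g g0 hg] := u22 _ e80.
  exists (Num.min (Num.min a b) (Num.min c g)); rewrite !lt_min a0 b0 c0 g0; split => //.
  move=> u v x y Au Av Ux Uy xy.
  have xa : ball x a y by apply: le_ball xy; rewrite !ge_min lexx.
  have xb : ball x b y by apply: le_ball xy; rewrite !ge_min lexx orbT.
  have xc : ball x c y by apply: le_ball xy; rewrite !ge_min lexx !orbT.
  have xg : ball x g y by apply: le_ball xy; rewrite !ge_min lexx !orbT.
  by case: (axisP Au) => ->; case: (axisP Av) => ->; [exact: ha|exact: hb|exact: hc|exact: hg].
have [M [M0 hM]] : exists M : R, 0 <= M /\ forall u v x y, axis u -> axis v ->
    U x -> U y -> `|'D_v ('D_u f) x - 'D_v ('D_u f) y| <= M.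
  have [_ [a ha]] := r11; have [_ [b hb]] := r12.
  have [_ [c hc]] := r21; have [_ [g hg]] := r22.
  have a0 : 0 <= a by apply: le_trans (ha e1).
  have b0 : 0 <= b by apply: le_trans (hb e1).
  have c0 : 0 <= c by apply: le_trans (hc e1).
  have g0 : 0 <= g by apply: le_trans (hg e1).
  exists ((a + b + c + g) + (a + b + c + g)); split; first by rewrite !addr_ge0.
  move=> u v x y Au Av Ux Uy; apply: (le_trans (ler_normB _ _)).
  have B z : U z -> `|'D_v ('D_u f) z| <= a + b + c + g.
    move=> Uz; case: (axisP Au) => ->; case: (axisP Av) => ->.
    - by rewrite -E11//; apply: (le_trans (ha _)); rewrite -!addrA lerDl !addr_ge0.
    - rewrite -E12//; apply: (le_trans (hb _)).
      by rewrite -!addrA addrCA lerDl !addr_ge0.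
    - rewrite -E21//; apply: (le_trans (hc _)).
      by rewrite -!addrA addrA addrCA lerDl !addr_ge0.
    - by rewrite -E22//; apply: (le_trans (hg _)); rewrite lerDr !addr_ge0.
  by apply: lerD; exact: B.
have dd0 : 0 < d ^+ 2 by rewrite exprn_gt0.
pose C := 4 * M / d ^+ 2.
have C0 : 0 <= C by rewrite !mulr_ge0// invr_ge0 ltW.
pose N x y : R := (y.1 - x.1) ^+ 2 + (y.2 - x.2) ^+ 2.
have N0 x y : 0 <= N x y by rewrite addr_ge0// sqr_ge0.
have open_bound x y : U x -> U y ->
    `|T k1 k2 k11 k12 k22 x y| <= e * N x y + C * N x y ^+ 2.
  move=> Ux Uy.
  have -> : T k1 k2 k11 k12 k22 x y =
      T ('D_e1 f) ('D_e2 f) ('D_e1 ('D_e1 f)) ('D_e2 ('D_e1 f)) ('D_e2 ('D_e2 f)) x y.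
    by rewrite /taylor_remainder E1// E2// E11// E12// E22.
  have NN0 : 0 <= C * N x y ^+ 2 by rewrite mulr_ge0// sqr_ge0.
  have [close|far] := boolP ((`|y.1 - x.1| < d) && (`|y.2 - x.2| < d)).
    have /andP[y1 y2] := close.
    apply: (@le_trans _ _ (4 * (e / 8) * N x y)).
      apply: taylor_open => // u v z Au Av Uz z1 z2.
      rewrite distrC; apply/ltW/hd => //.
      by split; rewrite /ball/= distrC; [exact: le_lt_trans z1 y1|exact: le_lt_trans z2 y2].
    apply: (@le_trans _ _ (e * N x y)); last by rewrite lerDl.
    by rewrite ler_wpM2r//; lra.
  apply: (@le_trans _ _ (4 * M * N x y)).
    by apply: taylor_open => // u v z Au Av Uz _ _; exact: hM.
  apply: (@le_trans _ _ (C * N x y ^+ 2)); last by rewrite lerDr mulr_ge0// ltW.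
  have dN : d ^+ 2 <= N x y.
    move: far; rewrite negb_and -!leNgt /N -(real_normK (num_real (y.1 - x.1)))
      -(real_normK (num_real (y.2 - x.2))) => /orP[h|h].
      apply: (@le_trans _ _ (`|y.1 - x.1| ^+ 2)); last by rewrite lerDl sqr_ge0.
      by rewrite ler_sqr ?nnegrE// ltW.
    apply: (@le_trans _ _ (`|y.2 - x.2| ^+ 2)); last by rewrite lerDr sqr_ge0.
    by rewrite ler_sqr ?nnegrE// ltW.
  rewrite /C expr2 [leRHS]mulrA ler_wpM2r// -mulrA ler_peMr ?mulr_ge0//.
  by rewrite mulrC ler_pdivlMr// mul1r.
exists C => // x y Kx Ky; rewrite -/(N x y).
pose sh n : R * R := (n.+1%:R^-1 : R) *: s.
have sh0 : sh n @[n --> \oo] --> (0 : R * R).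
  rewrite -[X in _ --> X](scale0r s); apply: cvgZr_tmp.
  exact: cvg_harmonic.
have shx z : (fun n => z + sh n) @ \oo --> z.
  by rewrite -[X in _ --> X]addr0; apply: cvgD => //; exact: cvg_cst.
have NS n : N (x + sh n) (y + sh n) = N x y.
  by rewrite /N /=; congr (_ ^+ 2 + _ ^+ 2); ring.
have cvT : T k1 k2 k11 k12 k22 (x + sh n) (y + sh n) @[n --> \oo] -->
    T k1 k2 k11 k12 k22 x y.
  have E : (fun n => T k1 k2 k11 k12 k22 (x + sh n) (y + sh n)) =
      (fun n => f (y + sh n) - f (x + sh n) - (k1 (x + sh n) * (y.1 - x.1) +
        k2 (x + sh n) * (y.2 - x.2) +
        2^-1 * (k11 (x + sh n) * (y.1 - x.1) ^+ 2 + k22 (x + sh n) * (y.2 - x.2) ^+ 2) +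
        k12 (x + sh n) * ((y.1 - x.1) * (y.2 - x.2)))).
    apply/funext => n; rewrite /taylor_remainder.
    have -> : (y + sh n).1 - (x + sh n).1 = y.1 - x.1 by rewrite /=; ring.
    by have -> : (y + sh n).2 - (x + sh n).2 = y.2 - x.2 by rewrite /=; ring.
  have c k z : continuous k -> k (z + sh n) @[n --> \oo] --> k z.
    by move=> ck; exact: (cvg_comp _ _ (shx z) (ck z)).
  have [c1 _] := r1; have [c2' _] := r2; have [c11 _] := r11.
  have [c12 _] := r12; have [c22 _] := r22.
  rewrite E; apply: cvgB; first by apply: cvgB; exact: c.
  apply: cvgD; last by apply: cvgMl; exact: c.
  apply: cvgD; first by apply: cvgD; apply: cvgMl; exact: c.
  by apply: cvgM; [exact: cvg_cst|apply: cvgD; apply: cvgMl; exact: c].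
apply: (cvgr_to_le (cvg_norm cvT)); apply: nearW => n.
by rewrite -(NS n); apply: open_bound; apply: (hp_in H) => //; rewrite invr_gt0.
Qed.

End closed_half_plane.

Section below_above.
Variable R : realType.
Implicit Types x : R * R.

Lemma below_data : half_plane_data (@below R) [set x | x.1 <= x.2] (-1, 1)
  (fun x => (Num.min x.1 x.2, Num.max x.1 x.2)).
Proof.
split.
- exact: open_below.
- by move=> x /ltW.
- by move=> x e; rewrite /below/= /GRing.scale/= => h e0; lra.
- by rewrite /= normrN normr1.
- move=> [x1 x2] [y1 y2]; rewrite /below/= => h1 h2.
  have [h|h] := ltP y1 x2; [by left|right].
  by apply: lt_trans h2; apply: lt_le_trans h.
- move=> a b c t; rewrite /below/between/= => ac bc /andP[_ h].
  by apply: le_lt_trans h _; rewrite gt_max ac.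
- move=> a b c t; rewrite /below/between/= => ac bc /andP[h _].
  by apply: lt_le_trans h; rewrite lt_min ac.
- by move=> x /=; rewrite ge_min le_max lexx.
- by move=> [x1 x2] /= h; rewrite min_l// max_r.
- exact: continuous_pair (@continuous_min_coord R) (@continuous_max_coord R).
- by move=> a /=.
Qed.

Lemma above_data : half_plane_data (@above R) [set x | x.2 <= x.1] (1, -1)
  (fun x => (Num.max x.1 x.2, Num.min x.1 x.2)).
Proof.
split.
- exact: open_above.
- by move=> x /ltW.
- by move=> x e; rewrite /above/= /GRing.scale/= => h e0; lra.
- by rewrite /= normrN normr1.
- move=> [x1 x2] [y1 y2]; rewrite /above/= => h1 h2.
  have [h|h] := ltP x2 y1; [by left|right].
  by apply: lt_trans h1; apply: lt_le_trans h.
- move=> a b c t; rewrite /above/between/= => ac bc /andP[h _].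
  by apply: lt_le_trans h; rewrite lt_min ac.
- move=> a b c t; rewrite /above/between/= => ac bc /andP[_ h].
  by apply: le_lt_trans h _; rewrite gt_max ac.
- by move=> x /=; rewrite ge_min le_max lexx.
- by move=> [x1 x2] /= h; rewrite min_r// max_l.
- exact: continuous_pair (@continuous_max_coord R) (@continuous_min_coord R).
- by move=> a /=.
Qed.

(** The coalescing process moves within one closed half-plane: two of its
    positions in chronological order satisfy this relation. *)
Definition same_side (x y : R * R) :=
  (x.1 <= x.2 -> y.1 <= y.2) /\ (x.2 < x.1 -> y.2 <= y.1).

Definition bounded_measurable (k : R * R -> R) :=
  measurable_fun setT k /\ exists C : R, forall x, `|k x| <= C.

Let glue (b a : R * R -> R) x := if x.1 <= x.2 then b x else a x.

Let glue_bounded_measurable b a : bounded_continuous b -> bounded_continuous a ->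
  bounded_measurable (glue b a).
Proof.
move=> [cb [B hB]] [ca [A hA]]; split.
  apply: measurable_fun_ifT.
  - by apply: measurable_fun_ler.
  - exact: continuous_measurable_fun2.
  - exact: continuous_measurable_fun2.
exists (Num.max B A) => x; rewrite /glue; case: ifP => _.
  by rewrite le_max hB.
by rewrite le_max hA orbT.
Qed.

(** The expansion on the two closed half-planes, glued along the diagonal. Both
    sides expand the same second difference of the restriction to the diagonal,
    where the mixed derivatives are zero; so the two limits of the Laplacian
    agree there, and the generator is continuous. *)
Lemma calD_taylor rho (f : R * R -> R) : calD f ->
  continuous (G0 rho f) /\
  exists d1 d2 d11 d12 d22 : R * R -> R,
  [/\ [/\ bounded_measurable d1, bounded_measurable d2, bounded_measurable d11,
       bounded_measurable d12 & bounded_measurable d22],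
      forall a, d12 (a, a) = 0,
      forall x, G0 rho f x = 2^-1 * rho * (d11 x + d22 x) &
      forall e : R, 0 < e -> exists2 C : R, 0 <= C & forall x y, same_side x y ->
        `|taylor_remainder f d1 d2 d11 d12 d22 x y| <=
        e * ((y.1 - x.1) ^+ 2 + (y.2 - x.2) ^+ 2) +
        C * ((y.1 - x.1) ^+ 2 + (y.2 - x.2) ^+ 2) ^+ 2].
Proof.
move=> [[cf _ Df] _].
have [tb e1b e2b] := Df _ (or_introl erefl).
have [ta e1a e2a] := Df _ (or_intror erefl).
have [b1 [b2 [b11 [b12 [b22 [rb zb lb Tb]]]]]] :=
  closed_half_plane_taylor below_data cf tb e1b e2b.
have [a1 [a2 [a11 [a12 [a22 [ra za la Ta]]]]]] :=
  closed_half_plane_taylor above_data cf ta e1a e2a.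
have diag (a : R) : b11 (a, a) + b22 (a, a) = a11 (a, a) + a22 (a, a).
  apply/eqP; rewrite -subr_eq0 -normr_le0; apply/ler_addgt0Pl => e e0; rewrite addr0.
  have e0' : 0 < e / 16 by rewrite divr_gt0.
  have [Cb Cb0 hb] := Tb _ e0'; have [Ca Ca0 ha] := Ta _ e0'.
  pose h : R := Num.sqrt (e / (16 * (Ca + Cb + 1))).
  have Cp : 0 < Ca + Cb + 1 by rewrite ltr_wpDl ?addr_ge0.
  have h2 : h ^+ 2 = e / (16 * (Ca + Cb + 1)).
    by rewrite sqr_sqrtr// divr_ge0 ?ltW// mulr_gt0.
  have h20 : 0 < h ^+ 2 by rewrite h2 divr_gt0// mulr_gt0.
  have := hb (a, a) (a + h, a + h) (lexx _) (lexx _).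
  have := hb (a, a) (a - h, a - h) (lexx _) (lexx _).
  have := ha (a, a) (a + h, a + h) (lexx _) (lexx _).
  have := ha (a, a) (a - h, a - h) (lexx _) (lexx _).
  rewrite /taylor_remainder /= za zb.
  have -> : a + h - a = h by ring.
  have -> : a - h - a = - h by ring.
  rewrite sqrrN; move: h2 h20; set q := h ^+ 2 => h2 h20.
  have Cq : (Ca + Cb) * q * q <= e / 16 * q.
    rewrite ler_wpM2r// ?ltW//.
    have : (Ca + Cb + 1) * q = e / 16 by rewrite h2; field; rewrite gt_eqF.
    by move: h20; lra.
  rewrite !ler_norml => /andP[u1 v1] /andP[u2 v2] /andP[u3 v3] /andP[u4 v4].
  have qe : - (q * e) <= q * (b11 (a, a) + b22 (a, a) - (a11 (a, a) + a22 (a, a))) <= q * e.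
    by apply/andP; split; nra.
  by move: qe; rewrite -mulrN !ler_pM2l.
pose g (x : R * R) : R := b11 x + b22 x.
pose k (x : R * R) : R := a11 x + a22 x.
have bc_add (p q : R * R -> R) : bounded_continuous p -> bounded_continuous q ->
    continuous (fun x => p x + q x).
  by move=> [cp _] [cq _] x; apply: cvgD; [exact: cp|exact: cq].
have [rb1 rb2 rb11 rb12 rb22] := rb; have [ra1 ra2 ra11 ra12 ra22] := ra.
have cg : continuous g by exact: bc_add.
have ck : continuous k by exact: bc_add.
have G0b x : x.1 <= x.2 -> G0 rho f x = 2^-1 * rho * g x.
  rewrite /G0 => x12; congr (_ * _); case: eqVneq => [e|ne]; last first.
    by rewrite lb// /below/= lt_neqAle ne.
  have pf := diag_below_proper e.
  apply: cvg_lim => //.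
  have h : g y @[y --> within (@below R) (nbhs x)] --> g x.
    exact: cvg_within_filter (cg x).
  apply: cvg_trans h; apply: near_eq_cvg.
  by rewrite /prop_near1 /within/=; apply: nearW => y /lb ->.
have G0a x : x.2 <= x.1 -> G0 rho f x = 2^-1 * rho * k x.
  move=> x21; have [e|ne] := eqVneq x.1 x.2.
    rewrite G0b ?e//; congr (_ * _); rewrite /g /k.
    by rewrite (surjective_pairing x) e diag.
  rewrite /G0 (negPf ne); congr (_ * _).
  by rewrite la// /above/= lt_neqAle eq_sym ne.
split.
  pose lo (x : R * R) : R * R := (Num.min x.1 x.2, x.2).
  pose hi (x : R * R) : R * R := (Num.max x.1 x.2, x.2).
  pose dg (x : R * R) : R * R := (x.2, x.2).
  have clo : continuous lo by exact: continuous_pair (@continuous_min_coord R) (@continuous_snd2 R).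
  have chi : continuous hi by exact: continuous_pair (@continuous_max_coord R) (@continuous_snd2 R).
  have cdg : continuous dg by exact: continuous_pair (@continuous_snd2 R) (@continuous_snd2 R).
  have -> : G0 rho f = (fun x => 2^-1 * rho * (g (lo x) + k (hi x) - g (dg x))).
    apply/funext => x; rewrite /lo /hi /dg.
    have gk (t : R) : g (t, t) = k (t, t) by exact: diag.
    have [x12|x21] := leP x.1 x.2.
      by rewrite G0b// gk addrK -surjective_pairing.
    by rewrite (G0a _ (ltW x21)) -surjective_pairing; congr (_ * _); ring.
  have cc (p : R * R -> R) (r : R * R -> R * R) x : continuous p -> continuous r ->
      p (r y) @[y --> x] --> p (r x).
    by move=> cp cr; exact: (cvg_comp _ _ (cr x) (cp _)).
  move=> x; apply: cvgM; first exact: cvg_cst.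
  apply: cvgB; last exact: cc.
  by apply: cvgD; exact: cc.
exists (glue b1 a1), (glue b2 a2), (glue b11 a11), (glue b12 a12), (glue b22 a22); split.
- by split; exact: glue_bounded_measurable.
- by move=> a; rewrite /glue /= lexx zb.
- move=> x; rewrite /glue; case: leP => x12; first exact: G0b.
  by apply: G0a; exact: ltW.
- move=> e e0; have [Cb Cb0 hb] := Tb _ e0; have [Ca Ca0 ha] := Ta _ e0.
  exists (Cb + Ca); first exact: addr_ge0.
  move=> x y [xyb xya]; rewrite /taylor_remainder /glue /=.
  have N0 : 0 <= ((y.1 - x.1) ^+ 2 + (y.2 - x.2) ^+ 2) ^+ 2 by exact: sqr_ge0.
  have [x12|x12] := leP x.1 x.2.
    have := hb x y x12 (xyb x12); rewrite /taylor_remainder => /le_trans; apply.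
    by rewrite lerD2l ler_wpM2r// lerDl.
  have := ha x y (ltW x12) (xya x12); rewrite /taylor_remainder => /le_trans; apply.
  by rewrite lerD2l ler_wpM2r// lerDr.
Qed.

End below_above.

(** * Moments of the normal distribution *)

Section gaussian_moments.
Variable R : realType.
Local Notation mu := (@lebesgue_measure R).

Lemma ge0_integral_normal_prob (s : R) (f : R -> R) :
  measurable_fun setT f -> (forall x, 0 <= f x) ->
  (\int[normal_prob 0 s]_x (f x)%:E = \int[mu]_x (f x * normal_pdf 0 s x)%:E)%E.
Proof.
move=> mf f0.
have dom := normal_prob_dominates 0 s.
have mp : measurable_fun setT (normal_pdf 0 s) by exact: measurable_normal_pdf.
rewrite -(Radon_Nikodym_SigmaFinite.change_of_variables dom)//; last exact/measurable_EFinP.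
have rnE : ae_eq mu setT (Radon_Nikodym_SigmaFinite.f (normal_prob 0 s) mu)
    (EFin \o normal_pdf 0 s).
  apply: integral_ae_eq => //.
  - exact: Radon_Nikodym_SigmaFinite.f_integrable.
  - exact/measurable_EFinP.
  - by move=> E _ mE; rewrite -Radon_Nikodym_SigmaFinite.f_integral.
apply: ae_eq_integral => //.
- apply: emeasurable_funM; first exact/measurable_EFinP.
  exact: (measurable_int _ (Radon_Nikodym_SigmaFinite.f_integrable dom)).
- exact/measurable_EFinP/measurable_funM.
- have := @ae_eqe_mul2l _ _ _ mu _ _ _ (EFin \o f) rnE.
  by under [X in ae_eq _ _ _ X -> _]eq_fun do rewrite -EFinM.
Qed.

(** The fundamental theorem on [- n, n], and dominated convergence. *)
Lemma integral_derivative_line (F f : R -> R) :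
  (forall x, is_derive x (1 : R) F (f x)) -> continuous f ->
  mu.-integrable setT (EFin \o f) ->
  F n%:R @[n --> \oo] --> (0 : R) -> F (- n%:R) @[n --> \oo] --> (0 : R) ->
  \int[mu]_x f x = 0.
Proof.
move=> dF cf fi F1 F2.
pose I (n : nat) : set R := `[- n%:R, n%:R]%classic.
have mI n : measurable (I n) by exact: measurable_itv.
have cF : continuous F.
  by move=> x; apply: differentiable_continuous; apply/derivable1_diffP; case: (dF x).
have e n : (0 < n)%N -> \int[mu]_x (f \_ (I n)) x = F n%:R - F (- n%:R).
  move=> n0; rewrite -Rintegral_mkcond /Rintegral.
  have nn : - n%:R < n%:R :> R by move: n0; rewrite -(ltr0n R); lra.
  rewrite (@continuous_FTC2 R f F _ _ nn)//.
  - exact: continuous_subspaceT.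
  - split => [x _||].
    + by case: (dF x).
    + by apply: cvg_at_right_filter; exact: cF.
    + by apply: cvg_at_left_filter; exact: cF.
  - by move=> x _; rewrite derive1E; case: (dF x).
have c1 : \int[mu]_x (f \_ (I n)) x @[n --> \oo] --> \int[mu]_x f x.
  have fin_f := integrable_fin_num measurableT fi.
  rewrite /Rintegral; apply: fine_cvg; rewrite fineK//.
  apply: (@dominated_cvg _ _ _ mu setT measurableT (fun n => EFin \o (f \_ (I n)))
    (EFin \o f) (fun x => `|(EFin \o f) x|%E)) => //.
  - move=> n; apply/measurable_EFinP; have mf : measurable_fun setT f by exact: continuous_measurable_fun.
    have mfI := measurable_funS measurableT (@subsetT _ (I n)) mf.
    exact: (measurable_restrictT f (mI n)).1 mfI.
  - move=> x _; apply: cvg_near_cst; exists (Num.trunc `|x|).+1 => // n /= xn.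
    rewrite patchE ifT// inE; change (x \in `[- n%:R, n%:R]); rewrite in_itv -ler_norml.
    by apply/ltW; apply: lt_le_trans (truncnS_gt _) _; rewrite ler_nat.
  - exact: integrable_abse.
  - move=> n x _ /=; rewrite lee_fin patchE; case: ifP => // _.
    by rewrite normr0.
have c2 : \int[mu]_x (f \_ (I n)) x @[n --> \oo] --> (0 : R).
  have : F n%:R - F (- n%:R) @[n --> \oo] --> (0 - 0 : R) by exact: cvgB.
  rewrite subr0; apply: cvg_trans; apply: near_eq_cvg.
  by exists 1%N => // n /= n0; rewrite e.
exact: (cvg_unique _ c1 c2).
Qed.

Variable s : R.
Hypothesis s0 : 0 < s.

Let p : R -> R := normal_pdf 0 s.

Let pE x : p x = normal_peak s * expR (- x ^+ 2 / (s ^+ 2 *+ 2)).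
Proof. by rewrite /p normal_pdfE ?gt_eqF// /normal_fun subr0. Qed.

Let s2 : 0 < s ^+ 2. Proof. exact: exprn_gt0. Qed.

Let p_ge0 x : 0 <= p x. Proof. exact: normal_pdf_ge0. Qed.

Let cp : continuous p. Proof. by apply: continuous_normal_pdf; rewrite gt_eqF. Qed.

Let dp x : is_derive x (1 : R) p (- (x / s ^+ 2) * p x).
Proof.
have h : is_derive x (1 : R) (fun x : R => (- (s ^+ 2 *+ 2)^-1) * x ^+ 2) (- (x / s ^+ 2)).
  have e2 : is_derive x (1 : R) (fun x : R => x ^+ 2) (2 * x).
    have -> : (fun x : R => x ^+ 2) = id ^+ 2 by apply/funext => y; rewrite exprS expr1.
    by apply: is_derive_eq; rewrite /GRing.scale/= mulr1 expr1.
  have -> : - (x / s ^+ 2) = - (s ^+ 2 *+ 2)^-1 * (2 * x).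
    by rewrite -mulr_natr; field; rewrite gt_eqF.
  exact: is_deriveZ.
have h' := @is_derive1_comp R expR _ x _ _ (is_derive_expR _) h.
have h2 := @is_deriveZ _ _ _ _ (normal_peak s) _ _ _ h'.
have pE' : p = (fun y => normal_peak s *: (expR \o (fun x : R => (- (s ^+ 2 *+ 2)^-1) * x ^+ 2)) y).
  by apply/funext => y; rewrite pE /= /GRing.scale/=; congr (_ * expR _); rewrite mulrC mulNr mulrN.
have -> : - (x / s ^+ 2) * p x = normal_peak s *: (expR (- (s ^+ 2 *+ 2)^-1 * x ^+ 2) * - (x / s ^+ 2)).
  by rewrite pE' /GRing.scale/=; ring.
by rewrite pE'; exact: h2.
Qed.

(** The power is absorbed by passing from variance s^2 to variance 2 s^2, whose
    density decays more slowly. *)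
Let p4 x : x ^+ 4 * p x <= 128 * s ^+ 4 * normal_pdf 0 (Num.sqrt 2 * s) x.
Proof.
have s20 : 0 < Num.sqrt 2 * s :> R by rewrite mulr_gt0// sqrtr_gt0.
rewrite pE normal_pdfE ?gt_eqF// /normal_fun subr0.
have peakE : normal_peak s = Num.sqrt 2 * normal_peak (Num.sqrt 2 * s).
  rewrite /normal_peak exprMn sqr_sqrtr//.
  have -> : 2 * s ^+ 2 * pi *+ 2 = 2 * (s ^+ 2 * pi *+ 2) :> R by rewrite mulrnAr mulrA.
  by rewrite sqrtrM// invfM mulrA divff ?mul1r// gt_eqF// sqrtr_gt0.
rewrite peakE exprMn sqr_sqrtr//.
set q := normal_peak _; have q0 : 0 <= q by exact: normal_peak_ge0.
pose z := x ^+ 2 / (4 * s ^+ 2).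
have z0 : 0 <= z by rewrite divr_ge0 ?sqr_ge0// mulr_ge0// ltW.
have -> : - x ^+ 2 / (s ^+ 2 *+ 2) = - z + - z.
  by rewrite /z -mulr_natr; field; rewrite gt_eqF.
have -> : - x ^+ 2 / (2 * s ^+ 2 *+ 2) = - z.
  by rewrite /z -mulr_natr; field; rewrite gt_eqF.
have -> : x ^+ 4 = 16 * s ^+ 4 * z ^+ 2.
  by rewrite /z; field; rewrite gt_eqF.
rewrite expRD.
have ez : z ^+ 2 * expR (- z) <= 4.
  rewrite expRN ler_pdivrMr ?expR_gt0//.
  have h : 1 + z / 2 <= expR (z / 2) by exact: expR_ge1Dx.
  have -> : expR z = expR (z / 2) ^+ 2 by rewrite expr2 -expRD; congr expR; field.
  have : (1 + z / 2) ^+ 2 <= expR (z / 2) ^+ 2.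
    rewrite ler_sqr ?nnegrE ?expR_ge0//; lra.
  nra.
have sq2 : Num.sqrt 2 <= 2 :> R.
  rewrite -[leRHS](@ger0_norm _ 2)// -sqrtr_sqr ler_sqrt//; lra.
set E := expR (- z) in ez *; have E0 : 0 <= E by exact: expR_ge0.
have -> : 16 * s ^+ 4 * z ^+ 2 * (Num.sqrt 2 * q * (E * E)) =
  16 * s ^+ 4 * (q * E) * (Num.sqrt 2 * (z ^+ 2 * E)) by ring.
have -> : 128 * s ^+ 4 * (q * E) = 16 * s ^+ 4 * (q * E) * (2 * 4) by ring.
have s4 : 0 <= s ^+ 4 by rewrite exprn_ge0// ltW.
have qE : 0 <= q * E by exact: mulr_ge0.
apply: ler_wpM2l; first by apply: mulr_ge0 => //; apply: mulr_ge0.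
by apply: ler_pM => //; rewrite ?sqrtr_ge0// mulr_ge0// sqr_ge0.
Qed.


Let K := 128 * s ^+ 4 * normal_peak (Num.sqrt 2 * s).

Let sq20 : 0 < Num.sqrt 2 * s :> R. Proof. by rewrite mulr_gt0// sqrtr_gt0. Qed.

Let p4K x : x ^+ 4 * p x <= K.
Proof.
apply: le_trans (p4 x) _; apply: ler_wpM2l; last by apply: normal_pdf_ub; rewrite gt_eqF.
by rewrite mulr_ge0// exprn_ge0// ltW.
Qed.

Let mp : measurable_fun setT p. Proof. exact: measurable_normal_pdf. Qed.

Let mX n : measurable_fun setT (fun x : R => x ^+ n).
Proof. exact: measurable_funX. Qed.

Let int_p4 : mu.-integrable setT (EFin \o (fun x => x ^+ 4 * p x)).
Proof.
apply: (le_integrable measurableT _ _ (integrableZ_EFin (128 * s ^+ 4) measurableT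
  (integrable_normal_pdf 0 (Num.sqrt 2 * s)))).
  by apply/measurable_EFinP; exact: measurable_funM.
move=> x _ /=; rewrite lee_fin ger0_norm; last by rewrite mulr_ge0// exprn_even_ge0.
exact: le_trans (p4 x) (ler_norm _).
Qed.

Let int_p : mu.-integrable setT (EFin \o p). Proof. exact: integrable_normal_pdf. Qed.

Let pow_le (k : nat) (x : R) : (k <= 4)%N -> `|x ^+ k| <= 1 + x ^+ 4.
Proof.
move=> k4; rewrite normrX; have [x1|x1] := leP `|x| 1.
  have h : `|x| ^+ k <= 1 by rewrite exprn_ile1.
  by apply: le_trans h _; rewrite lerDl exprn_even_ge0.
have -> : x ^+ 4 = `|x| ^+ 4 by rewrite -normrX ger0_norm// exprn_even_ge0.
have h : `|x| ^+ k <= `|x| ^+ 4 by rewrite ler_weXn2l// ltW.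
by apply: le_trans h _; rewrite lerDr.
Qed.

Let int_pow (k : nat) : (k <= 4)%N -> mu.-integrable setT (EFin \o (fun x => x ^+ k * p x)).
Proof.
move=> k4; apply: (le_integrable measurableT _ _ (integrableD_EFin measurableT int_p int_p4)).
  by apply/measurable_EFinP; exact: measurable_funM.
move=> x _ /=; rewrite lee_fin normrM (ger0_norm (p_ge0 x)).
apply: le_trans _ (ler_norm _).
have -> : p x + x ^+ 4 * p x = (1 + x ^+ 4) * p x by ring.
by apply: ler_wpM2r => //; exact: pow_le.
Qed.

Let decay (k : nat) (x : R) : (k <= 3)%N -> 1 <= `|x| -> `|x ^+ k * p x| <= K / `|x|.
Proof.
move=> k3 x1; rewrite normrM (ger0_norm (p_ge0 x)) normrX.
have x0 : 0 < `|x| by exact: lt_le_trans x1.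
rewrite ler_pdivlMr//; apply: le_trans (p4K x).
have -> : x ^+ 4 = `|x| ^+ 4 by rewrite -normrX ger0_norm// exprn_even_ge0.
rewrite mulrAC -exprSr; apply: ler_wpM2r => //.
by rewrite ler_weXn2l.
Qed.

Let decay_cvg (k : nat) (e : nat -> R) : (k <= 3)%N -> (forall n, `|e n| = n%:R) ->
  e n ^+ k * p (e n) @[n --> \oo] --> (0 : R).
Proof.
move=> k3 ne; apply/norm_cvg0P.
have c : K * (n%:R)^-1 @[n --> \oo] --> (0 : R).
  rewrite -(mulr0 K); apply: cvgMr; rewrite -cvg_shiftS; exact: cvg_harmonic.
apply: squeeze_cvgr; [|exact: cvg_cst|exact: c].
exists 1%N => // n /= n1; rewrite normr_ge0/= -(ne n); apply: decay => //.
by rewrite ne ler1n.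
Qed.

Let Rint_p : \int[mu]_x p x = 1.
Proof. by rewrite /Rintegral integral_normal_pdf. Qed.

Let cX (k : nat) : continuous (fun x : R => x ^+ k * p x).
Proof. by move=> x; apply: cvgM; [exact: exprn_continuous|exact: cp]. Qed.

(** With p' = - x p / s^2, the function x p is the derivative of - s^2 p. *)
Let moment1 : \int[mu]_x (x * p x) = 0.
Proof.
have e (k : nat) (e : nat -> R) : (forall n, `|e n| = n%:R) ->
    - s ^+ 2 * p (e n) @[n --> \oo] --> (0 : R).
  move=> ne; rewrite -(mulr0 (- s ^+ 2)); apply: cvgMr.
  have := @decay_cvg 0 e isT ne.
  by under eq_fun do rewrite expr0 mul1r.
apply: (@integral_derivative_line (fun x => - s ^+ 2 * p x) (fun x => x * p x)).
- move=> x; have -> : x * p x = - s ^+ 2 * (- (x / s ^+ 2) * p x).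
    by field; rewrite gt_eqF.
  exact: is_deriveZ.
- by have := @cX 1.
- by have := @int_pow 1 isT.
- by apply: (e 0%N) => n; rewrite normr_nat.
- by apply: (e 0%N) => n; rewrite normrN normr_nat.
Qed.

(** The function x^2 p - s^2 p is the derivative of - s^2 x p. *)
Let moment2 : \int[mu]_x (x ^+ 2 * p x) = s ^+ 2.
Proof.
have int2 : mu.-integrable setT (EFin \o (fun x => s ^+ 2 * p x)).
  exact: integrableZ_EFin.
have : \int[mu]_x (x ^+ 2 * p x - s ^+ 2 * p x) = 0.
  have e (e : nat -> R) : (forall n, `|e n| = n%:R) ->
    - s ^+ 2 * (e n * p (e n)) @[n --> \oo] --> (0 : R).
    move=> ne; rewrite -(mulr0 (- s ^+ 2)); apply: cvgMr.
    exact: (@decay_cvg 1 e isT ne).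
  apply: (@integral_derivative_line (fun x => - s ^+ 2 * (x * p x))
    (fun x => x ^+ 2 * p x - s ^+ 2 * p x)).
  - move=> x; have -> : x ^+ 2 * p x - s ^+ 2 * p x =
        - s ^+ 2 * (x *: (- (x / s ^+ 2) * p x) + p x *: 1).
      by rewrite /GRing.scale/=; field; rewrite gt_eqF.
    exact: (is_deriveZ _ (is_deriveM (is_derive_id x (1 : R)) (dp x))).
  - move=> x; apply: cvgB; first exact: cX.
    by apply: cvgMr; exact: cp.
  - by apply: integrableB_EFin => //; exact: int_pow.
  - by apply: e => n; rewrite normr_nat.
  - by apply: e => n; rewrite normrN normr_nat.
rewrite RintegralB//; last exact: int_pow.
by rewrite RintegralZl// Rint_p mulr1 => /eqP; rewrite subr_eq0 => /eqP.
Qed.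

Local Notation N := (normal_prob 0 s).

Lemma integrable_normal_prob_exp (k : nat) : (k <= 4)%N ->
  N.-integrable setT (EFin \o (fun x => x ^+ k)).
Proof.
move=> k4; apply/integrableP; split; first exact/measurable_EFinP.
under eq_integral do rewrite /comp abse_EFin.
rewrite ge0_integral_normal_prob//; last exact: measurableT_comp.
have /integrableP[_] := int_pow k4; congr (_ < _)%E; apply: eq_integral => x _ /=.
by rewrite normrM (ger0_norm (p_ge0 x)).
Qed.

Lemma normal_prob_moment4 : \int[N]_x (x ^+ 4) <= 128 * s ^+ 4.
Proof.
rewrite /Rintegral ge0_integral_normal_prob//; last by move=> x; rewrite exprn_even_ge0.
have -> : 128 * s ^+ 4 = \int[mu]_x (128 * s ^+ 4 * normal_pdf 0 (Num.sqrt 2 * s) x).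
  rewrite RintegralZl//; last exact: integrable_normal_pdf.
  by rewrite /Rintegral integral_normal_pdf mulr1.
apply: le_Rintegral => //; exact/integrableZ_EFin/integrable_normal_pdf.
Qed.

Lemma normal_prob_moment2 : \int[N]_x (x ^+ 2) = s ^+ 2.
Proof.
by rewrite -moment2 /Rintegral ge0_integral_normal_prob//; move=> x; rewrite sqr_ge0.
Qed.

(** Writing 2 x = (x + 1)^2 - x^2 - 1 leaves integrals of nonnegative functions
    only, for which the density formula was shown. *)
Lemma normal_prob_moment1 : \int[N]_x x = 0.
Proof.
have i1 : N.-integrable setT (EFin \o (fun x : R => x)) by exact: (@integrable_normal_prob_exp 1).
have i2 := @integrable_normal_prob_exp 2 isT.
have i0 := @integrable_normal_prob_exp 0 isT.
have h : \int[N]_x ((x + 1) ^+ 2) = s ^+ 2 + 1.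
  rewrite {1}/Rintegral ge0_integral_normal_prob//; last first.
  - by move=> x; rewrite sqr_ge0.
  - by apply: measurable_funX; exact: measurable_funD.
  rewrite -[LHS]/(\int[mu]_x ((x + 1) ^+ 2 * p x)).
  under eq_Rintegral => x _.
    have -> : (x + 1) ^+ 2 * p x = x ^+ 2 * p x + 2 * (x ^+ 1 * p x) + p x by ring.
    over.
  have j1 := int_pow (isT : (1 <= 4)%N); have j2 := int_pow (isT : (2 <= 4)%N).
  have j1' := integrableZ_EFin 2 measurableT j1.
  rewrite RintegralD//; last exact: integrableD_EFin.
  rewrite RintegralD// RintegralZl// moment2 Rint_p.
  under [X in _ + 2 * X]eq_Rintegral do rewrite expr1.
  by rewrite moment1 mulr0 addr0.
move: h; under eq_Rintegral => x _.
  have -> : (x + 1) ^+ 2 = x ^+ 2 + 2 * x + x ^+ 0 by rewrite expr0; ring.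
  over.
have i1' := integrableZ_EFin 2 measurableT i1.
rewrite RintegralD//; last exact: integrableD_EFin.
rewrite RintegralD// RintegralZl// normal_prob_moment2.
have -> : \int[N]_x (x ^+ 0) = 1.
  rewrite -[RHS]Rint_p /Rintegral ge0_integral_normal_prob//.
  by congr fine; apply: eq_integral => x _; rewrite expr0 mul1r.
lra.
Qed.

End gaussian_moments.

(** * Independence as a product formula *)

Section independent_variables.
Context d (Omega : measurableType d) (R : realType) (Pr : probability Omega R).
Context d' (T' : measurableType d') d'' (T'' : measurableType d'').
Variable N : probability T'' R.
Variables (U : Omega -> T') (V : Omega -> T'').
Hypothesis mU : measurable_fun setT U.
Hypothesis mV : measurable_fun setT V.
Hypothesis lawV : forall E, measurable E -> Pr (V @^-1` E) = N E.
Implicit Types (A : set Omega) (k : T' -> R) (phi : T'' -> R).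

Lemma integrable_law phi : measurable_fun setT phi ->
  N.-integrable setT (EFin \o phi) -> Pr.-integrable setT (EFin \o (phi \o V)).
Proof.
move=> mphi /integrableP[_ phioo]; apply/integrableP; split.
  by apply/measurable_EFinP; exact: measurableT_comp.
apply: le_lt_trans phioo.
have mn : measurable_fun setT (fun y => `|(EFin \o phi) y|%E).
  by apply: measurableT_comp => //; exact/measurable_EFinP.
have := @ge0_integral_pushforward _ _ _ _ R V mV Pr setT _ measurableT mn (fun y _ => abse_ge0 _).
rewrite preimage_setT /= => <-.
by rewrite (@eq_measure_integral _ _ _ setT N)// => E mE _; rewrite /= /pushforward lawV.
Qed.

Lemma integrable_bounded_mul A (g h : Omega -> R) (C : R) : measurable A ->
  measurable_fun setT g -> (forall x, `|g x| <= C) ->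
  Pr.-integrable setT (EFin \o h) ->
  Pr.-integrable A (EFin \o (fun x => g x * h x)).
Proof.
move=> mA mg gC hi; apply: (integrableS measurableT) => //.
have mh : measurable_fun setT h by apply/measurable_EFinP; exact: measurable_int hi.
apply: (le_integrable measurableT _ _ (integrableZ_EFin C measurableT hi)).
  by apply/measurable_EFinP; exact: measurable_funM.
move=> x _ /=; rewrite lee_fin !normrM ler_wpM2r//.
exact: le_trans (gC x) (ler_norm _).
Qed.

(** On A the joint law of U and V is the product of the law of U on A with N, and
    the formula is Fubini's theorem. *)
Lemma Rintegral_independent A k phi (C : R) : measurable A ->
  (forall B E, measurable B -> measurable E ->
    Pr (A `&` U @^-1` B `&` V @^-1` E) = (Pr (A `&` U @^-1` B) * N E)%E) ->
  measurable_fun setT k -> (forall x, `|k x| <= C) ->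
  measurable_fun setT phi -> N.-integrable setT (EFin \o phi) ->
  \int[Pr]_(om in A) (k (U om) * phi (V om)) =
  \int[Pr]_(om in A) k (U om) * \int[N]_y phi y.
Proof.
move=> mA ind mk kC mphi phii.
have mUV : measurable_fun setT (fun om => (U om, V om)) by exact: measurable_fun_pair.
pose m0 := image_on Pr mA mU.
pose m' := image_on Pr mA mUV.
have m0fin : fin_num_fun m0.
  by move=> B mB; rewrite image_onE fin_num_measure//; apply: measurableI => //; rewrite -[X in measurable X]setTI; exact: mU.
pose m1 : {sigma_finite_measure set T' -> \bar R} :=
  HB.pack_for {sigma_finite_measure set T' -> \bar R} (m0 : set T' -> \bar R)
   (Measure.on m0) (Measure_isFinite.Build _ _ _ m0 m0fin).
pose F (z : T' * T'') := k z.1 * phi z.2.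
have mF : measurable_fun setT F.
  by apply: measurable_funM; apply: measurableT_comp.
have Fi : Pr.-integrable A (EFin \o (F \o (fun om => (U om, V om)))).
  apply: (@integrable_bounded_mul _ (k \o U) (phi \o V) C) => //.
  - exact: measurableT_comp.
  - by move=> om; exact: kC.
  - exact: (integrable_law mphi phii).
have e (X : set (T' * T'')) : measurable X -> m' X = (m1 \x N)%E X.
  move=> mX; apply/esym/product_measure_unique => // B E mB mE.
  have -> : m1 B = Pr (A `&` U @^-1` B) by rewrite setIC.
  rewrite -ind// /m' image_onE; congr (Pr _).
  by apply/seteqP; split => om /=; tauto.
have Fi' := integrable_image_on mA mUV mF Fi.
have Fi1 : (m1 \x N)%E.-integrable setT (EFin \o F).
  move/integrableP : Fi' => [mF' Foo]; apply/integrableP; split => //.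
  by rewrite (@eq_measure_integral _ _ _ setT m')// => X mX _; exact: esym (e _ mX).
have ki : Pr.-integrable A (EFin \o (k \o U)).
  apply: (@bounded_integrable _ _ _ _ _ _ C) => //.
    exact: probability_lty.
    by apply: measurable_funTS; exact: measurableT_comp.
  by move=> om _; exact: kC.
have ki' := integrable_image_on mA mU mk ki.
rewrite -(Rintegral_image_on mA mU mk ki) -(Rintegral_image_on mA mUV mF Fi).
rewrite /Rintegral (@eq_measure_integral _ _ _ setT (m1 \x N)%E); last first.
  by move=> X mX _; exact: e.
rewrite -integral12_prod_meas1//.
have -> : (\int[m1]_x fubini_F N (EFin \o F) x = \int[m1]_x ((k x * \int[N]_y phi y)%:E))%E.
  apply: eq_integral => x _; rewrite /fubini_F /F/=.
  under eq_integral do rewrite EFinM.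
  by rewrite integralZl// EFinM /Rintegral fineK//; exact: integrable_fin_num.
by rewrite -[LHS]/(\int[m1]_x (k x * \int[N]_y phi y)) RintegralZr.
Qed.

End independent_variables.

(** * The coalescing pair between two times *)

Section stopped_paths.
Context {R : realType} {d : measure_display} {Omega : measurableType d}.
Variables (X : R -> Omega -> R * R) (B : R -> Omega -> R) (om : Omega).
Hypothesis cX : {within `[0, +oo[, continuous (X ^~ om)}.
Hypothesis cB : {within `[0, +oo[, continuous (B ^~ om)}.
Let D t := (X t om).1 - (X t om).2.
Hypothesis stopped : forall t : R, 0 <= t -> `|D t| = stopped_at_origin B t om.
Let tau := hitting_origin B om.

Let tau_ge0 : (0 <= tau)%E.
Proof. by apply: le_ereal_inf_tmp => _ [t [t0 _] <-]; rewrite lee_fin. Qed.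

Let tau_le t : 0 <= t -> B t om = 0 -> (tau <= t%:E)%E.
Proof. by move=> t0 Bt; apply: ereal_inf_lbound; exists t. Qed.

(** The zeros of a continuous path form a closed set, which contains its infimum. *)
Let hitting_attained (r : R) : tau = r%:E -> B r om = 0.
Proof.
move=> tr; have r0 : 0 <= r by rewrite -lee_fin -tr.
apply/eqP; apply: contraT => Br.
have Br0 : 0 < `|B r om| by rewrite normr_gt0.
have /subspace_continuousP/(_ r) := cB.
rewrite /= in_itv/= r0 => /(_ isT)/cvgrPdist_lt/(_ _ Br0).
rewrite near_withinE => /nbhs_ballP[e /= e0 he].
have : (tau < (r + e)%:E)%E by rewrite tr lte_fin ltrDl.
move=> /ereal_inf_lt[_ [t [t0 Bt] <-]]; rewrite lte_fin => te.
have rt : r <= t by rewrite -lee_fin -tr; exact: tau_le.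
have rte : ball r e t by rewrite /ball/= distrC ger0_norm ?subr_ge0//; move: te; lra.
have := he t rte; rewrite /= in_itv/= t0 => /(_ isT).
by rewrite /from_subspace /= Bt subr0 ltxx.
Qed.

Let min_tau_le t : 0 <= t -> (tau <= t%:E)%E ->
  stopped_at_origin B t om = B (fine tau) om.
Proof. by move=> t0 tt; rewrite /stopped_at_origin -/tau min_r. Qed.

Let min_tau_ge t : (t%:E <= tau)%E -> stopped_at_origin B t om = B t om.
Proof. by move=> tt; rewrite /stopped_at_origin -/tau min_l. Qed.

Let tau_coalesced t : 0 <= t -> (tau <= t%:E)%E -> D t = 0.
Proof.
move=> t0 tt; apply/eqP; rewrite -normr_eq0 stopped// min_tau_le//; apply/eqP/hitting_attained.
by rewrite fineK// ge0_fin_numE// (le_lt_trans tt)// ltry.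
Qed.

Let before_tau t : 0 <= t -> D t != 0 -> (t%:E <= tau)%E /\ B t om = `|D t|.
Proof.
move=> t0 Dt; have tt : (t%:E < tau)%E.
  by rewrite ltNge; apply/negP => /(tau_coalesced t0)/eqP; exact/negP.
by split; [exact: ltW|rewrite stopped// min_tau_ge// ltW].
Qed.

(** If the pair has met at time u, the Brownian motion has reached the origin by
    then, and the distance remains stopped there. *)
Lemma coalesced_forever u v : 0 <= u -> u <= v -> D u = 0 -> D v = 0.
Proof.
move=> u0 uv Du; have v0 := le_trans u0 uv.
apply: tau_coalesced => //; apply: (@le_trans _ _ u%:E); last by rewrite lee_fin.
rewrite leNgt; apply/negP => ut.
have := stopped u0; rewrite Du normr0 min_tau_ge ?ltW// => /esym Bu.
by have := tau_le u0 Bu; rewrite leNgt ut.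
Qed.

Let cD v : 0 <= v -> {within `[0, v], continuous D}.
Proof.
move=> v0; have c : {within `[0, +oo[, continuous D}.
  have cd : continuous (fun y : R * R => y.1 - y.2).
    by move=> y; apply: cvgB; [exact: cvg_fst|exact: cvg_snd].
  by move=> t; exact: (cvg_comp _ _ (@cX t) (@cd _)).
apply: continuous_subspaceW c => t /=.
by rewrite !in_itv/= => /andP[-> _].
Qed.

Let same_sign u v : 0 <= u -> u <= v -> D v != 0 -> 0 <= D u * D v.
Proof.
move=> u0 uv Dv; rewrite leNgt; apply/negP => h.
have cuv : {within `[u, v], continuous D}.
  apply: continuous_subspaceW (cD (le_trans u0 uv)) => t /=.
  by rewrite !in_itv/= => /andP[ut ->]; rewrite (le_trans u0).
have [|c] := @IVT R D u v 0 uv cuv.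
  by rewrite ge_min le_max; have [d1|d1] := leP (D u) 0; have [d2|d2] := leP (D v) 0 => //=; nra.
rewrite in_itv/= => /andP[uc cv] Dc.
by move/eqP: Dv; apply; apply: (@coalesced_forever c) => //; exact: le_trans uc.
Qed.

(** A change of sign of the difference forces a meeting in between, after which
    the difference is zero. *)
Lemma coalescing_same_side u v : 0 <= u -> u <= v -> same_side (X u om) (X v om).
Proof.
move=> u0 uv; have [Dv|Dv] := eqVneq (D v) 0.
  by split=> _; rewrite le_eqVlt; apply/orP; left; move: Dv; rewrite /D => /eqP; rewrite subr_eq0 // eq_sym.
have := same_sign u0 uv Dv.
have [Du|Du] := eqVneq (D u) 0.
  by move: Dv; rewrite (coalesced_forever u0 uv Du) eqxx.
move: Dv Du; rewrite /D; set b := _ - _; set a := _ - _ => b0 a0 ab.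
split => h.
- have a1 : a < 0 by rewrite lt_neqAle a0/= subr_le0.
  by rewrite -subr_le0 -/b; nra.
- have a1 : 0 < a by rewrite subr_gt0.
  by rewrite -subr_ge0 -/b; nra.
Qed.

(** Before the meeting the distance is the Brownian motion itself, and the
    difference does not change sign. *)
Lemma separated_increment u v : 0 <= u -> u <= v -> D v != 0 ->
  (D v - D u) ^+ 2 = (B v om - B u om) ^+ 2.
Proof.
move=> u0 uv Dv; have v0 := le_trans u0 uv.
have Du : D u != 0 by apply: contra Dv => /eqP/(coalesced_forever u0 uv)/eqP.
have [_ ->] := before_tau v0 Dv; have [_ ->] := before_tau u0 Du.
have := same_sign u0 uv Dv; rewrite [D u * _]mulrC => h.
rewrite (sqrrB (D v)) (sqrrB `|D v|) !real_normK ?num_real// -normrM.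
by rewrite (ger0_norm h).
Qed.

End stopped_paths.

(** * Increments of a Brownian motion *)

Section brownian_increments.
Context {R : realType} {d : measure_display} {Omega : measurableType d}.
Variables (Pr : probability Omega R) (X : R -> Omega -> R * R).
Hypothesis mX : forall r, 0 <= r -> measurable_fun setT (X r).
Variables (sigma : R) (B : R -> Omega -> R).
Hypothesis sigma0 : 0 < sigma.
Hypothesis bm : brownian Pr (natural_filtration X) sigma B.
Variables (u v : R) (A : set Omega).
Hypotheses (u0 : 0 <= u) (uv : u < v) (FA : natural_filtration X u A).

Let v0 : 0 <= v. Proof. exact: le_trans (ltW uv). Qed.

Let mA : measurable A.
Proof. exact: natural_filtration_measurable FA. Qed.

Let W om := B v om - B u om.

Let mB t : 0 <= t -> measurable_fun setT (B t).
Proof.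
move=> t0 _ E mE; rewrite setTI; case: bm => ad _ _.
exact: natural_filtration_measurable (ad _ t0 _ mE).
Qed.

Lemma measurable_increment : measurable_fun setT (fun om => B v om - B u om).
Proof. by apply: measurable_funB; apply: mB. Qed.

Let s : R := Num.sqrt (sigma * (v - u)).

Let s0 : 0 < s. Proof. by rewrite sqrtr_gt0 mulr_gt0// subr_gt0. Qed.

Let s2 : s ^+ 2 = sigma * (v - u).
Proof. by rewrite sqr_sqrtr// mulr_ge0// ?(ltW sigma0)// subr_ge0 ltW. Qed.

Let law E : measurable E -> Pr (W @^-1` E) = normal_prob 0 s E.
Proof. by case: bm => _ _ /(_ _ _ u0 uv)[+ _]; exact. Qed.

Let independent B' E : measurable B' -> measurable E ->
  Pr (A `&` X u @^-1` B' `&` W @^-1` E) = (Pr (A `&` X u @^-1` B') * normal_prob 0 s E)%E.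
Proof.
move=> mB' mE; rewrite -law//; case: bm => _ _ /(_ _ _ u0 uv)[_]; apply => //.
pose G := \bigcup_(r in `[0, u]) preimage_set_system setT (X r) measurable.
have FB := @natural_filtration_preimage _ _ _ X u u _ u0 (lexx u) mB'.
exact: (@measurableI _ (g_sigma_algebraType G) A (X u @^-1` B') FA FB).
Qed.

Variables (k : R * R -> R) (C : R).
Hypotheses (mk : measurable_fun setT k) (kC : forall x, `|k x| <= C).

Let mpow (j : nat) : measurable_fun setT (fun x : R => x ^+ j).
Proof. exact: measurable_funX. Qed.

Lemma integrable_increment j : (j <= 4)%N ->
  Pr.-integrable A (EFin \o (fun om => k (X u om) * (B v om - B u om) ^+ j)).
Proof.
move=> j4; apply: (@integrable_bounded_mul _ _ _ Pr A (k \o X u) (fun om => W om ^+ j) C) => //.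
- by apply: measurableT_comp => //; exact: mX.
- by move=> om; exact: kC.
- exact: (@integrable_law _ _ _ Pr _ _ (normal_prob 0 s) W measurable_increment law _ (mpow j) (integrable_normal_prob_exp s0 j4)).
Qed.

Lemma increment_moment j : (j <= 4)%N ->
  \int[Pr]_(om in A) (k (X u om) * (B v om - B u om) ^+ j) =
  \int[Pr]_(om in A) k (X u om) * \int[normal_prob 0 s]_x (x ^+ j).
Proof.
move=> j4.
exact: (@Rintegral_independent _ _ _ Pr _ _ _ _ (normal_prob 0 s) _ W
  (mX u0) measurable_increment law A k _ C mA independent mk kC
  (mpow j) (integrable_normal_prob_exp s0 j4)).
Qed.

Lemma increment_moment1 : \int[Pr]_(om in A) (k (X u om) * (B v om - B u om)) = 0.
Proof.
have := @increment_moment 1 isT.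
under eq_Rintegral do rewrite expr1; move=> ->.
under [X in _ * X]eq_Rintegral do rewrite expr1.
by rewrite normal_prob_moment1// mulr0.
Qed.

Lemma increment_moment2 : \int[Pr]_(om in A) (k (X u om) * (B v om - B u om) ^+ 2) =
  sigma * (v - u) * \int[Pr]_(om in A) k (X u om).
Proof. by rewrite increment_moment// normal_prob_moment2// s2 mulrC. Qed.

End brownian_increments.

Section brownian_increment_powers.
Context {R : realType} {d : measure_display} {Omega : measurableType d}.
Variables (Pr : probability Omega R) (X : R -> Omega -> R * R).
Hypothesis mX : forall r, 0 <= r -> measurable_fun setT (X r).
Variables (sigma : R) (B : R -> Omega -> R).
Hypothesis sigma0 : 0 < sigma.
Hypothesis bm : brownian Pr (natural_filtration X) sigma B.
Variables (u v : R) (A : set Omega).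
Hypotheses (u0 : 0 <= u) (uv : u < v) (FA : natural_filtration X u A).

Let mA : measurable A.
Proof. exact: natural_filtration_measurable FA. Qed.

Let one_bound (x : R * R) : `|cst (1 : R) x| <= 1. Proof. by rewrite normr1. Qed.

Let int_one_le : 0 <= \int[Pr]_(om in A) cst (1 : R) (X u om) <= 1.
Proof.
rewrite /= Rintegral_cst// mul1r fine_ge0//=.
by rewrite -[leRHS]/(fine 1%E) fine_le ?fin_num_measure// probability_le1.
Qed.

Lemma integrable_increment_exp j : (j <= 4)%N ->
  Pr.-integrable A (EFin \o (fun om => (B v om - B u om) ^+ j)).
Proof.
move=> j4.
have := integrable_increment mX sigma0 bm u0 uv FA (measurable_cst (1 : R)) one_bound j4.
by apply: eq_integrable => // om _ /=; rewrite mul1r.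
Qed.

Lemma increment_square_le :
  \int[Pr]_(om in A) ((B v om - B u om) ^+ 2) <= sigma * (v - u).
Proof.
have := increment_moment2 mX sigma0 bm u0 uv FA (measurable_cst (1 : R)) one_bound.
under eq_Rintegral do rewrite mul1r; move=> ->.
have s0 : 0 <= sigma * (v - u) by rewrite mulr_ge0 ?(ltW sigma0)// subr_ge0 ltW.
by move: int_one_le => /andP[_ h]; rewrite ler_piMr.
Qed.

Lemma increment_fourth_le :
  \int[Pr]_(om in A) ((B v om - B u om) ^+ 4) <= 128 * (sigma * (v - u)) ^+ 2.
Proof.
have s0 : 0 < sigma * (v - u) by rewrite mulr_gt0// subr_gt0.
have := increment_moment mX sigma0 bm u0 uv FA (measurable_cst (1 : R)) one_bound (isT : (4 <= 4)%N).
under eq_Rintegral do rewrite mul1r; move=> ->.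
have sq0 : 0 < Num.sqrt (sigma * (v - u)) by rewrite sqrtr_gt0.
have := normal_prob_moment4 sq0.
have -> : Num.sqrt (sigma * (v - u)) ^+ 4 = (sigma * (v - u)) ^+ 2.
  by rewrite (exprM _ 2 2) sqr_sqrtr// ltW.
apply: le_trans; move: int_one_le => /andP[_ h]; apply: ler_piMl => //.
apply: Rintegral_ge0 => x _; exact: exprn_even_ge0.
Qed.

End brownian_increment_powers.

(** * One step of the chain rule *)

Section integral_calculus.
Context d (T : measurableType d) (R : realType) (mu : {measure set T -> \bar R}).
Variables (A : set T) (mA : measurable A).
Implicit Types (g : T -> R) (x k : R).

Definition has_integral g x :=
  mu.-integrable A (EFin \o g) /\ \int[mu]_(om in A) g om = x.

Lemma has_integralD g g' x x' : has_integral g x -> has_integral g' x' ->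
  has_integral (fun om => g om + g' om) (x + x').
Proof.
by move=> [gi <-] [gi' <-]; split; [exact: integrableD_EFin|rewrite RintegralD].
Qed.

Lemma has_integralB g g' x x' : has_integral g x -> has_integral g' x' ->
  has_integral (fun om => g om - g' om) (x - x').
Proof.
by move=> [gi <-] [gi' <-]; split; [exact: integrableB_EFin|rewrite RintegralB].
Qed.

Lemma has_integralZ k g x : has_integral g x ->
  has_integral (fun om => k * g om) (k * x).
Proof. by move=> [gi <-]; split; [exact: integrableZ_EFin|rewrite RintegralZl]. Qed.

Lemma has_integral_le N g g' x x' : measurable N -> mu N = 0%E ->
  has_integral g x -> has_integral g' x' ->
  (forall om, ~ N om -> `|g om| <= g' om) -> `|x| <= x'.
Proof.
move=> mN N0 [gi <-] [gi' <-] gg'.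
have mAN : measurable (A `\` N) by exact: measurableD.
have giN : mu.-integrable (A `\` N) (EFin \o g) by exact: integrableS gi.
have giN' : mu.-integrable (A `\` N) (EFin \o g') by exact: integrableS gi'.
rewrite /Rintegral (negligible_integral mN mA gi N0) (negligible_integral mN mA gi' N0).
rewrite -![fine _]/(\int[mu]_(om in A `\` N) _ om).
apply: (le_trans (le_normr_Rintegral mAN giN)).
apply: le_Rintegral => //; first exact: (integrable_norm giN).
by move=> om [_ /gg'].
Qed.

End integral_calculus.

Section coalescing_step.
Variable R : realType.
Implicit Types (x y : R * R) (w : R).

(** By polarisation, the mixed product a * b is (a^2 + b^2 - (a - b)^2) / 2, and
    (a - b)^2 is compared with the square of the Brownian increment w.
    When the pair meets during the step, the increment of its distance no
    longer matches the Brownian one; the error is paid by the indicator of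
    this event, at most once along a path, and by fourth powers. *)
Lemma coalescing_step_bound (f d1 d2 d11 d12 d22 : R * R -> R) (e C c q : R) x y w :
  0 < e -> 0 <= C -> 0 < c -> 0 < q -> (forall z, `|d12 z| <= c) -> (forall a, d12 (a, a) = 0) ->
  `|taylor_remainder f d1 d2 d11 d12 d22 x y| <=
     e * ((y.1 - x.1) ^+ 2 + (y.2 - x.2) ^+ 2) +
     C * ((y.1 - x.1) ^+ 2 + (y.2 - x.2) ^+ 2) ^+ 2 ->
  (x.1 - x.2 = 0 -> y.1 - y.2 = 0) ->
  (y.1 - y.2 != 0 -> ((y.1 - y.2) - (x.1 - x.2)) ^+ 2 = w ^+ 2) ->
  `|f y - f x - (d1 x * (y.1 - x.1) + d2 x * (y.2 - x.2) +
     2^-1 * (d11 x * (y.1 - x.1) ^+ 2 + d22 x * (y.2 - x.2) ^+ 2) +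
     2^-1 * (d12 x * (y.1 - x.1) ^+ 2 + d12 x * (y.2 - x.2) ^+ 2 - d12 x * w ^+ 2))| <=
  e * ((y.1 - x.1) ^+ 2 + (y.2 - x.2) ^+ 2) +
  2 * C * ((y.1 - x.1) ^+ 4 + (y.2 - x.2) ^+ 4) +
  q * ((x.1 - x.2 != 0)%:R - (y.1 - y.2 != 0)%:R) +
  c ^+ 2 / q * (w ^+ 4 + 2 * (y.1 - x.1) ^+ 4 + 2 * (y.2 - x.2) ^+ 4).
Proof.
move=> e0 C0 c0 q0 d12c d120; set rem := taylor_remainder _ _ _ _ _ _ _ _ => hrem xy xyw.
set a := y.1 - x.1 in hrem *; set b := y.2 - x.2 in hrem *.
set S := f y - _ - _.
have SE : S = rem + 2^-1 * d12 x * (w ^+ 2 - (a - b) ^+ 2).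
  by rewrite /rem /S /taylor_remainder -/a -/b; field.
have ab4 : (a ^+ 2 + b ^+ 2) ^+ 2 <= 2 * (a ^+ 4 + b ^+ 4).
  have -> : 2 * (a ^+ 4 + b ^+ 4) = (a ^+ 2 + b ^+ 2) ^+ 2 + (a ^+ 2 - b ^+ 2) ^+ 2 by ring.
  by rewrite lerDl sqr_ge0.
have hrem' : `|rem| <= e * (a ^+ 2 + b ^+ 2) + 2 * C * (a ^+ 4 + b ^+ 4).
  apply: le_trans hrem _; rewrite lerD2l -mulrA [2 * _]mulrC -mulrA ler_wpM2l// mulrC.
  exact: ab4.
have P4 (z : R) : 0 <= z ^+ 4 by exact: exprn_even_ge0.
have rest0 : 0 <= c ^+ 2 / q * (w ^+ 4 + 2 * a ^+ 4 + 2 * b ^+ 4).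
  apply: mulr_ge0; first by rewrite divr_ge0 ?sqr_ge0// ltW.
  by have := P4 w; have := P4 a; have := P4 b; lra.
have rem_only : (x.1 - x.2 != 0)%:R - (y.1 - y.2 != 0)%:R = 0 :> R -> S = rem ->
  `|S| <= e * (a ^+ 2 + b ^+ 2) + 2 * C * (a ^+ 4 + b ^+ 4) +
    q * ((x.1 - x.2 != 0)%:R - (y.1 - y.2 != 0)%:R) +
    c ^+ 2 / q * (w ^+ 4 + 2 * a ^+ 4 + 2 * b ^+ 4).
  by move=> -> ->; rewrite mulr0 addr0; apply: le_trans hrem' _; rewrite lerDl.
have dec (r : R) : r = 0 \/ r != 0 by have [->|] := eqVneq r 0; [left|right].
have [x0|x0] := dec (x.1 - x.2).
  apply: rem_only; first by rewrite x0 (xy x0) eqxx subrr.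
  have xE : x = (x.1, x.1).
    apply: injective_projections => //=.
    by move/eqP: x0; rewrite subr_eq0 => /eqP ->.
  by rewrite SE xE d120 mulr0 mul0r addr0.
have [y0|y0] := dec (y.1 - y.2); last first.
  apply: rem_only; first by rewrite x0 y0 subrr.
  rewrite SE -(xyw y0) (_ : a - b = y.1 - y.2 - (x.1 - x.2)); last by rewrite /a /b; ring.
  by rewrite subrr mulr0 addr0.
rewrite x0 y0 eqxx/= subr0 mulr1 SE.
(* Young's inequality; of the five squares w^2, a^2, a^2, b^2, b^2 each gets q / 5 *)
have sq (z : R) : 2^-1 * (c * z ^+ 2) <= q / 5 + c ^+ 2 / q * z ^+ 4.
  rewrite -subr_ge0.
  have -> : q / 5 + c ^+ 2 / q * z ^+ 4 - 2^-1 * (c * z ^+ 2) =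
    5 / (16 * q) * (c * z ^+ 2 - 4 * q / 5) ^+ 2 + 11 / (16 * q) * (c * z ^+ 2) ^+ 2.
    by field; rewrite gt_eqF.
  by rewrite addr_ge0// mulr_ge0 ?sqr_ge0// divr_ge0// mulr_ge0// ltW.
apply: (le_trans (ler_normD _ _)).
have cross : `|2^-1 * d12 x * (w ^+ 2 - (a - b) ^+ 2)| <=
    2^-1 * (c * (w ^+ 2 + 2 * a ^+ 2 + 2 * b ^+ 2)).
  rewrite -mulrA normrM ger0_norm// ler_wpM2l// normrM ler_pM//.
  rewrite ler_norml; apply/andP; split.
    by have := sqr_ge0 w; have := sqr_ge0 (a + b); nra.
  by have := sqr_ge0 (a - b); have := sqr_ge0 a; have := sqr_ge0 b; nra.
have := sq w; have := sq a; have := sq b.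
move: hrem' cross.
set r := `|rem|; set s := `|_|; set k := c ^+ 2 / q.
set W := w ^+ 4; set A4 := a ^+ 4; set B4 := b ^+ 4.
set E := e * _ + _; lra.
Qed.
End coalescing_step.

Section one_step.
Context {R : realType} {d : measure_display} {Omega : measurableType d}.
Variables (Pr : probability Omega R) (X : R -> Omega -> R * R) (rho : R).
Hypothesis mX : forall r, 0 <= r -> measurable_fun setT (X r).
Hypothesis rho0 : 0 < rho.
Hypothesis sysX : coalescing_system Pr rho X.
Variable f : R * R -> R.
Hypothesis Df : calD f.

(** It decreases in t, and its decrease over a step is the mass of the paths in A
    along which the pair meets during this step. *)
Definition separation_mass (A : set Omega) (t : R) : R :=
  \int[Pr]_(om in A) ((X t om).1 - (X t om).2 != 0)%:R.

Let measurable_separation t : 0 <= t ->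
  measurable_fun setT (fun om => ((X t om).1 - (X t om).2 != 0)%:R : R).
Proof.
move=> t0.
have m1 : measurable_fun setT (fun om => (X t om).1) by apply: measurableT_comp (mX t0).
have m2 : measurable_fun setT (fun om => (X t om).2) by apply: measurableT_comp (mX t0).
have -> : (fun om => ((X t om).1 - (X t om).2 != 0)%:R : R) =
    (fun om => if (X t om).1 == (X t om).2 then 0 else 1).
  by apply/funext => om; rewrite subr_eq0; case: eqP.
by apply: measurable_fun_ifT => //; exact: measurable_fun_eqr.
Qed.

Let separated_integral A t : measurable A -> 0 <= t ->
  has_integral Pr A (fun om => ((X t om).1 - (X t om).2 != 0)%:R) (separation_mass A t).
Proof.
move=> mA t0; split => //; apply: (@bounded_integrable _ _ _ _ _ _ 1) => //; first exact: probability_lty.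
  exact: measurable_funTS (measurable_separation t0).
by move=> om _; case: (_ != _); rewrite ?normr1 ?normr0.
Qed.

Lemma separation_mass_bounds A t : measurable A -> 0 <= t -> 0 <= separation_mass A t <= 1.
Proof.
move=> mA t0; apply/andP; split; first by apply: Rintegral_ge0 => om _; case: (_ != _).
apply: (@le_trans _ _ (\int[Pr]_(om in A) cst 1 om)).
  apply: le_Rintegral => //; first by case: (separated_integral mA t0).
    by apply: finite_measure_integrable_cst.
  by move=> om _; case: (_ != _).
rewrite Rintegral_cst// mul1r.
by rewrite -[leRHS]/(fine 1%E) fine_le ?fin_num_measure// probability_le1.
Qed.

Lemma bounded_measurable_integral A k t : measurable A -> 0 <= t -> bounded_measurable k ->
  has_integral Pr A (fun om => k (X t om)) (\int[Pr]_(om in A) k (X t om)).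
Proof.
move=> mA t0 [mk [C kC]]; split => //; apply: (@bounded_integrable _ _ _ _ _ _ C) => //.
  exact: probability_lty.
by apply: measurable_funTS; apply: measurableT_comp (mX t0).
Qed.

Section moments.
Variables (sigma : R) (B : R -> Omega -> R) (sigma0 : 0 < sigma).
Hypothesis bm : brownian Pr (natural_filtration X) sigma B.
Variables (A : set Omega) (u v : R) (u0 : 0 <= u) (uv : u < v).
Hypothesis FA : natural_filtration X u A.
Variables (k : R * R -> R) (bk : bounded_measurable k).

Lemma increment_integral1 : has_integral Pr A (fun om => k (X u om) * (B v om - B u om)) 0.
Proof.
case: bk => mk [C kC]; split; last exact: (increment_moment1 mX sigma0 bm u0 uv FA mk kC).
have := integrable_increment mX sigma0 bm u0 uv FA mk kC (isT : (1 <= 4)%N).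
by under eq_fun do rewrite expr1.
Qed.

Lemma increment_integral2 : has_integral Pr A (fun om => k (X u om) * (B v om - B u om) ^+ 2)
  (sigma * (v - u) * \int[Pr]_(om in A) k (X u om)).
Proof.
case: bk => mk [C kC]; split; last exact: (increment_moment2 mX sigma0 bm u0 uv FA mk kC).
exact: (integrable_increment mX sigma0 bm u0 uv FA mk kC (isT : (2 <= 4)%N)).
Qed.

Lemma increment_power_integral j : (j <= 4)%N -> has_integral Pr A (fun om => (B v om - B u om) ^+ j)
  (\int[Pr]_(om in A) ((B v om - B u om) ^+ j)).
Proof. by move=> j4; split => //; exact: (integrable_increment_exp mX sigma0 bm u0 uv FA j4). Qed.

End moments.

(** Apart from the remainder and the correction of the mixed term, the integral of
    each term of the expansion is known from the moments of the increments; the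
    three contributions of the mixed term, with speeds rho, rho and 2 * rho,
    cancel. *)
Lemma coalescing_one_step (e : R) : 0 < e -> exists2 K : R, 0 <= K &
  forall u h A, 0 <= u -> 0 < h -> natural_filtration X u A ->
  `|\int[Pr]_(om in A) (f (X (u + h) om) - f (X u om)) -
    h * \int[Pr]_(om in A) G0 rho f (X u om)| <=
  e * h + e * (separation_mass A u - separation_mass A (u + h)) + K * h ^+ 2.
Proof.
move=> e0; case: (calD_taylor rho Df) => cG [d1 [d2 [d11 [d12 [d22]]]]].
move=> [[b1 b2 b11 b12 b22] d120 GE taylor].
case: sysX => cX bm1 bm2 [B bmB [N0 [mN PN hN]]].
have cB : continuous_process B by case: bmB.
(* the squares of the two increments have total mean 2 * rho * h at most *)
pose e1 := e / (2 * rho).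
have e10 : 0 < e1 by rewrite divr_gt0// mulr_gt0.
have [C C0 hC] := taylor _ e10.
have [c c0 d12c] : exists2 c, 0 < c & forall z, `|d12 z| <= c.
  case: b12 => _ [c hc]; exists (`|c| + 1); first by rewrite ltr_wpDl.
  by move=> z; apply: le_trans (hc z) _; apply: le_trans (ler_norm _) _; rewrite lerDl.
pose c' := c ^+ 2 / e.
have c'0 : 0 <= c' by rewrite divr_ge0 ?sqr_ge0// ltW.
have [m m0 mE] : exists2 m : R, 0 <= m & 128 * rho ^+ 2 = m.
  by exists (128 * rho ^+ 2) => //; apply: mulr_ge0; [exact: ler0n|exact: sqr_ge0].
exists (4 * C * m + 8 * c' * m); first by apply: addr_ge0; apply: mulr_ge0 => //; apply: mulr_ge0.
move=> u h A u0 h0 FA; set v := u + h.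
have uv : u < v by rewrite ltrDl.
have v0 : 0 <= v := le_trans u0 (ltW uv).
have vu : v - u = h by rewrite /v; ring.
have mA : measurable A by exact: natural_filtration_measurable FA.
have rho20 : 0 < 2 * rho by rewrite mulr_gt0.
have J1 := increment_integral1 rho0 bm1 u0 uv FA b1.
have J2 := increment_integral1 rho0 bm2 u0 uv FA b2.
have J11 := increment_integral2 rho0 bm1 u0 uv FA b11.
have J22 := increment_integral2 rho0 bm2 u0 uv FA b22.
have J12 := increment_integral2 rho0 bm1 u0 uv FA b12.
have J21 := increment_integral2 rho0 bm2 u0 uv FA b12.
have JB := increment_integral2 rho20 bmB u0 uv FA b12.
have Jv := bounded_measurable_integral mA v0 (calD_bounded Df).
have Ju := bounded_measurable_integral mA u0 (calD_bounded Df).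
have L1 := increment_power_integral rho0 bm1 u0 uv FA (isT : (2 <= 4)%N).
have L2 := increment_power_integral rho0 bm2 u0 uv FA (isT : (2 <= 4)%N).
have M1 := increment_power_integral rho0 bm1 u0 uv FA (isT : (4 <= 4)%N).
have M2 := increment_power_integral rho0 bm2 u0 uv FA (isT : (4 <= 4)%N).
have MB := increment_power_integral rho20 bmB u0 uv FA (isT : (4 <= 4)%N).
have l1 := increment_square_le mX rho0 bm1 u0 uv FA.
have l2 := increment_square_le mX rho0 bm2 u0 uv FA.
have F1 := increment_fourth_le mX rho0 bm1 u0 uv FA.
have F2 := increment_fourth_le mX rho0 bm2 u0 uv FA.
have F3 := increment_fourth_le mX rho20 bmB u0 uv FA.
have S := has_integralB mA (has_integralB mA Jv Ju)
  (has_integralD mA (has_integralD mA (has_integralD mA J1 J2)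
     (has_integralZ mA 2^-1 (has_integralD mA J11 J22)))
     (has_integralZ mA 2^-1 (has_integralB mA (has_integralD mA J12 J21) JB))).
have T := has_integralD mA (has_integralD mA (has_integralD mA
  (has_integralZ mA e1 (has_integralD mA L1 L2))
  (has_integralZ mA (2 * C) (has_integralD mA M1 M2)))
  (has_integralZ mA e (has_integralB mA (separated_integral mA u0) (separated_integral mA v0))))
  (has_integralZ mA c' (has_integralD mA (has_integralD mA MB (has_integralZ mA 2 M1))
     (has_integralZ mA 2 M2))).
have key := has_integral_le mA mN PN S T.
have {}key := key _.
have pathwise : forall om, ~ N0 om -> _ := fun om Nom =>
  let st : forall t : R, 0 <= t ->
      `|(X t om).1 - (X t om).2| = stopped_at_origin B t om :=
    contrapT (fun h => Nom (hN om h)) in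
  @coalescing_step_bound R f d1 d2 d11 d12 d22 e1 C c e (X u om) (X v om)
    (B v om - B u om) e10 C0 c0 e0 d12c d120
    (hC _ _ (coalescing_same_side (cX om) (cB om) st u0 (ltW uv)))
    (coalesced_forever (cB om) st u0 (ltW uv))
    (separated_increment (cX om) (cB om) st u0 (ltW uv)).
have {}key := key pathwise.
have GI : \int[Pr]_(om in A) G0 rho f (X u om) =
    2^-1 * rho * (\int[Pr]_(om in A) d11 (X u om) + \int[Pr]_(om in A) d22 (X u om)).
  under eq_Rintegral => om _ do rewrite GE.
  have [h1 _] := bounded_measurable_integral mA u0 b11; have [h2 _] := bounded_measurable_integral mA u0 b22.
  by case: (has_integralZ mA (2^-1 * rho) (has_integralD mA (conj h1 erefl) (conj h2 erefl))).
have fI : \int[Pr]_(om in A) (f (X v om) - f (X u om)) =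
    \int[Pr]_(om in A) f (X v om) - \int[Pr]_(om in A) f (X u om).
  by case: (has_integralB mA Jv Ju).
rewrite fI GI; move: key l1 l2 F1 F2 F3; rewrite vu.
clear S T J1 J2 J11 J22 J12 J21 JB Jv Ju L1 L2 M1 M2 MB pathwise GI fI.
set x1 := Rintegral _ _ (fun om => f (X v om)).
set x2 := Rintegral _ _ (fun om => f (X u om)).
set y1 := Rintegral _ _ (fun om => d11 (X u om)).
set y2 := Rintegral _ _ (fun om => d22 (X u om)).
set y3 := Rintegral _ _ (fun om => d12 (X u om)).
set p1 := Rintegral _ _ (fun om => ((X v om).1 - (X u om).1) ^+ 2).
set p2 := Rintegral _ _ (fun om => ((X v om).2 - (X u om).2) ^+ 2).
set q1 := Rintegral _ _ (fun om => ((X v om).1 - (X u om).1) ^+ 4).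
set q2 := Rintegral _ _ (fun om => ((X v om).2 - (X u om).2) ^+ 4).
set q3 := Rintegral _ _ (fun om => (B v om - B u om) ^+ 4).
have -> : x1 - x2 - (0 + 0 + 2^-1 * (rho * h * y1 + rho * h * y2) +
    2^-1 * (rho * h * y3 + rho * h * y3 - 2 * rho * h * y3)) =
  x1 - x2 - h * (2^-1 * rho * (y1 + y2)) by field.
move=> key l1 l2 F1 F2 F3; apply: (le_trans key).
have {}F1 : q1 <= m * h ^+ 2 by apply: le_trans F1 _; rewrite exprMn mulrA mE.
have {}F2 : q2 <= m * h ^+ 2 by apply: le_trans F2 _; rewrite exprMn mulrA mE.
have {}F3 : q3 <= 4 * m * h ^+ 2.
  by apply: le_trans F3 _; rewrite -mE le_eqVlt; apply/orP; left; apply/eqP; ring.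
have E1 : e1 * (p1 + p2) <= e * h.
  have -> : e * h = e1 * (rho * h + rho * h) by rewrite /e1; field; rewrite gt_eqF.
  by apply: ler_wpM2l; [exact: ltW|exact: lerD].
have E2 : 2 * C * (q1 + q2) <= 2 * C * (m * h ^+ 2 + m * h ^+ 2).
  by apply: ler_wpM2l; [exact: mulr_ge0|exact: lerD].
have E3 : c' * (q3 + 2 * q1 + 2 * q2) <= c' * (4 * m * h ^+ 2 + 2 * (m * h ^+ 2) + 2 * (m * h ^+ 2)).
  by apply: ler_wpM2l => //; move: F1 F2 F3; lra.
have -> : (4 * C * m + 8 * c' * m) * h ^+ 2 = 2 * C * (m * h ^+ 2 + m * h ^+ 2) +
  c' * (4 * m * h ^+ 2 + 2 * (m * h ^+ 2) + 2 * (m * h ^+ 2)) by ring.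
by move: E1 E2 E3; lra.
Qed.

End one_step.

(** * From the steps to the martingale property *)

Section time_integral.
Variable R : realType.

Definition time_integral (g : R * R -> R) (t : R) (w : path_space R) : R :=
  \int[lebesgue_measure]_(r in `[0, t]) g (coordinate r w).

Lemma time_integral_extended g t w : time_integral g t w =
  \int[lebesgue_measure]_(r in `[0, t]) g (extended_path w r).
Proof.
apply: eq_Rintegral => r; rewrite inE/= in_itv/= => /andP[r0 _].
by rewrite extended_path_ge0.
Qed.

Lemma cvg_time_riemann_sum g u v w : continuous g -> 0 <= u -> u <= v ->
  \sum_(0 <= j < n.+1) (v - u) / n.+1%:R * g (coordinate (u + j%:R * ((v - u) / n.+1%:R)) w)
    @[n --> \oo] --> time_integral g v w - time_integral g u w.
Proof.
move=> cg u0 uv; rewrite !time_integral_extended.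
have cgw : continuous (fun r => g (extended_path w r)).
  by move=> r; apply: continuous_comp; [exact: continuous_extended_path|exact: cg].
have := cvg_riemann_sum cgw u0 uv.
have -> // : (fun n : nat => \sum_(0 <= j < n.+1) (v - u) / n.+1%:R *
    g (extended_path w (u + j%:R * ((v - u) / n.+1%:R)))) =
  (fun n : nat => \sum_(0 <= j < n.+1) (v - u) / n.+1%:R *
    g (coordinate (u + j%:R * ((v - u) / n.+1%:R)) w)).
apply/funext => n; apply: eq_bigr => j _; rewrite extended_path_ge0//.
by rewrite addr_ge0// mulr_ge0// divr_ge0// subr_ge0.
Qed.

Lemma time_integral0 g w : time_integral g 0 w = 0.
Proof. by rewrite /time_integral set_itv1 Rintegral_set1. Qed.

Lemma time_integral_bound g C t w : continuous g -> (forall x, `|g x| <= C) -> 0 <= t ->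
  `|time_integral g t w| <= C * t.
Proof.
move=> cg gC t0; have cgw : continuous (fun r => g (extended_path w r)).
  by move=> r; apply: continuous_comp; [exact: continuous_extended_path|exact: cg].
have := integral_lipschitz cgw (fun r => gC (extended_path w r)) (lexx 0) t0.
by rewrite -!time_integral_extended time_integral0 !subr0.
Qed.

(** A limit of Riemann sums only looks at the path up to time t. *)
Lemma measurable_time_integral d (T : measurableType d) (Y : T -> path_space R) g t :
  continuous g -> 0 <= t ->
  (forall r, 0 <= r -> r <= t -> measurable_fun setT (fun x => coordinate r (Y x))) ->
  measurable_fun setT (fun x => time_integral g t (Y x)).
Proof.
move=> cg t0 mY.
apply: (@measurable_fun_cvg _ _ _ _ (fun n x => \sum_(0 <= j < n.+1) (t - 0) / n.+1%:R *
  g (coordinate (0 + j%:R * ((t - 0) / n.+1%:R)) (Y x)))) => [n|x _].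
  under eq_fun do rewrite big_mkord.
  apply: measurable_sum => j; apply: measurable_funM => //.
  apply: measurableT_comp; first exact: continuous_measurable_fun2.
  rewrite subr0 add0r; apply: mY; first by rewrite mulr_ge0// divr_ge0.
  by rewrite mulrA ler_pdivrMr ?ltr0Sn// mulrC ler_wpM2l// ler_nat ltnW.
have := @cvg_time_riemann_sum g 0 t (Y x) cg (lexx 0) t0.
by rewrite time_integral0 [time_integral _ _ _ - 0]subr0.
Qed.

End time_integral.

Section martingale_increment.
Context {R : realType} {d : measure_display} {Omega : measurableType d}.
Variables (Pr : probability Omega R) (rho : R) (Y : {mfun Omega >-> path_space R}).
Let X t om : R * R := coordinate t (Y om).
Hypothesis rho0 : 0 < rho.
Hypothesis sysX : coalescing_system Pr rho X.
Variable f : R * R -> R.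
Hypothesis Df : calD f.

Let mX r : 0 <= r -> measurable_fun setT (X r).
Proof. by move=> r0; apply: measurableT_comp; first exact: measurable_coordinate. Qed.

Lemma G0_bounded : exists2 C, 0 <= C & forall x, `|G0 rho f x| <= C.
Proof.
have [_ [d1 [d2 [d11 [d12 [d22]]]]]] := calD_taylor rho Df.
move=> [[_ _ [_ [C1 h1]] _ [_ [C2 h2]]] _ GE _].
have C10 := le_trans (normr_ge0 _) (h1 (0, 0)); have C20 := le_trans (normr_ge0 _) (h2 (0, 0)).
have r2 : 0 <= 2^-1 * rho by rewrite mulr_ge0// ltW.
exists (2^-1 * rho * (C1 + C2)); first by rewrite mulr_ge0// addr_ge0.
move=> x; rewrite GE normrM (ger0_norm r2) ler_wpM2l//.
by apply: le_trans (ler_normD _ _) _; rewrite lerD.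
Qed.

(** Over n steps, the one-step errors add up to at most e * (t - s + 1) plus a
    multiple of 1 / n, because the terms with separation_mass telescope. *)
Lemma martingale_increment s t A : 0 <= s -> s <= t -> natural_filtration X s A ->
  \int[Pr]_(om in A) f (X t om) - \int[Pr]_(om in A) f (X s om) =
  \int[Pr]_(om in A) (time_integral (G0 rho f) t (Y om) - time_integral (G0 rho f) s (Y om)).
Proof.
move=> s0; rewrite le_eqVlt => /predU1P[<- FA|st FA].
  by rewrite subrr; under eq_Rintegral do rewrite subrr; rewrite Rintegral_cst ?mul0r//; exact: natural_filtration_measurable FA.
have [cG _] := calD_taylor rho Df.
have [C C0 GC] := G0_bounded.
have mA : measurable A by exact: natural_filtration_measurable FA.
have Poo := probability_lty Pr mA.
pose h (n : nat) := (t - s) / n.+1%:R.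
have h0 n : 0 < h n by rewrite divr_gt0// subr_gt0.
pose u n (j : nat) := s + j%:R * h n.
have u0 n j : 0 <= u n j by rewrite addr_ge0// mulr_ge0// ltW.
have su n j : s <= u n j by rewrite lerDl mulr_ge0// ltW.
have uS n j : u n j.+1 = u n j + h n by rewrite /u -natr1; ring.
have un n : u n n.+1 = t by rewrite /u /h; field.
have bG : bounded_measurable (G0 rho f).
  by split; [exact: continuous_measurable_fun2|exists C].
pose G n j := \int[Pr]_(om in A) G0 rho f (X (u n j) om).
have Gi n j : has_integral Pr A (fun om => h n * G0 rho f (X (u n j) om)) (h n * G n j).
  apply: has_integralZ => //; split => //.
  apply: (@bounded_integrable _ _ _ _ _ _ C) => //.
  by apply: measurable_funTS; apply: measurableT_comp (mX (u0 n j)); exact: continuous_measurable_fun2.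
pose r n om := \sum_(0 <= j < n.+1) h n * G0 rho f (X (u n j) om).
have ri n : \int[Pr]_(om in A) r n om = \sum_(0 <= j < n.+1) h n * G n j.
  suff H m : has_integral Pr A (fun om => \sum_(0 <= j < m) h n * G0 rho f (X (u n j) om))
      (\sum_(0 <= j < m) h n * G n j) by case: (H n.+1).
  elim: m => [|m IH].
    under eq_fun do rewrite big_geq//; rewrite big_geq//.
    split; first exact: finite_measure_integrable_cst.
    by rewrite Rintegral_cst// mul0r.
  under eq_fun do rewrite big_nat_recr//; rewrite big_nat_recr//=.
  exact: has_integralD.
pose I v := \int[Pr]_(om in A) f (X v om).
rewrite -/(I t) -/(I s).
pose L := \int[Pr]_(om in A) (time_integral (G0 rho f) t (Y om) - time_integral (G0 rho f) s (Y om)).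
rewrite -/L.
have cL : \int[Pr]_(om in A) r n om @[n --> \oo] --> L.
  apply: (@bounded_cvg_integral _ _ _ _ _ r _ (C * (t - s))) => //.
  - move=> n; apply: measurable_funTS; apply: measurable_sum => j; apply: measurable_funM => //.
    by apply: measurableT_comp (mX (u0 n j)); exact: continuous_measurable_fun2.
  - move=> n om _; apply: (le_trans (ler_norm_sum _ _ _)).
    have -> : C * (t - s) = \sum_(0 <= j < n.+1) h n * C.
      by rewrite sumr_const_nat subn0 -mulr_natr /h; field.
    by apply: ler_sum => j _; rewrite normrM (gtr0_norm (h0 n)) ler_wpM2l// ltW.
  - by move=> om _; exact: cvg_time_riemann_sum cG s0 (ltW st).
have bound (e : R) : 0 < e -> `|I t - I s - L| <= e * (t - s + 1).
  move=> e0.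
  have [K K0 step] := coalescing_one_step mX rho0 sysX Df e0.
  have bn n : `|I t - I s - \int[Pr]_(om in A) r n om| <= e * (t - s + 1) + K * (t - s) ^+ 2 * n.+1%:R^-1.
    have uv n' j : I (u n' j.+1) - I (u n' j) =
        \int[Pr]_(om in A) (f (X (u n' j + h n') om) - f (X (u n' j) om)).
      have v0 : 0 <= u n' j + h n' by rewrite addr_ge0// ltW.
      have bf := calD_bounded Df.
      have H1 := bounded_measurable_integral Pr mX mA v0 bf.
      have H2 := bounded_measurable_integral Pr mX mA (u0 n' j) bf.
      by case: (has_integralB mA H1 H2) => _ ->; rewrite uS.
    have -> : I t - I s = \sum_(0 <= j < n.+1) (I (u n j.+1) - I (u n j)).
      by rewrite (telescope_sumr (fun j => I (u n j)))// un /u mul0r addr0.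
    rewrite ri -sumrB; apply: (le_trans (ler_norm_sum _ _ _)).
    pose q j := separation_mass Pr X A (u n j).
    have hj j : `|I (u n j.+1) - I (u n j) - h n * G n j| <=
        (e * h n + K * h n ^+ 2) + - e * (q j.+1 - q j).
      have FAj : natural_filtration X (u n j) A by apply: natural_filtrationS FA.
      rewrite uv; apply: (le_trans (step _ _ _ (u0 n j) (h0 n) FAj)).
      by rewrite /q uS le_eqVlt; apply/orP; left; apply/eqP; ring.
    apply: (le_trans (ler_sum _ (fun j _ => hj j))).
    have -> : \sum_(0 <= j < n.+1) (e * h n + K * h n ^+ 2 + - e * (q j.+1 - q j)) =
        (e * h n + K * h n ^+ 2) * n.+1%:R + - e * (q n.+1 - q 0%N).
      by rewrite big_split/= -mulr_sumr telescope_sumr// sumr_const_nat subn0 mulr_natr.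
    have q0 : 0 <= q 0%N <= 1 by exact: separation_mass_bounds.
    have q1 : 0 <= q n.+1 <= 1 by exact: separation_mass_bounds.
    have -> : (e * h n + K * h n ^+ 2) * n.+1%:R =
        e * (t - s) + K * (t - s) ^+ 2 * n.+1%:R^-1 by rewrite /h; field.
    have eq : - e * (q n.+1 - q 0%N) <= e.
      rewrite mulNr -mulrN opprB -[leRHS]mulr1 ler_wpM2l ?(ltW e0)//.
      by move: q0 q1 => /andP[_ ?] /andP[? _]; lra.
    by rewrite [e * (t - s + 1)]mulrDr mulr1 addrAC lerD2r lerD2l.
  have lim1 : `|I t - I s - \int[Pr]_(om in A) r n om| @[n --> \oo] --> `|I t - I s - L|.
    by apply: cvg_norm; apply: cvgB => //; exact: cvg_cst.
  have lim2 : e * (t - s + 1) + K * (t - s) ^+ 2 * n.+1%:R^-1 @[n --> \oo] -->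
      e * (t - s + 1) + K * (t - s) ^+ 2 * 0.
    by apply: cvgD; [exact: cvg_cst|apply: cvgMr; exact: cvg_harmonic].
  have le : `|I t - I s - L| <= e * (t - s + 1) + K * (t - s) ^+ 2 * 0.
    exact: (ler_cvg_to lim1 lim2 (nearW _ bn)).
  by move: le; rewrite mulr0 addr0.
apply/eqP; rewrite -subr_eq0 -normr_le0; apply/ler_addgt0Pl => e e0; rewrite addr0.
have ts : 0 < t - s + 1 by rewrite addr_gt0// subr_gt0.
have := bound (e / (t - s + 1)); rewrite divr_gt0// => /(_ isT).
by rewrite divfK// gt_eqF.
Qed.

End martingale_increment.

(** * The coalescing pair solves the martingale problem *)

Lemma martingale_of_Rintegral (R : realType) d (T : measurableType d)
    (P : probability T R) (F : R -> set (set T)) (M : R -> T -> R) :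
  adapted F M -> (forall t, 0 <= t -> P.-integrable setT (EFin \o M t)) ->
  (forall s t A, 0 <= s -> s <= t -> F s A -> measurable A /\
     \int[P]_(om in A) M t om = \int[P]_(om in A) M s om) ->
  martingale P F M.
Proof.
move=> ad Mi ME; split => // s t s0 st A FA; have t0 := le_trans s0 st.
have [mA E] := ME s t A s0 st FA.
have Ei r : 0 <= r -> (\int[P]_(w in A) (M r w)%:E = (\int[P]_(w in A) M r w)%:E)%E.
  move=> r0; rewrite /Rintegral fineK//; apply: integrable_fin_num => //.
  exact: integrableS (Mi r r0).
by rewrite (Ei t t0) (Ei s s0) E.
Qed.

Section coalescing_solution.
Context {R : realType} {d : measure_display} {Omega : measurableType d}.
Variables (Pr : probability Omega R) (rho : R) (Y : {mfun Omega >-> path_space R}).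
Let X t om : R * R := coordinate t (Y om).
Hypothesis rho0 : 0 < rho.
Hypothesis sysX : coalescing_system Pr rho X.

Let P : probability (path_space R) R := distribution Pr Y.

Let mX r : 0 <= r -> measurable_fun setT (X r).
Proof. by move=> r0; apply: measurableT_comp; first exact: measurable_coordinate. Qed.

(** A generator of the past on the path space is pulled back to a generator. *)
Lemma natural_filtration_pullback s A : natural_filtration (@coordinate R) s A ->
  natural_filtration X s (Y @^-1` A).
Proof.
move=> FA.
pose GX := \bigcup_(r in `[0, s]) preimage_set_system setT (X r) measurable.
pose GC := \bigcup_(r in `[0, s]) preimage_set_system setT (@coordinate R r) measurable.
have mY : measurable_fun (setT : set (g_sigma_algebraType GX))
    (Y : g_sigma_algebraType GX -> g_sigma_algebraType GC).
  apply: (@measurability _ _ (g_sigma_algebraType GX) (g_sigma_algebraType GC) _ _ GC erefl).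
  move=> _ [B [r rs [E mE <-]] <-]; apply: sub_sigma_algebra; exists r => //.
  by exists E => //; rewrite !setTI.
by have := mY measurableT A FA; rewrite setTI.
Qed.

Lemma Rintegral_distribution (g : path_space R -> R) (C : R) A : measurable A ->
  measurable_fun setT g -> (forall w, `|g w| <= C) ->
  \int[P]_(w in A) g w = \int[Pr]_(om in Y @^-1` A) g (Y om).
Proof.
move=> mA mg gC; rewrite /Rintegral; congr fine.
have mYA : measurable (Y @^-1` A) by rewrite -[X in measurable X]setTI; exact: measurable_funP.
rewrite integral_pushforward//=.
  by apply/measurable_EFinP; exact: measurable_funTS.
apply: (@bounded_integrable _ _ _ _ _ (g \o Y) C) => //.
  exact: probability_lty.
  by apply: measurable_funTS; exact: measurableT_comp.
by move=> om _; exact: gC.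
Qed.

Lemma coalescing_solves_martingale_problem :
  solves_martingale_problem P rho (@coordinate R).
Proof.
split; first by move=> w; exact: continuous_coordinate.
move=> f Df; have [cG _] := calD_taylor rho Df.
have [C C0 GC] := G0_bounded rho0 Df.
have [mf [Cf fC]] := calD_bounded Df.
pose J := time_integral (G0 rho f).
pose M t w := f (coordinate t w) - f (coordinate 0 w) - J t w.
rewrite -[X in martingale _ _ X]/M.
have MC t w : 0 <= t -> `|M t w| <= Cf + Cf + C * t.
  move=> t0; apply: (le_trans (ler_normB _ _)); apply: lerD.
    by apply: (le_trans (ler_normB _ _)); apply: lerD.
  exact: time_integral_bound.
have mM t : 0 <= t -> measurable_fun setT (M t).
  move=> t0; apply: measurable_funB.
    by apply: measurable_funB; apply: measurableT_comp => //; exact: measurable_coordinate.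
  apply: (@measurable_time_integral R _ _ id) => // r r0 _; exact: measurable_coordinate.
apply: martingale_of_Rintegral.
- move=> t t0 E mE.
  pose G := \bigcup_(r in `[0, t]) preimage_set_system setT (@coordinate R r) measurable.
  have mc r : 0 <= r -> r <= t ->
      measurable_fun (setT : set (g_sigma_algebraType G)) (@coordinate R r).
    by move=> r0 rt _ B mB; rewrite setTI; exact: natural_filtration_preimage.
  have mMG : measurable_fun (setT : set (g_sigma_algebraType G)) (M t).
    apply: measurable_funB.
      by apply: measurable_funB; apply: measurableT_comp => //; exact: mc.
    exact: (@measurable_time_integral R _ (g_sigma_algebraType G) id).
  by have := mMG measurableT E mE; rewrite setTI.
- move=> t t0; apply: (@bounded_integrable _ _ _ P _ (M t) (Cf + Cf + C * t)) => //.
  + exact: probability_lty.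
  + exact: mM.
  + by move=> w _; exact: MC.
- move=> s t A s0 st FA; have t0 := le_trans s0 st.
  have mA : measurable A.
    by apply: natural_filtration_measurable FA => r r0; exact: measurable_coordinate.
  have FA' := natural_filtration_pullback FA.
  have mA' : measurable (Y @^-1` A) by exact: natural_filtration_measurable FA'.
  split; first exact: mA.
  rewrite (Rintegral_distribution mA (mM t t0) (fun w => MC t w t0)).
  rewrite (Rintegral_distribution mA (mM s s0) (fun w => MC s w s0)).
  have Hf r : 0 <= r -> has_integral Pr (Y @^-1` A) (fun om => f (X r om))
      (\int[Pr]_(om in Y @^-1` A) f (X r om)).
    by move=> r0; apply: bounded_measurable_integral => //; exact: calD_bounded.
  have HJ r : 0 <= r -> has_integral Pr (Y @^-1` A) (fun om => J r (Y om))
      (\int[Pr]_(om in Y @^-1` A) J r (Y om)).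
    move=> r0; split => //; apply: (@bounded_integrable _ _ _ _ _ _ (C * r)) => //.
    + exact: probability_lty.
    + apply: measurable_funTS.
      by apply: measurable_time_integral => // q q0 _; exact: mX.
    + by move=> om _; exact: time_integral_bound.
  have HM r (r0 : 0 <= r) := has_integralB mA' (has_integralB mA' (Hf r r0) (Hf 0 (lexx 0))) (HJ r r0).
  have [_ ->] := HM t t0; have [_ ->] := HM s s0.
  have [_ EJ] := has_integralB mA' (HJ t t0) (HJ s s0).
  have EI := martingale_increment rho0 sysX Df s0 st FA'.
  have alg (a b c e z : R) : a - b = c - e -> a - z - c = b - z - e.
    move=> h; apply/eqP; rewrite -subr_eq0.
    have -> : a - z - c - (b - z - e) = a - b - (c - e) by ring.
    by rewrite h subrr.
  by apply: alg; rewrite -EJ; exact: EI.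
Qed.

End coalescing_solution.
Theorem theorem2p1 (R : realType) (rho b1 b2 : R) (rho_gt0 : 0 < rho)
    (d : measure_display) (Omega : measurableType d) (Pr : probability Omega R)
    (Y : {mfun Omega >-> path_space R})
    (Y_system : coalescing_system Pr rho (fun t om => coordinate t (Y om)))
    (Y_init : Pr [set om | coordinate 0 (Y om) = (b1, b2)] = 1%E) :
  let P : probability (path_space R) R := distribution Pr Y in
  (P [set w | coordinate 0 w = (b1, b2)] = 1%E /\
   solves_martingale_problem P rho (@coordinate R)) /\
  (forall Q : probability (path_space R) R,
     Q [set w | coordinate 0 w = (b1, b2)] = 1%E ->
     solves_martingale_problem Q rho (@coordinate R) ->
     forall A : set (path_space R), measurable A -> Q A = P A).
Proof.
have mpP := coalescing_solves_martingale_problem rho_gt0 Y_system.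
split; first by split.
move=> Q Q0 mpQ A mA.
exact: (martingale_problem_unique mpQ mpP Q0 Y_init mA).
Qed.
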